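(* Let $T>0$, let $f:[0,1]\to\mathbb{R}$ be a bounded Lipschitz function, and let $v:\mathcal{M}([0,1])\times[0,1]\to\mathbb{R}$, $(\mu,x)\mapsto v[\mu](x)$, satisfy: (i) $v[\mu]\in\mathrm{BL}([0,1])$ for each $\mu\in\mathcal{M}([0,1])$; and, for any $R>0$ there are constants $K_R,L_R,M_R$ such that for all $\mu,\nu\in\mathcal{M}([0,1])$ with $\|\mu\|_{\mathrm{TV}}\leq R$ and $\|\nu\|_{\mathrm{TV}}\leq R$: (ii) $\|v[\mu]\|_\infty\leq K_R$; (iii) $|v[\mu]|_{\mathrm{L}}\leq L_R$; (iv) $\|v[\mu]-v[\nu]\|_\infty\leq M_R\,\|\mu-\nu\|^*_{\mathrm{BL}}$. Let $\nu_0\in\mathcal{M}^+([0,1])$ and let $\mu:[0,T]\to\mathcal{M}^+([0,1])$ be the (unique) mild solution, with initial value $\nu_0$, of $$\frac{\partial}{\partial t}\mu_t+\frac{\partial}{\partial x}(v[\mu_t]\,\mu_t)=f\cdot\mu_t .$$ Then $\mu$ is a weak solution of this equation corresponding to the initial condition $\nu_0$; that is, $$\langle\mu_T,\psi(\cdot,T)\rangle-\langle\nu_0,\psi(\cdot,0)\rangle=\int_0^T\big\langle\mu_t,\ \partial_t\psi(\cdot,t)+\partial_x\psi(\cdot,t)\cdot v[\mu_t]\big\rangle\,dt+\int_0^T\big\langle f\cdot\mu_t,\ \psi(\cdot,t)\big\rangle\,dt$$ for all $$\psi\in\Lambda^T:=\Big\{\psi\in C^1([0,1]\times[0,T])\ :\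 \partial_x\psi(0,t)=\partial_x\psi(1,t)=0\ \text{ for all } 0\leq t\leq T\Big\}.$$
   Context: **Measures and norms.** $\mathcal{M}([0,1])$ is the space of finite (signed) Borel measures on $[0,1]$, and $\mathcal{M}^+([0,1])$ its cone of positive measures. For $\mu\in\mathcal{M}([0,1])$ and a bounded measurable $\phi:[0,1]\to\mathbb{R}$, $\langle\mu,\phi\rangle:=\int_{[0,1]}\phi\,d\mu$. The measure $f\cdot\mu$ is the one with density $f$ with respect to $\mu$. $\|\cdot\|_{\mathrm{TV}}$ is the total variation norm, $\|\mu\|_{\mathrm{TV}}=\sup\{\langle\mu,\phi\rangle:\phi\in C_b([0,1]),\ \|\phi\|_\infty\leq1\}$. $\mathrm{BL}([0,1])$ is the space of real-valued bounded Lipschitz functions on $[0,1]$ with norm $\|\phi\|_{\mathrm{BL}}:=\|\phi\|_\infty+|\phi|_{\mathrm{L}}$, where $|\phi|_{\mathrm{L}}$ is the (smallest) Lipschitz constant of $\phi$. The dual bounded Lipschitz norm on $\mathcal{M}([0,1])$ is $\|\mu\|^*_{\mathrm{BL}}:=\sup\{|\langle\mu,\phi\rangle|:\phi\in\mathrm{BL}([0,1]),\ \|\phi\|_{\mathrm{BL}}\leq1\}$. $\mathcal{M}([0,1])_{\mathrm{BL}}$ denotes $\mathcal{M}([0,1])$ with this norm, and its completion is its closure in $\mathrm{BL}([0,1])^*$ (via $\mu\mapsto\langle\mu,\cdot\rangle$). $C([0,T];\mathcal{M}([0,1]))$ is the space of maps $[0,T]\to\mathcal{M}([0,1])$ continuous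 for $\|\cdot\|^*_{\mathrm{BL}}$, endowed with the metric $\sup_{t\in[0,T]}\|\mu_t-\nu_t\|^*_{\mathrm{BL}}$. **Stopped flow for a fixed velocity $u\in\mathrm{BL}([0,1])$.** For $x_0\in[0,1]$ let $x(\cdot\,;x_0)$ be the unique solution in $[0,1]$ of $\dot x(t)=u(x(t))$, $x(0)=x_0$, with maximal interval of existence $I_{x_0}\subset[0,\infty)$ (i.e. as long as the solution remains in $[0,1]$), and let $\tau_\partial(x_0):=\sup I_{x_0}\in[0,\infty]$. In particular $\tau_\partial(x_0)=0$ if $x_0$ is a boundary point where $u$ points outwards. The stopped flow is, for $t\geq0$, $\Phi_t(x_0):=x(t;x_0)$ if $t\in I_{x_0}$ and $\Phi_t(x_0):=x(\tau_\partial(x_0);x_0)$ otherwise. Define $P_t\mu:=\Phi_t\#\mu=\mu\circ\Phi_t^{-1}$ for $\mu\in\mathcal{M}([0,1])$. **Mild solutions for fixed velocity; the semigroup $Q^u$.** For fixed $u\in\mathrm{BL}([0,1])$ and initial value $\nu\in\mathcal{M}([0,1])$, a mild solution on $[0,S]$ is a continuous map $\mu:[0,S]\to\mathcal{M}([0,1])_{\mathrm{BL}}$ that is $\|\cdot\|_{\mathrm{TV}}$-bounded and satisfies $$\mu_t=P_t\nu+\int_0^tP_{t-s}\big(f\cdot\mu_s\big)\,ds\qquad\text{for all }t\in[0,S],$$ where the integral is with respect to $\|\cdot\|^*_{\mathrm{BL}}$ (Bochner integral in the completion of $\mathcal{M}([0,1])_{\mathrm{BL}}$). For $f\in\mathrm{BL}([0,1])$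 it is known to exist and be unique for every $S\geq0$. For $t\geq0$, $Q^u_t:\mathcal{M}([0,1])\to\mathcal{M}([0,1])$ is the operator mapping the initial value $\nu$ to the value $\mu_t$ of this solution at time $t$. **Euler approximations.** Let $\alpha=\{t_0,\dots,t_N\}\subset[0,T]$ with $N\geq1$, $0=t_0<t_1<\dots<t_N=T$, be a partition of $[0,T]$. The Euler approximation with partition $\alpha$ and initial value $\nu_0$ is the trajectory $\mu\in C([0,T];\mathcal{M}([0,1]))$ with $\mu_{0}=\nu_0$ and, for all $j\in\{0,\dots,N-1\}$, $$\mu_t:=Q^{v_j}_{t-t_j}\mu_{t_j}\quad\text{for }t\in(t_j,t_{j+1}],\qquad v_j:=v[\mu_{t_j}].$$ **Mild solution for measure-dependent velocity.** Consider sequences of partitions $(\alpha_k)_{k\in\mathbb{N}}$, $\alpha_k=\{t^k_0,\dots,t^k_{N_k}\}$ with $0=t^k_0<\dots<t^k_{N_k}=T$, such that the mesh sizes $M^{(k)}:=\max_{0\leq j\leq N_k-1}(t^k_{j+1}-t^k_j)$ form a nonincreasing sequence with $M^{(k)}\to0$ as $k\to\infty$. For each $k$ let $\mu^k$ be the Euler approximation with partition $\alpha_k$ and initial value $\nu_0$. Any limit, in the metric $\sup_{t\in[0,T]}\|\cdot\|^*_{\mathrm{BL}}$, of a subsequence of $(\mu^k)_{k\in\mathbb{N}}$ for any such sequence of partitions is called a (measure-valued) mild solution with initial value $\nu_0$. It is known that, under conditions (i)–(iv), for $f\in\mathrm{BL}([0,1])$ and $\nu_0\in\mathcal{M}^+([0,1])$,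 there is exactly one mild solution: for each such sequence of partitions, $(\mu^k)_{k\in\mathbb{N}}$ is a sequence in $C([0,T];\mathcal{M}^+([0,1]))$ that converges, and the limit lies in $C([0,T];\mathcal{M}^+([0,1]))$ and is independent of the choice of $(\alpha_k)_{k\in\mathbb{N}}$. *)

(* Defs.v *)
From HB Require Import structures.
From mathcomp Require Import all_boot all_order all_algebra.
From mathcomp Require Import all_classical all_reals all_analysis.

Set Implicit Arguments.
Unset Strict Implicit.
Unset Printing Implicit Defensive.

Import Order.TTheory GRing.Theory Num.Theory.
Import numFieldNormedType.Exports.

Local Open Scope classical_set_scope.
Local Open Scope ring_scope.

(* The space [0,1], with the subspace topology and its Borel sigma-algebra
   (the traces on [0,1] of the Borel sets of R). *)
Definition I01 (R : realType) : Type := set_type (`[0, 1]%classic : set R).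

Section unit_interval.
Context {R : realType}.

Fact zero_in_I01 : (0 : R) \in (`[0, 1]%classic : set R).
Proof. by rewrite inE /= in_itv /= lexx ler01. Qed.

HB.instance Definition _ :=
  Topological.copy (I01 R) (set_type (`[0, 1]%classic : set R)).
HB.instance Definition _ :=
  isPointed.Build (I01 R) (exist _ (0 : R) zero_in_I01).
HB.instance Definition _ := Measurable.copy (I01 R)
  (g_sigma_algebra_preimageType (fun x : I01 R => \val x : R)).

End unit_interval.

(* Finite signed Borel measures on [0,1].  A charge is a function on all sets
   whose values on non-measurable sets are irrelevant, hence [charge_eq]. *)
Notation M01 R := ({charge set (I01 R) -> \bar R}%type).

Section measures.
Context {R : realType}.
Implicit Types (mu nu : M01 R) (phi f : I01 R -> R) (l : (I01 R -> R) -> R).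

Definition charge_eq mu nu := forall A, measurable A -> mu A = nu A.

Definition positive_charge mu := forall A, measurable A -> (0 <= mu A)%E.

Fact hahn_pair mu :
  {PN : set (I01 R) * set (I01 R) | hahn_decomposition mu PN.1 PN.2}.
Proof.
by apply: cid; have [P [N PN]] := Hahn_decomposition mu; exists (P, N).
Qed.

Definition pos_part mu := jordan_pos (svalP (hahn_pair mu)).
Definition neg_part mu := jordan_neg (svalP (hahn_pair mu)).

Definition pairing mu phi : R :=
  \int[pos_part mu]_x phi x - \int[neg_part mu]_x phi x.

(* The measure with density [f]; the junk value [czero] is taken only when [f]
   is not integrable, which does not happen for bounded measurable [f]. *)
Definition density f mu : M01 R :=
  match pselect ((pos_part mu).-integrable setT (EFin \o f)),
        pselect ((neg_part mu).-integrable setT (EFin \o f)) with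
  | left ip, left im => cadd (induced_charge ip) (copp (induced_charge im))
  | _, _ => czero
  end.

(* Image measure [pushforward mu g], with junk value [czero] for a non-measurable map. *)
Definition image_charge (g : I01 R -> I01 R) mu : M01 R :=
  match pselect (measurable_fun setT g) with
  | left mg => measure_function_pushforward__canonical__charge_Charge mu mg
  | right _ => czero
  end.

Definition sup_norm phi : \bar R := ereal_sup [set (`|phi x|)%:E | x in setT].

(* [+oo] when [phi] is not Lipschitz *)
Definition lip_const phi : \bar R :=
  ereal_inf [set L%:E | L in
    [set L : R | 0 <= L /\
      forall x y, `|phi x - phi y| <= L * `|\val x - \val y|]].

Definition BL_norm phi : \bar R := (sup_norm phi + lip_const phi)%E.

Definition BL phi : Prop := (BL_norm phi < +oo)%E.

Definition TV_norm mu : \bar R :=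
  ereal_sup [set (pairing mu phi)%:E | phi in
    [set phi | continuous phi /\ (sup_norm phi <= 1)%E]].

(* The norm of BL([0,1])^*.  It is defined on all maps
   [(I01 R -> R) -> R] but only depends on their values on BL functions. *)
Definition BL_dual_norm l : \bar R :=
  ereal_sup [set (`|l phi|)%:E | phi in [set phi | (BL_norm phi <= 1)%E]].

Definition BL_dist mu nu : \bar R := BL_dual_norm (pairing mu - pairing nu).

Definition BL_completion : set ((I01 R -> R) -> R) :=
  [set l | (forall (a : R) phi chi, BL phi -> BL chi ->
              l (fun x => a * phi x + chi x) = a * l phi + l chi) /\
           (forall e : R, 0 < e ->
              exists mu, (BL_dual_norm (l - pairing mu)%R < e%:E)%E)].

Definition BL_continuous (T : R) (m : R -> M01 R) :=
  forall t, `[0, T]%classic t ->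
    BL_dist (m s) (m t) @[s --> within `[0, T]%classic (nbhs t)] --> 0%E.

Definition TV_bounded (T : R) (m : R -> M01 R) :=
  exists C : R, forall t, `[0, T]%classic t -> (TV_norm (m t) <= C%:E)%E.

End measures.

(* Bochner integral with respect to Lebesgue measure for maps into a space [K]
   of vectors of [E], with a possibly degenerate norm [N]; the value is then
   determined up to vectors of norm 0. *)
Section bochner.
Context {R : realType} {E : lmodType R} (N : E -> \bar R) (K : set E).

Record simple_map := SimpleMap {
  sm_size : nat;
  sm_set : 'I_sm_size -> set R;
  sm_val : 'I_sm_size -> E }.

Definition simple_map_on (D : set R) (s : simple_map) :=
  forall i : 'I_(sm_size s), [/\ measurable (sm_set i), sm_set i `<=` D,
    (lebesgue_measure (sm_set i) < +oo)%E & K (sm_val i)].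

Definition simple_eval (s : simple_map) (x : R) : E :=
  \sum_(i < sm_size s) (\1_(sm_set i) x : R) *: sm_val i.

Definition simple_integral (s : simple_map) : E :=
  \sum_(i < sm_size s) fine (lebesgue_measure (sm_set i)) *: sm_val i.

Definition bochner_integral (D : set R) (F : R -> E) (I : E) : Prop :=
  K I /\ exists s : nat -> simple_map,
  [/\ forall n, simple_map_on D (s n),
      {ae (@lebesgue_measure R), forall x, D x ->
         N (F x - simple_eval (s n) x) @[n --> \oo] --> 0%E},
      (\int[lebesgue_measure]_(x in D) N (F x - simple_eval (s n) x)%R)%E
         @[n --> \oo] --> 0%E &
      N (I - simple_integral (s n)) @[n --> \oo] --> 0%E].

End bochner.

(* one-sided at the endpoints when [J] is an interval *)
Definition derivative_within {R : realType} (J : set R) (g : R -> R) (t l : R) :=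
  (g r - g t) / (r - t) @[r --> within J t^'] --> l.

Section stopped_flow.
Context {R : realType}.
Implicit Types (u : I01 R -> R) (x : R -> I01 R).

Definition solves u (x0 : I01 R) (J : set R) x :=
  x 0 = x0 /\
  forall t, J t -> derivative_within J (fun s => \val (x s)) t (u (x t)).

Definition existence_interval u (x0 : I01 R) : set R :=
  [set t | 0 <= t /\ exists x, solves u x0 `[0, t]%classic x].

Definition maximal_solution u (x0 : I01 R) : R -> I01 R :=
  xget (cst x0) [set x | solves u x0 (existence_interval u x0) x].

Definition exit_time u (x0 : I01 R) : \bar R :=
  ereal_sup [set t%:E | t in existence_interval u x0].

Definition flow u (t : R) (x0 : I01 R) : I01 R :=
  maximal_solution u x0
    (if `[< existence_interval u x0 t >] then t else fine (exit_time u x0)).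

Definition P u (t : R) (mu : M01 R) : M01 R := image_charge (flow u t) mu.

End stopped_flow.

Section mild.
Context {R : realType}.
Implicit Types (f u : I01 R -> R) (nu rho : M01 R) (mu m : R -> M01 R).

Definition mild_fixed f u (S : R) nu m :=
  [/\ BL_continuous S m, TV_bounded S m &
      forall t, `[0, S]%classic t ->
        exists B, bochner_integral BL_dual_norm BL_completion `[0, t]%classic
                    (fun s => pairing (P u (t - s) (density f (m s)))) B /\
          forall phi, BL phi ->
            pairing (m t) phi = pairing (P u t nu) phi + B phi].

(* Graph of the operator Q^u_t: [rho] is the value at time [t] of the mild
   solution for the velocity [u] started at [nu]. *)
Definition Q f u (t : R) nu rho :=
  exists S m, [/\ 0 <= t <= S, mild_fixed f u S nu m & charge_eq (m t) rho].

(* A partition of [0, T] is given by the list of its points after 0. *)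
Definition part_pt (T : R) (s : seq R) (j : nat) : R := nth T (0 :: s) j.

Definition mesh (T : R) (s : seq R) : R :=
  \big[Num.max/0]_(j < size s) (part_pt T s j.+1 - part_pt T s j).

Definition euler f (v : M01 R -> I01 R -> R) (T : R) (s : seq R) nu0 mu :=
  [/\ itv_partition 0 T s, BL_continuous T mu, charge_eq (mu 0) nu0 &
      forall j, (j < size s)%N ->
      forall t, part_pt T s j < t <= part_pt T s j.+1 ->
        Q f (v (mu (part_pt T s j))) (t - part_pt T s j)
          (mu (part_pt T s j)) (mu t)].

Definition mild_solution f (v : M01 R -> I01 R -> R) (T : R) nu0 mu :=
  BL_continuous T mu /\
  exists (alpha : nat -> seq R) (muk : nat -> R -> M01 R) (sub : nat -> nat),
  [/\ nonincreasing_seq (fun k => mesh T (alpha k)),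
      mesh T (alpha k) @[k --> \oo] --> (0 : R),
      forall k, euler f v T (alpha k) nu0 (muk k),
      forall i j, (i < j)%N -> (sub i < sub j)%N &
      ereal_sup [set BL_dist (muk (sub n) t) (mu t) | t in `[0, T]%classic]
        @[n --> \oo] --> 0%E].

End mild.

(* [psi] is C^1 on [0,1] x [0,T] with partial derivatives [dx] and [dt];
   only the values on this rectangle matter. *)
Definition C1_rectangle {R : realType} (T : R) (psi dx dt : R -> R -> R) :=
  let K : set (R * R) := `[0, 1]%classic `*` `[0, T]%classic in
  [/\ {within K, continuous (fun p => psi p.1 p.2)},
      {within K, continuous (fun p => dx p.1 p.2)},
      {within K, continuous (fun p => dt p.1 p.2)} &
      forall x t, K (x, t) ->
        derivative_within `[0, 1]%classic (psi ^~ t) x (dx x t) /\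
        derivative_within `[0, T]%classic (psi x) t (dt x t)].

(* The test functions Lambda^T, given with their partial derivatives. *)
Definition test_function {R : realType} (T : R) (psi dx dt : R -> R -> R) :=
  C1_rectangle T psi dx dt /\
  forall t, 0 <= t <= T -> dx 0 t = 0 /\ dx 1 t = 0.

Definition weak_solution {R : realType} (f : I01 R -> R)
    (v : M01 R -> I01 R -> R) (T : R) (nu0 : M01 R) (mu : R -> M01 R) :=
  forall psi dx dt : R -> R -> R, test_function T psi dx dt ->
    pairing (mu T) (fun x => psi (\val x) T)
      - pairing nu0 (fun x => psi (\val x) 0)
    = \int[lebesgue_measure]_(t in `[0, T]%classic)
        pairing (mu t) (fun x => dt (\val x) t + dx (\val x) t * v (mu t) x)
      + \int[lebesgue_measure]_(t in `[0, T]%classic)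
        pairing (density f (mu t)) (fun x => psi (\val x) t).

(* Main.v *)
(* The solution is compared with Euler approximations at partition points only.

   On one Euler step of length h the velocity u is frozen.  A trajectory of the
   stopped flow either stays in [0,1], and then moves by h u(x) + O(h^2), or is
   stopped at an endpoint within distance O(h) of x; there the x-derivative of
   the test function vanishes, so in both cases
     psi(Phi_h x, t+h) - psi(x, t) = h (d_t psi + u d_x psi)(x, t) + o(h)
   uniformly in x.  Inserting this in Duhamel's formula shows that the Euler
   approximation satisfies the weak equation on each step up to o(h).  This only
   uses the Duhamel formula for a total-variation bound and a displacement bound,
   so neither uniqueness nor the semigroup property of Q is needed.

   Summing over the partition gives a Riemann sum of
   t |-> <mu_t, d_t psi + v[mu_t] d_x psi + f psi>.  This functional is uniformly
   continuous in (mu, t) for the dual bounded Lipschitz distance on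
   total-variation balls, because its integrands are equicontinuous and hence
   uniformly close to functions with a common Lipschitz constant. *)
Require Import Defs.
From HB Require Import structures.
From mathcomp Require Import all_boot all_order all_algebra.
From mathcomp Require Import all_classical all_reals all_analysis.
From mathcomp Require Import ring lra measurable_realfun.

Set Implicit Arguments.
Unset Strict Implicit.
Unset Printing Implicit Defensive.

Import Order.TTheory GRing.Theory Num.Theory.
Import numFieldNormedType.Exports.

Local Open Scope classical_set_scope.
Local Open Scope ring_scope.

(** * Charges on the unit interval *)

(** The definitions give little to compute with: the flow is a chosen maximal solution, the Bochner
    integral is a relation for a degenerate norm, the Jordan parts are chosen. Each is replaced by
    one usable fact. The velocity is extended to the real line by constants, so that a Picard
    solution exists for a short time; once outside [0,1] it moves at constant speed and never
    returns, hence its projection onto [0,1] is the stopped flow. A Bochner integral is only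
    estimated: if the integrand tested against phi stays within d of a constant c on [0,t], the
    integral stays within d t of c t. Identities between charges are checked on indicators.

    Total variation has to be bounded uniformly over all partitions. A step of length h with h F <=
    1/2 costs a factor 1 + 2 F h <= exp(2 F h), so the approximations of small mesh stay below r = A
    exp(2 F T), and the bounds on v are needed on that ball only.

    In the limit the sum is compared with a primitive of the limiting integrand, which turns
    convergence into a telescoping estimate. *)

Lemma clamp_lipschitz (R : realType) (a b s t : R) :
  `|Num.max a (Num.min b s) - Num.max a (Num.min b t)| <= `|s - t|.
Proof.
have max_lip (x y : R) : `|Num.max a x - Num.max a y| <= `|x - y|.
  by case: (leP a x) => ?; case: (leP a y) => ?; rewrite ler_norml;
    case: (ger0P (x - y)) => ?; apply/andP; split; lra.
have min_lip (x y : R) : `|Num.min b x - Num.min b y| <= `|x - y|.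
  by case: (leP b x) => ?; case: (leP b y) => ?; rewrite ler_norml;
    case: (ger0P (x - y)) => ?; apply/andP; split; lra.
by rewrite (le_trans (max_lip _ _)) ?min_lip.
Qed.

Section unit_interval_facts.
Context {R : realType}.
Implicit Types (phi chi : I01 R -> R) (mu nu : M01 R).

Fact proj01_subproof (y : R) :
  Num.max 0 (Num.min 1 y) \in (`[0, 1]%classic : set R).
Proof.
by rewrite inE /= in_itv /= le_max lexx /= ge_max ler01 ge_min lexx.
Qed.

(** Every function on [I01 R] factors as [(phi \o proj01) \o val], which reduces continuity and
    measurability on [0,1] to the real line. The same retraction later extends the velocity and
    projects trajectories. *)
Definition proj01 (y : R) : I01 R :=
  @exist R (fun z => z \in (`[0, 1]%classic : set R)) _ (proj01_subproof y).

Lemma I01_itv (x : I01 R) : 0 <= \val x <= 1.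
Proof. by case: x => y /=; rewrite inE /= in_itv. Qed.

Lemma proj01E (y : R) : \val (proj01 y) = Num.max 0 (Num.min 1 y).
Proof. by []. Qed.

Lemma proj01_id (y : R) : 0 <= y <= 1 -> \val (proj01 y) = y.
Proof. by move=> /andP[y0 y1]; rewrite proj01E min_r // max_r. Qed.

Lemma I01_inj (x y : I01 R) : \val x = \val y -> x = y.
Proof. exact: val_inj. Qed.

Lemma proj01K (x : I01 R) : proj01 (\val x) = x.
Proof. by apply: I01_inj; rewrite proj01_id // I01_itv. Qed.

Lemma proj01_lip (y z : R) : `|\val (proj01 y) - \val (proj01 z)| <= `|y - z|.
Proof.
by rewrite !proj01E clamp_lipschitz.
Qed.

Definition lipschitz_I01 (L : R) phi :=
  forall x y, `|phi x - phi y| <= L * `|\val x - \val y|.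

Lemma continuous_val_I01 : continuous (fun x : I01 R => \val x : R).
Proof. exact: (@initial_continuous (I01 R) R (fun x => \val x)). Qed.

Lemma lipschitz_R_continuous (L : R) (g : R -> R) :
  (forall y z, `|g y - g z| <= L * `|y - z|) -> continuous g.
Proof.
move=> gL y; apply/cvgrPdist_le => e e0.
have d0 : 0 < e / (`|L| + 1) by rewrite divr_gt0 // ltr_wpDl.
near=> z.
rewrite (le_trans (gL _ _)) //.
rewrite (@le_trans _ _ (`|L| * `|y - z|)) //.
  by rewrite ler_wpM2r ?normr_ge0 // ler_norm.
have : `|y - z| <= e / (`|L| + 1) by near: z; apply/nbhs_ballP; exists (e / (`|L| + 1)) => //= z /ltW.
move=> h; rewrite (@le_trans _ _ (`|L| * (e / (`|L| + 1)))) //.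
  by rewrite ler_wpM2l.
rewrite mulrCA ler_piMr ?(ltW e0) // ler_pdivrMr ?ltr_wpDl // mul1r lerDl //.
Unshelve. all: by end_near.
Qed.

Lemma lipschitz_I01_continuous (L : R) phi : lipschitz_I01 L phi -> continuous phi.
Proof.
move=> phiL.
have -> : phi = (phi \o proj01) \o (fun x : I01 R => \val x : R).
  by apply/funext => x /=; rewrite proj01K.
move=> x; apply: continuous_comp; first exact: continuous_val_I01.
apply: (@lipschitz_R_continuous `|L|) => y z /=.
apply: le_trans (phiL _ _) _; apply: (@le_trans _ _ (`|L| * `|\val (proj01 y) - \val (proj01 z)|)).
  by rewrite ler_wpM2r // ler_norm.
by rewrite ler_wpM2l // proj01_lip.
Qed.

Lemma continuous_proj01 : continuous proj01.
Proof.
apply/(@continuous_comp_initial (I01 R) _ _ (fun x => \val x : R) proj01).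
apply: (@lipschitz_R_continuous 1) => y z; rewrite mul1r; exact: proj01_lip.
Qed.

Lemma measurable_val_I01 : measurable_fun setT (fun x : I01 R => \val x : R).
Proof. by move=> _ A mA; exists A. Qed.

Lemma continuous_measurable_I01 phi : continuous phi -> measurable_fun setT phi.
Proof.
move=> cphi.
have -> : phi = (phi \o proj01) \o (fun x : I01 R => \val x : R).
  by apply/funext => x /=; rewrite proj01K.
apply: measurableT_comp; last exact: measurable_val_I01.
apply: continuous_measurable_fun => y; apply: continuous_comp; first exact: continuous_proj01.
exact: cphi.
Qed.

Lemma measurable_into_I01 (g : I01 R -> I01 R) :
  measurable_fun setT (fun x => \val (g x) : R) -> measurable_fun setT g.
Proof.
by move=> mg _ _ [B mB <-]; have := mg measurableT B mB; rewrite !setTI.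
Qed.

End unit_interval_facts.

Section uniform_continuity.
Context {R : realType}.

(** Compactness is used as the near-covering property: a radius that works near each point of [K]
    can be taken uniform over [K]. *)
Lemma compact_uniform_continuous (M : pseudoMetricType R) (K : set M) (g : M -> R) :
  compact K -> {within K, continuous g} ->
  forall e : R, 0 < e -> exists2 d : R, 0 < d &
    forall x y, K x -> K y -> ball x d y -> `|g x - g y| < e.
Proof.
move=> /compact_near_coveringP/near_covering_withinP cK /subspace_continuousP gc e e0.
have near_d : \forall d \near 0^'+, K `<=` (fun x => forall y, K y -> ball x d y -> `|g x - g y| < e).
  apply: cK => x Kx.
  have /cvgrPdist_lt /(_ (e / 2)) := gc x Kx; rewrite divr_gt0 // => /(_ isT).
  rewrite near_withinE => /nbhs_ballP[r /= r0 hr].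
  (* Half of the radius is spent on moving the centre from x to z, half on the distance from z to y,
     so both z and y lie in the ball of radius r around x. *)
  exists (ball x (r / 2), [set d | d < r / 2]) => /=.
    by split; [apply: nbhsx_ballx; rewrite divr_gt0|exact: nbhs_right_lt (divr_gt0 _ _)].
  move=> [z d] /= [xz dr] Kz y Ky zdy.
  have h1 : `|g x - g z| < e / 2.
    by apply: hr => //; apply: le_ball xz; rewrite ler_pdivrMr // ler_pMr // ler1n.
  have h2 : `|g x - g y| < e / 2.
    apply: hr => //; rewrite (splitr r); apply: ball_triangle xz _.
    by apply: le_ball zdy; exact: ltW.
  by rewrite (le_lt_trans (ler_distD (g x) _ _)) // (splitr e) ltrD // distrC.
have [d [d0 hd]] : exists d, 0 < d /\ K `<=` (fun x => forall y, K y -> ball x d y -> `|g x - g y| < e).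
  near (0 : R)^'+ => d; exists d; split => //.
  by near: d.
by exists d => // x y Kx Ky; exact: hd.
Unshelve. all: by end_near.
Qed.

End uniform_continuity.

(** * Pairing of a charge with bounded measurable functions *)

Section pairing_facts.
Context {R : realType}.
Implicit Types (phi chi : I01 R -> R) (mu nu : M01 R).

(** A class of integrands that contains the indicators, on which charges are compared, and is stable
    under products and under composition with the flow. *)
Definition bounded_measurable phi :=
  measurable_fun setT phi /\ exists C, forall x, `|phi x| <= C.

Lemma bounded_measurable_lin (a : R) phi chi : bounded_measurable phi ->
  bounded_measurable chi -> bounded_measurable (fun x => a * phi x + chi x).
Proof.
move=> [mphi [C hC]] [mchi [D hD]]; split.
  by apply: measurable_funD => //; apply: measurable_funM.
exists (`|a| * C + D) => x; rewrite (le_trans (ler_normD _ _)) // lerD //.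
by rewrite normrM ler_wpM2l.
Qed.

Lemma bounded_measurable_indic (A : set (I01 R)) : measurable A ->
  bounded_measurable (\1_A : I01 R -> R).
Proof.
move=> mA; split; first exact: measurable_indic.
by exists 1 => x; rewrite indicE; case: (_ \in _); rewrite ?normr1 ?normr0.
Qed.

Lemma bounded_measurableM phi chi : bounded_measurable phi ->
  bounded_measurable chi -> bounded_measurable (fun x => phi x * chi x).
Proof.
move=> [mphi [C hC]] [mchi [D hD]]; split; first exact: measurable_funM.
by exists (C * D) => x; rewrite normrM ler_pM.
Qed.

Lemma bounded_measurable_comp (g : I01 R -> I01 R) phi : measurable_fun setT g ->
  bounded_measurable phi -> bounded_measurable (phi \o g).
Proof.
move=> mg [mphi [C hC]]; split; first exact: measurableT_comp.
by exists C => x /=.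
Qed.

Lemma bounded_measurable_cst (c : R) : bounded_measurable (cst c).
Proof. by split; [exact: measurable_cst|exists `|c|]. Qed.

Section finite_measure_integral.
Variable m : {finite_measure set (I01 R) -> \bar R}.

Lemma bounded_measurable_integrable phi : bounded_measurable phi ->
  m.-integrable setT (EFin \o phi).
Proof.
move=> [mphi [C hC]]; apply: measurable_bounded_integrable => //.
  by rewrite -ge0_fin_numE ?measure_ge0 // fin_num_measure.
exists C; split; first exact: num_real.
by move=> D CD x _ /=; rewrite (le_trans (hC x)) // ltW.
Qed.

Lemma Rintegral_bounded_lin (a : R) phi chi : bounded_measurable phi ->
  bounded_measurable chi ->
  \int[m]_x (a * phi x + chi x) = a * \int[m]_x phi x + \int[m]_x chi x.
Proof.
move=> bphi bchi; rewrite RintegralD //.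
- by rewrite RintegralZl //; exact: bounded_measurable_integrable.
- have : bounded_measurable (fun x => a * phi x + 0).
    exact: bounded_measurable_lin (bounded_measurable_cst 0).
  by under eq_fun do rewrite addr0; exact: bounded_measurable_integrable.
- exact: bounded_measurable_integrable.
Qed.

Lemma Rintegral_bounded_le phi c : bounded_measurable phi ->
  (forall x, `|phi x| <= c) -> `|\int[m]_x phi x| <= c * fine (m setT).
Proof.
move=> bphi hc.
have ibphi := bounded_measurable_integrable bphi.
rewrite (le_trans (le_normr_Rintegral measurableT ibphi)) //.
rewrite -(Rintegral_cst m measurableT c); apply: le_Rintegral => //.
  exact: integrable_norm ibphi.
exact: (bounded_measurable_integrable (bounded_measurable_cst c)).
Qed.

Lemma fine_setT_ge0 : 0 <= fine (m setT).
Proof. exact: fine_ge0. Qed.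

Lemma Rintegral_indicT (A : set (I01 R)) : measurable A ->
  \int[m]_x (\1_A x : R) = fine (m A).
Proof. by move=> mA; rewrite /Rintegral integral_indic // setIT. Qed.

End finite_measure_integral.

Lemma pairing_lin mu (a : R) phi chi : bounded_measurable phi ->
  bounded_measurable chi ->
  pairing mu (fun x => a * phi x + chi x) = a * pairing mu phi + pairing mu chi.
Proof.
move=> bphi bchi.
have gen (m1 m2 : {finite_measure set (I01 R) -> \bar R}) :
    \int[m1]_x (a * phi x + chi x) - \int[m2]_x (a * phi x + chi x) =
    a * (\int[m1]_x phi x - \int[m2]_x phi x) + (\int[m1]_x chi x - \int[m2]_x chi x).
  by rewrite !Rintegral_bounded_lin //; ring.
exact: gen.
Qed.

(** [K] is the total mass of the variation of [mu]. This crude bound serves for integrands that are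
    merely measurable; for continuous ones the total variation norm takes over. *)
Lemma pairing_bounded mu : exists2 K, 0 <= K & forall phi (c : R),
  bounded_measurable phi -> (forall x, `|phi x| <= c) -> `|pairing mu phi| <= c * K.
Proof.
exists (fine (pos_part mu setT) + fine (neg_part mu setT)).
  by apply: addr_ge0; exact: fine_setT_ge0.
move=> phi c bphi hc; rewrite mulrDr (le_trans (ler_normB _ _)) // lerD //.
  exact: Rintegral_bounded_le.
exact: Rintegral_bounded_le.
Qed.

Lemma pairing_indic mu (A : set (I01 R)) : measurable A ->
  pairing mu \1_A = fine (mu A).
Proof.
move=> mA; rewrite /pairing !Rintegral_indicT //.
rewrite (jordan_decomp (svalP (hahn_pair mu)) mA) /cadd /= cscaleN1.
by rewrite fineB // fin_num_measure.
Qed.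

(* Bounded measurable functions are uniform limits of simple functions. *)
Lemma bounded_functional_eq0 (D : (I01 R -> R) -> R) (K : R) :
  (forall (a : R) phi chi, bounded_measurable phi -> bounded_measurable chi ->
     D (fun x => a * phi x + chi x) = a * D phi + D chi) ->
  (forall phi (c : R), bounded_measurable phi -> (forall x, `|phi x| <= c) ->
     `|D phi| <= c * K) ->
  (forall A, measurable A -> D \1_A = 0) ->
  forall phi, bounded_measurable phi -> D phi = 0.
Proof.
move=> Dlin Dbnd Dind phi [mphi [C hC]].
have Dcst0 : D (cst 0) = 0.
  by have := Dind _ (@measurable0 _ (I01 R)); rewrite indic0.
have Dsum (h : nat -> R) (A : nat -> set (I01 R)) N : (forall k, measurable (A k)) ->
    bounded_measurable (fun x => \sum_(k < N) h k * \1_(A k) x) /\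
    D (fun x => \sum_(k < N) h k * \1_(A k) x) = 0.
  move=> mA; elim: N => [|N [IH1 IH2]].
    under eq_fun do rewrite big_ord0.
    by split => //; exact: bounded_measurable_cst.
  under eq_fun do rewrite big_ord_recr /= addrC.
  split; first exact: bounded_measurable_lin (bounded_measurable_indic _) _.
  by rewrite Dlin ?IH2 ?Dind ?mulr0 ?addr0 //; exact: bounded_measurable_indic.
have C0 : 0 <= C by exact: le_trans (hC (proj01 0)).
have approx n : (0 < n)%N -> `|D phi| <= n%:R^-1 * K.
  move=> n0; have n0' : 0 < n%:R :> R by rewrite ltr0n.
  (* The function s below rounds phi down to the grid of points k/n - C, with error at most 1/n. The
     shift by C makes g nonnegative, and g <= 2 C n bounds the number of levels by N. *)
  pose g x := n%:R * (phi x + C).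
  have g0 x : 0 <= g x.
    by rewrite mulr_ge0 // -lerBlDr sub0r; have := hC x; rewrite ler_norml => /andP[].
  pose A k := [set x | k%:R <= g x < k.+1%:R].
  have mA k : measurable (A k).
    have mg : measurable_fun setT g.
      by apply: measurable_funM => //; apply: measurable_funD.
    have := mg measurableT `[k%:R, k.+1%:R[%classic (measurable_itv _).
    by rewrite setTI; congr measurable; apply/seteqP; split => x; rewrite /= in_itv.
  pose N := (Num.truncn (n%:R * (C + C))).+1.
  pose s (x : I01 R) : R := \sum_(k < N) (k%:R / n%:R - C) * \1_(A k) x.
  have [bs Ds] := Dsum (fun k => k%:R / n%:R - C) A N mA.
  have sE x : s x = (Num.truncn (g x))%:R / n%:R - C.
    have gN : (Num.truncn (g x) < N)%N.
      rewrite ltnS; apply: le_truncn; rewrite ler_pM2l // lerD2r.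
      by rewrite (le_trans (ler_norm _)).
    rewrite /s (bigD1 (Ordinal gN)) //= big1 ?addr0 => [|k kne]; last first.
      rewrite indicE memNset ?mulr0 // => hk.
      by move/eqP: kne; apply; apply: val_inj => /=; rewrite (truncn_def hk).
    by rewrite indicE mem_set ?mulr1 //; exact: truncn_itv.
  have bphi : bounded_measurable phi by split => //; exists C.
  have := Dlin (-1) s phi bs bphi; rewrite [D s]Ds mulr0 add0r => <-.
  apply: Dbnd; first exact: bounded_measurable_lin.
  move=> x; rewrite sE mulN1r opprB.
  have -> : C - (Num.truncn (g x))%:R / n%:R + phi x = (g x - (Num.truncn (g x))%:R) / n%:R.
    by rewrite mulrBl /g mulrAC divff ?mul1r ?gt_eqF //; lra.
  have /andP[h1 h2] := truncn_itv (g0 x).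
  rewrite normrM [X in _ * X]ger0_norm ?invr_ge0 // ler_piMl ?invr_ge0 //.
  by rewrite ger0_norm ?subr_ge0 // lerBlDr addrC natr1 ltW.
apply/eqP; rewrite -normr_le0; apply/ler_addgt0Pl => e e0; rewrite addr0.
have K0 : 0 <= `|K| by [].
pose n := (Num.truncn (`|K| / e)).+1.
rewrite (le_trans (approx n isT)) // ler_pdivrMl // (le_trans (ler_norm _)) //.
by rewrite -ler_pdivrMr // ltW // truncnS_gt.
Qed.

(** Applied to the formulas for images and densities below, this reduces them to sets and avoids the
    Jordan decompositions: the image of a Jordan decomposition need not be the Jordan decomposition
    of the image, and multiplication by a signed density mixes the two parts. *)
Lemma functional_eq (l1 l2 : (I01 R -> R) -> R) (K1 K2 : R) :
  (forall (a : R) phi chi, bounded_measurable phi -> bounded_measurable chi ->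
     l1 (fun x => a * phi x + chi x) = a * l1 phi + l1 chi) ->
  (forall (a : R) phi chi, bounded_measurable phi -> bounded_measurable chi ->
     l2 (fun x => a * phi x + chi x) = a * l2 phi + l2 chi) ->
  (forall phi (c : R), bounded_measurable phi -> (forall x, `|phi x| <= c) ->
     `|l1 phi| <= c * K1) ->
  (forall phi (c : R), bounded_measurable phi -> (forall x, `|phi x| <= c) ->
     `|l2 phi| <= c * K2) ->
  (forall A, measurable A -> l1 \1_A = l2 \1_A) ->
  forall phi, bounded_measurable phi -> l1 phi = l2 phi.
Proof.
move=> lin1 lin2 b1 b2 ind phi bphi; apply/eqP; rewrite -subr_eq0; apply/eqP.
apply: (@bounded_functional_eq0 (fun phi => l1 phi - l2 phi) (K1 + K2)) => //.
- by move=> a p c bp bc; rewrite lin1 // lin2 //; ring.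
- move=> p c bp hc; rewrite mulrDr (le_trans (ler_normB _ _)) // lerD //.
    exact: b1.
  exact: b2.
- by move=> A mA; rewrite ind // subrr.
Qed.

(** The Hahn pair is chosen from the charge as a function on all sets, so charges that agree on
    measurable sets may come with different pairs; their pairings agree nevertheless, by comparison
    on indicators. *)
Lemma pairing_charge_eq mu nu phi : charge_eq mu nu -> bounded_measurable phi ->
  pairing mu phi = pairing nu phi.
Proof.
move=> munu; have [K1 _ b1] := pairing_bounded mu; have [K2 _ b2] := pairing_bounded nu.
apply: (functional_eq _ _ b1 b2) => [a p c bp bc|a p c bp bc|A mA].
- exact: pairing_lin.
- exact: pairing_lin.
- by rewrite !pairing_indic // munu.
Qed.

Lemma pairing_image (g : I01 R -> I01 R) mu phi : measurable_fun setT g ->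
  bounded_measurable phi -> pairing (image_charge g mu) phi = pairing mu (phi \o g).
Proof.
move=> mg; have [K1 _ b1] := pairing_bounded (image_charge g mu).
have [K2 _ b2] := pairing_bounded mu.
apply: (@functional_eq _ (fun p => pairing mu (p \o g)) K1 K2 _ _ b1) => [a p c bp bc|a p c bp bc|p c bp hc|A mA].
- exact: pairing_lin.
- by rewrite -pairing_lin //; exact: bounded_measurable_comp.
- by apply: b2; [exact: bounded_measurable_comp|move=> x /=].
- rewrite pairing_indic // /image_charge; case: pselect => // mg' /=.
  rewrite /pushforward -pairing_indic //.
  by rewrite -[X in measurable X]setTI; exact: mg'.
Qed.

Lemma pairing_density f mu phi : bounded_measurable f -> bounded_measurable phi ->
  pairing (density f mu) phi = pairing mu (fun x => f x * phi x).
Proof.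
move=> bf; have [K1 _ b1] := pairing_bounded (density f mu).
have [K2 _ b2] := pairing_bounded mu.
have [C hC] := bf.2.
apply: (@functional_eq _ (fun p => pairing mu (fun x => f x * p x)) K1 (C * K2) _ _ b1) => [a p c bp bc|a p c bp bc|p c bp hc|A mA].
- exact: pairing_lin.
- rewrite -pairing_lin; [|exact: bounded_measurableM..].
  by congr (pairing mu _); apply/funext => x; ring.
- rewrite mulrCA mulrA; apply: b2; first exact: bounded_measurableM.
  by move=> x; rewrite normrM ler_pM.
- rewrite pairing_indic // /density.
  case: pselect => [ip|]; last by case; exact: bounded_measurable_integrable.
  case: pselect => [im|]; last by case; exact: bounded_measurable_integrable.
  rewrite /cadd /copp /= /induced_charge fineB; last 2 first.
  + exact: integrable_fin_num (integrableS _ _ _ ip).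
  + exact: integrable_fin_num (integrableS _ _ _ im).
  rewrite /pairing; congr (_ - _).
    rewrite -/(Rintegral _ _ _) Rintegral_mkcond; congr (Rintegral _ _ _).
    by apply/funext => x; rewrite patchE indicE; case: ifPn; rewrite ?mulr1 ?mulr0.
  rewrite -/(Rintegral _ _ _) Rintegral_mkcond; congr (Rintegral _ _ _).
  by apply/funext => x; rewrite patchE indicE; case: ifPn; rewrite ?mulr1 ?mulr0.
Qed.

End pairing_facts.

(** * Bounded Lipschitz and total variation norms *)

Section norms.
Context {R : realType}.
Implicit Types (phi chi : I01 R -> R) (mu nu : M01 R).

Lemma I01_continuous_cst (c : R) : continuous (cst c : I01 R -> R).
Proof.
by apply: (@lipschitz_I01_continuous R 0) => x y; rewrite subrr normr0 mul0r.
Qed.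

Lemma I01_continuousD phi chi : continuous phi -> continuous chi ->
  continuous (fun x => phi x + chi x).
Proof. by move=> cphi cchi x; exact: cvgD (cphi x) (cchi x). Qed.

Lemma I01_continuousB phi chi : continuous phi -> continuous chi ->
  continuous (fun x => phi x - chi x).
Proof. by move=> cphi cchi x; exact: cvgB (cphi x) (cchi x). Qed.

Lemma I01_continuousM phi chi : continuous phi -> continuous chi ->
  continuous (fun x => phi x * chi x).
Proof. by move=> cphi cchi x; exact: cvgM (cphi x) (cchi x). Qed.

Lemma pairing_cst0 mu : pairing mu (cst 0) = 0.
Proof.
have b0 := @bounded_measurable_cst R 0.
have := pairing_lin mu 1 b0 b0; rewrite mul1r.
have -> : (fun x : I01 R => 1 * cst 0 x + cst 0 x : R) = cst 0.
  by apply/funext => x /=; rewrite mulr0 addr0.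
lra.
Qed.

Lemma pairingZ mu (a : R) phi : bounded_measurable phi ->
  pairing mu (fun x => a * phi x) = a * pairing mu phi.
Proof.
move=> bphi; have b0 := @bounded_measurable_cst R 0.
rewrite -[RHS]addr0 -[in RHS](pairing_cst0 mu) -pairing_lin //.
by congr pairing; apply/funext => x /=; rewrite addr0.
Qed.

Lemma pairingB mu phi chi : bounded_measurable phi -> bounded_measurable chi ->
  pairing mu (fun x => phi x - chi x) = pairing mu phi - pairing mu chi.
Proof.
move=> bphi bchi; rewrite addrC -mulN1r -pairing_lin //.
by congr pairing; apply/funext => x; rewrite mulN1r addrC.
Qed.

Lemma continuous_bounded_measurable phi (C : R) : continuous phi ->
  (forall x, `|phi x| <= C) -> bounded_measurable phi.
Proof. by move=> cphi hC; split; [exact: continuous_measurable_I01|exists C]. Qed.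

Lemma sup_normP phi (C : R) :
  (sup_norm phi <= C%:E)%E <-> forall x, `|phi x| <= C.
Proof.
split=> [hC x|hC].
  by rewrite -lee_fin (le_trans _ hC) //; apply: ereal_sup_ubound; exists x.
by apply: ge_ereal_sup => _ [x _ <-]; rewrite lee_fin.
Qed.

Lemma sup_norm_ge0 phi : (0 <= sup_norm phi)%E.
Proof.
apply: (@le_trans _ _ (`|phi (proj01 0)|)%:E); first by rewrite lee_fin.
by apply: ereal_sup_ubound; exists (proj01 0).
Qed.

Lemma lip_const_ge0 phi : (0 <= lip_const phi)%E.
Proof. by apply: le_ereal_inf_tmp => _ [L [L0 _] <-]; rewrite lee_fin. Qed.

Lemma lip_const_le phi (L : R) : (lip_const phi <= L%:E)%E -> lipschitz_I01 L phi.
Proof.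
move=> hL x y; apply/ler_addgt0Pr => e e0.
(* Points of [0,1] are at distance at most 1, so an excess e in the Lipschitz constant costs at most
   e. *)
have d1 : `|\val x - \val y| <= 1.
  have /andP[? ?] := I01_itv x; have /andP[? ?] := I01_itv y.
  by rewrite ler_norml; apply/andP; split; lra.
have [|_ [L' [L'0 L'l] <-] L'e] := @lb_ereal_inf_adherent R
  [set M%:E | M in [set M : R | 0 <= M /\ lipschitz_I01 M phi]] e e0.
  have : (lip_const phi < +oo)%E by rewrite (le_lt_trans hL) ?ltry.
  by rewrite ge0_fin_numE ?lip_const_ge0.
have {}L'e : L' < L + e.
  by rewrite -lte_fin (lt_le_trans L'e) // EFinD leeD2r.
rewrite (le_trans (L'l x y)) // (@le_trans _ _ ((L + e) * `|\val x - \val y|)) //.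
  by rewrite ler_wpM2r // ltW.
by rewrite mulrDl lerD2l ler_piMr // ltW.
Qed.

Lemma le_lip_const phi (L : R) : 0 <= L -> lipschitz_I01 L phi ->
  (lip_const phi <= L%:E)%E.
Proof. by move=> L0 hL; apply: ereal_inf_lbound; exists L. Qed.

Lemma BLP phi : BL phi <-> exists C L : R,
  [/\ 0 <= C, 0 <= L, forall x, `|phi x| <= C & lipschitz_I01 L phi].
Proof.
split=> [|[C [L [C0 L0 hC hL]]]].
  rewrite /BL /BL_norm; have := sup_norm_ge0 phi; have := lip_const_ge0 phi.
  have := @sup_normP phi; have := @lip_const_le phi.
  case: (sup_norm phi) => [C| |] //; case: (lip_const phi) => [L| |] // hl hs.
  rewrite !lee_fin => L0 C0 _; exists C, L; split => //.
    by apply/hs.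
  exact: hl.
rewrite /BL (@le_lt_trans _ _ (C + L)%:E) ?ltry // EFinD leeD //.
  exact/sup_normP.
exact: le_lip_const.
Qed.

Lemma BL_continuous_fun phi : BL phi -> continuous phi.
Proof. by move=> /BLP[C [L [_ _ _ hL]]]; exact: lipschitz_I01_continuous hL. Qed.

Lemma BL_bounded_measurable phi : BL phi -> bounded_measurable phi.
Proof.
move=> bl; have /BLP[C [L [_ _ hC hL]]] := bl.
by apply: (@continuous_bounded_measurable _ C) => //; exact: BL_continuous_fun.
Qed.

Lemma BL_norm_le1 phi (C L : R) : (forall x, `|phi x| <= C) ->
  0 <= L -> lipschitz_I01 L phi -> C + L <= 1 -> (BL_norm phi <= 1)%E.
Proof.
move=> hC L0 hL CL1; apply: (@le_trans _ _ (C + L)%:E); last by rewrite lee_fin.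
by rewrite EFinD leeD //; [exact/sup_normP|exact: le_lip_const].
Qed.

Lemma BL_norm_cst0 : (BL_norm (cst 0%R : I01 R -> R) <= 1)%E.
Proof.
apply: (@BL_norm_le1 _ 0 0); [by move=> x; rewrite normr0|by []| |by rewrite addr0].
by move=> x y; rewrite subrr normr0 mul0r.
Qed.

Lemma BL_dual_normP (l : (I01 R -> R) -> R) (d : R) phi (C L : R) :
  (forall a chi, BL chi -> l (fun x => a * chi x) = a * l chi) ->
  (BL_dual_norm l <= d%:E)%E ->
  (forall x, `|phi x| <= C) -> 0 <= L -> lipschitz_I01 L phi ->
  `|l phi| <= (C + L) * d.
Proof.
move=> lZ ld hC L0 hL.
have C0 : 0 <= C by exact: le_trans (hC (proj01 0)).
have blphi : BL phi by apply/BLP; exists C, L.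
have d0 : 0 <= d.
  rewrite -lee_fin (le_trans _ ld) // (@le_trans _ _ `|l (cst 0)|%:E) ?lee_fin //.
  apply: ereal_sup_ubound; exists (cst 0) => //=.
  exact: BL_norm_cst0.
apply/ler_addgt0Pr => e e0.
have CL0 : 0 <= C + L by rewrite addr_ge0.
(* Scaling by a brings the BL norm below 1. The summand e / (d + 1) keeps a defined when C + L = 0,
   and contributes at most e after multiplication by d. *)
pose a := (C + L + e / (d + 1))^-1.
have s0 : 0 < e / (d + 1) by rewrite divr_gt0 // ltr_wpDl.
have a0 : 0 < a by rewrite invr_gt0 ltr_wpDl.
have : (`|l (fun x => a * phi x)|%:E <= BL_dual_norm l)%E.
  apply: ereal_sup_ubound; exists (fun x => a * phi x) => //=.
  apply: (@BL_norm_le1 _ (a * C) (a * L)).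
  - by move=> x; rewrite normrM gtr0_norm // ler_pM2l.
  - by rewrite mulr_ge0 // ltW.
  - by move=> x y; rewrite -mulrBr normrM gtr0_norm // -mulrA ler_pM2l.
  - by rewrite -mulrDr ler_pdivrMl ?ltr_wpDl // mulr1 lerDl ltW.
move=> /le_trans /(_ ld); rewrite lee_fin lZ // normrM gtr0_norm //.
rewrite ler_pdivrMl ?ltr_wpDl // => /le_trans; apply.
rewrite mulrDl lerD2l mulrAC ler_pdivrMr ?ltr_wpDl // ler_pM2l //.
by rewrite lerDl.
Qed.

Lemma BL_distP mu nu (d : R) phi (C L : R) : (BL_dist mu nu <= d%:E)%E ->
  (forall x, `|phi x| <= C) -> 0 <= L -> lipschitz_I01 L phi ->
  `|pairing mu phi - pairing nu phi| <= (C + L) * d.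
Proof.
move=> hd hC L0 hL.
apply: (@BL_dual_normP (pairing mu - pairing nu) d phi C L) => //.
move=> a chi /BL_bounded_measurable bchi.
by rewrite /= -[LHS]/(pairing _ _ - pairing _ _) !pairingZ // -mulrBr.
Qed.

Lemma BL_dist_ge0 mu nu : (0 <= BL_dist mu nu)%E.
Proof.
apply: (@le_trans _ _ `|(pairing mu - pairing nu) (cst 0)|%:E); first by rewrite lee_fin.
apply: ereal_sup_ubound; exists (cst 0) => //=.
exact: BL_norm_cst0.
Qed.

Lemma TV_norm_pairing mu (r C : R) phi : (TV_norm mu <= r%:E)%E ->
  continuous phi -> (forall x, `|phi x| <= C) -> `|pairing mu phi| <= r * C.
Proof.
move=> hr cphi hC.
have bphi := continuous_bounded_measurable cphi hC.
have C0 : 0 <= C by exact: le_trans (hC (proj01 0)).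
have TV1 chi : continuous chi -> (forall x, `|chi x| <= 1) -> pairing mu chi <= r.
  move=> cchi chi1; rewrite -lee_fin (le_trans _ hr) //.
  by apply: ereal_sup_ubound; exists chi => //; split => //; exact/sup_normP.
(* The supremum in [TV_norm] carries no absolute value, so the bound is taken for both b = 1/C and b
   = -1/C; when C = 0 the function phi vanishes. *)
have scale (b : R) : `|b| * C <= 1 -> b * pairing mu phi <= r.
  move=> bC; rewrite -pairingZ //; apply: TV1.
    exact: I01_continuousM (@I01_continuous_cst b) cphi.
  by move=> x; rewrite normrM (le_trans _ bC) // ler_wpM2l.
have [C_gt0|C_le0] := ltP 0 C.
  have h1 : `|C^-1| * C <= 1 by rewrite gtr0_norm ?invr_gt0 // mulVf ?gt_eqF.
  have h2 : `|- C^-1| * C <= 1 by rewrite normrN.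
  move: (scale _ h1) (scale _ h2); rewrite mulNr -mulrN !ler_pdivrMl // => s1 s2.
  by rewrite ler_norml; apply/andP; split; lra.
have -> : C = 0 by apply/le_anti; rewrite C_le0 C0.
have -> : phi = (fun x => 0 * phi x).
  apply/funext => x; rewrite mul0r; apply/eqP; rewrite -normr_le0.
  exact: le_trans (hC x) _.
by rewrite pairingZ // mul0r mulr0 normr0.
Qed.

Lemma TV_norm_ge0 mu : (0 <= TV_norm mu)%E.
Proof.
rewrite -[leLHS]/(0%:E) -(pairing_cst0 mu).
apply: ereal_sup_ubound; exists (cst 0) => //; split; first exact: I01_continuous_cst.
by apply/sup_normP => x; rewrite normr0.
Qed.

Lemma TV_norm_fin mu : exists2 K : R, 0 <= K & TV_norm mu = K%:E.
Proof.
have [K K0 hK] := pairing_bounded mu.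
have : (TV_norm mu <= K%:E)%E.
  apply: ge_ereal_sup => _ [phi [cphi /sup_normP phi1] <-]; rewrite lee_fin.
  rewrite (le_trans (ler_norm _)) // -[K in leRHS]mul1r hK //.
  exact: continuous_bounded_measurable phi1.
have := TV_norm_ge0 mu; case: (TV_norm mu) => [t| |] // t0 _.
by exists t.
Qed.

(* Inf-convolution [inf_y phi y + N |x - y|] with [N = 2 C / d]. *)
Lemma lipschitz_approximation phi (C d e : R) : 0 < d ->
  (forall x, `|phi x| <= C) ->
  (forall x y : I01 R, `|\val x - \val y| < d -> `|phi x - phi y| <= e) ->
  exists chi, [/\ forall x, `|chi x| <= C, lipschitz_I01 (2 * C / d) chi &
    forall x, `|phi x - chi x| <= e].
Proof.
move=> d0 hC hd; set N := 2 * C / d.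
have C0 : 0 <= C by exact: le_trans (hC (proj01 0)).
have N0 : 0 <= N by rewrite divr_ge0 // ?mulr_ge0 // ltW.
have e0 : 0 <= e.
  by rewrite (le_trans _ (hd (proj01 0) (proj01 0) _)) ?subrr ?normr0.
have hCl x : - C <= phi x by have := hC x; rewrite ler_norml => /andP[].
have hCr x : phi x <= C by have := hC x; rewrite ler_norml => /andP[].
pose S (x : I01 R) : set R := [set phi y + N * `|\val x - \val y| | y in [set: I01 R]].
pose chi x := inf (S x).
have lbS (x : I01 R) : lbound (S x) (- C).
  by move=> _ [y _ <-]; rewrite (le_trans (hCl y)) // lerDl mulr_ge0.
have S0 x : S x !=set0 by exists (phi x + N * `|\val x - \val x|); exists x.
have chi_le x y : chi x <= phi y + N * `|\val x - \val y|.
  by apply: ge_inf; [exists (- C); exact: lbS|exists y].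
have chi_ge x z : (forall y, z <= phi y + N * `|\val x - \val y|) -> z <= chi x.
  by move=> h; apply: lb_le_inf => // _ [y _ <-].
exists chi; split.
- move=> x; rewrite ler_norml chi_ge ?andTb => [|y]; last first.
    by apply: lbS; exists y.
  by rewrite (le_trans (chi_le x x)) // subrr normr0 mulr0 addr0.
- have half x y : chi x - chi y <= N * `|\val x - \val y|.
    rewrite lerBlDr addrC -lerBlDr; apply: chi_ge => z.
    rewrite lerBlDr (le_trans (chi_le x z)) // -addrA lerD2l -mulrDr ler_wpM2l //.
    by rewrite [leRHS]addrC ler_distD.
  move=> x y; rewrite ler_norml half andbT lerNl opprB.
  by rewrite (distrC (\val x)) half.
- move=> x; rewrite ger0_norm; last first.
    by rewrite subr_ge0 (le_trans (chi_le x x)) // subrr normr0 mulr0 addr0.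
  rewrite lerBlDr addrC -lerBlDr; apply: chi_ge => y.
  have [xy|xy] := ltP `|\val x - \val y| d.
    have := hd _ _ xy; rewrite ler_norml => /andP[_]; rewrite lerBlDr addrC -lerBlDr.
    by move=> /le_trans; apply; rewrite lerDl mulr_ge0.
  (* At distance d or more the penalty exceeds the largest possible oscillation 2 C of phi, so such
     y do not lower the infimum below phi x. *)
  have : 2 * C <= N * `|\val x - \val y|.
    by rewrite /N mulrAC ler_pdivlMr // ler_wpM2l // mulr_ge0.
  by have := hCl y; have := hCr x; lra.
Qed.

Lemma I01_uniform_continuous phi (e : R) : continuous phi -> 0 < e ->
  exists2 d : R, 0 < d & forall x y : I01 R, `|\val x - \val y| < d -> `|phi x - phi y| <= e.
Proof.
move=> cphi e0.
have [d d0 hd] : exists2 d : R, 0 < d & forall x y : R, `[0, 1]%classic x ->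
    `[0, 1]%classic y -> ball x d y -> `|(phi \o proj01) x - (phi \o proj01) y| < e.
  apply: compact_uniform_continuous => //; first exact: segment_compact.
  apply: continuous_subspaceT => x; apply: continuous_comp; first exact: continuous_proj01.
  exact: cphi.
exists d => // x y xy; rewrite -(proj01K x) -(proj01K y) ltW //.
by apply: hd; rewrite //= in_itv I01_itv.
Qed.

(** The inf-convolution preserves the bound 1 on the sup norm, and its uniform error is multiplied
    by the finite mass of [mu]. Since Duhamel's formula and the BL distance only speak of BL
    functions, every total variation bound below passes through this lemma. *)
Lemma TV_norm_BL mu (r : R) :
  (forall phi, BL phi -> (forall x, `|phi x| <= 1) -> pairing mu phi <= r) ->
  (TV_norm mu <= r%:E)%E.
Proof.
move=> hr; apply: ge_ereal_sup => _ [phi [cphi /sup_normP phi1] <-]; rewrite lee_fin.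
have [K K0 hK] := pairing_bounded mu.
apply/ler_addgt0Pr => e e0.
have e0' : 0 < e / (K + 1) by rewrite divr_gt0 // ltr_wpDl.
have [d d0 hd] := I01_uniform_continuous cphi e0'.
have [chi [chi1 chil hchi]] := lipschitz_approximation d0 phi1 hd.
have blchi : BL chi.
  by apply/BLP; exists 1, (2 * 1 / d); split => //; rewrite divr_ge0 ?ltW.
have bphi := continuous_bounded_measurable cphi phi1.
have bchi := BL_bounded_measurable blchi.
have -> : pairing mu phi = pairing mu chi + (pairing mu phi - pairing mu chi) by ring.
rewrite lerD ?hr // -pairingB // (le_trans (ler_norm _)) //.
rewrite (le_trans (hK _ _ _ hchi)) //.
  under eq_fun do rewrite addrC -mulN1r; exact: bounded_measurable_lin.
by rewrite mulrAC ler_pdivrMr ?ltr_wpDl // ler_pM2l // lerDl.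
Qed.

(** Replacing phi by its Lipschitz approximation costs r e for each of the two charges, and the
    approximation has BL norm at most C + 2 C / d. This admits integrands such as the derivatives of
    a test function, which are only continuous. *)
Lemma equicontinuous_pairing mu nu (r C d e D : R) phi :
  (TV_norm mu <= r%:E)%E -> (TV_norm nu <= r%:E)%E -> 0 < d ->
  (forall x, `|phi x| <= C) ->
  (forall x y : I01 R, `|\val x - \val y| < d -> `|phi x - phi y| <= e) ->
  continuous phi -> (BL_dist mu nu <= D%:E)%E ->
  `|pairing mu phi - pairing nu phi| <= 2 * r * e + (C + 2 * C / d) * D.
Proof.
move=> mur nur d0 hC hd cphi hD.
have [chi [chiC chil hchi]] := lipschitz_approximation d0 hC hd.
have C0 : 0 <= C by exact: le_trans (hC (proj01 0)).
have N0 : 0 <= 2 * C / d by rewrite divr_ge0 // ?mulr_ge0 // ltW.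
have cchi := lipschitz_I01_continuous chil.
have bphi := continuous_bounded_measurable cphi hC.
have bchi := continuous_bounded_measurable cchi chiC.
have cdiff : continuous (fun x => phi x - chi x).
  exact: I01_continuousB.
have h1 := TV_norm_pairing mur cdiff hchi; rewrite pairingB // in h1.
have h2 := TV_norm_pairing nur cdiff hchi; rewrite pairingB // in h2.
have h3 := BL_distP hD chiC N0 chil.
move: h1 h2 h3; rewrite !ler_norml.
move: (pairing mu phi) (pairing mu chi) (pairing nu phi) (pairing nu chi) (2 * C / d).
move=> {phi chi hC hd cphi hD chiC chil hchi N0 cchi bphi bchi cdiff} p1 p2 p3 p4 N.
move=> /andP[? ?] /andP[? ?] /andP[? ?].
by apply/andP; split; lra.
Qed.

End norms.

(** * Scalar differential equations *)

Section derivative_within_facts.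
Context {R : realType}.
Implicit Types (J : set R) (g x y w : R -> R).

(** The multiplied-out form of [derivative_within]: r = t needs no exclusion, and restriction and
    gluing are immediate. A derivative stated for all [J] includes the whole line and is thus
    two-sided, also at the endpoints of a time interval. *)
Definition has_derivative J g (t l : R) := forall e : R, 0 < e ->
  exists2 d : R, 0 < d & forall r, J r -> `|r - t| < d ->
    `|g r - g t - l * (r - t)| <= e * `|r - t|.

Let quotient_error (h A l : R) : h != 0 -> l - h^-1 * A = - h^-1 * (A - l * h).
Proof. by move=> h0; field. Qed.

Lemma derivative_withinP J g t l : derivative_within J g t l <-> has_derivative J g t l.
Proof.
rewrite /derivative_within; split=> [/cvgrPdist_le h e e0|h].
  have := h e e0; rewrite near_withinE => /nbhs_ballP[d /= d0 hd].
  exists d => // r Jr rd.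
  have [->|rt] := eqVneq r t; first by rewrite !subrr mulr0 subrr !normr0 mulr0.
  have rt0 : r - t != 0 by rewrite subr_eq0.
  have := hd r; rewrite /ball /= distrC => /(_ rd rt Jr).
  rewrite mulrC quotient_error // normrM normrN normfV ler_pdivrMl ?normr_gt0 //.
  by rewrite (mulrC _ e).
apply/cvgrPdist_le => e e0; have [d d0 hd] := h e e0.
rewrite near_withinE; apply/nbhs_ballP; exists d => //= r.
rewrite /ball /= distrC => rd rt Jr; have rt0 : r - t != 0 by rewrite subr_eq0.
rewrite mulrC quotient_error // normrM normrN normfV ler_pdivrMl ?normr_gt0 //.
by rewrite (mulrC _ e) hd.
Qed.

Lemma has_derivative_sub J J' g t l : J' `<=` J -> has_derivative J g t l ->
  has_derivative J' g t l.
Proof.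
by move=> JJ h e e0; have [d d0 hd] := h e e0; exists d => // r /JJ; exact: hd.
Qed.

Lemma has_derivative_near J J' g g' t l (d : R) : 0 < d -> g t = g' t ->
  (forall r, J' r -> `|r - t| < d -> J r /\ g' r = g r) -> has_derivative J g t l ->
  has_derivative J' g' t l.
Proof.
move=> d0 gt hJ h e e0; have [d' d'0 hd] := h e e0.
exists (Num.min d d') => [|r J'r]; first by rewrite lt_min d0.
by rewrite lt_min => /andP[rd rd']; have [Jr ->] := hJ r J'r rd; rewrite -gt hd.
Qed.

Lemma has_derivative_is_derive a b g t l : a < t < b ->
  has_derivative `[a, b]%classic g t l -> is_derive (t : R) 1 g l.
Proof.
move=> /andP[a_lt lt_b] h.
suff gl : h^-1 *: (g (h *: 1 + t) - g t) @[h --> 0^'] --> l.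
  by apply: DeriveDef; [apply/cvg_ex; exists l|exact: cvg_lim gl].
apply/cvgrPdist_le => e e0; have [d d0 hd] := h e e0.
have m0 : 0 < Num.min d (Num.min (t - a) (b - t)) by rewrite !lt_min d0 !subr_gt0 a_lt.
near=> r.
have r0 : r != 0 by near: r; exact: nbhs_dnbhs_neq.
have : `|r| < Num.min d (Num.min (t - a) (b - t)) by near: r; exact: dnbhs0_lt.
rewrite !lt_min => /and3P[rd ra rb].
have := hd (r + t); rewrite addrK => /(_ _ rd) hr.
rewrite [r *: 1](mulr1 r).
have -> : l - r^-1 *: (g (r + t) - g t) = - r^-1 * (g (r + t) - g t - l * r).
  by rewrite [_ *: _]/(_ * _) quotient_error.
rewrite normrM normrN normfV ler_pdivrMl ?normr_gt0 // (mulrC _ e) hr //.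
move: ra rb; rewrite /= in_itv /= !ltr_norml => /andP[? ?] /andP[? ?].
by apply/andP; split; lra.
Unshelve. all: by end_near.
Qed.

Lemma is_derive_has_derivative J g t l : is_derive (t : R) 1 g l -> has_derivative J g t l.
Proof.
move=> [dg gl] e e0.
have /cvgrPdist_le /(_ e e0) : h^-1 *: (g (h *: 1 + t) - g t) @[h --> 0^'] --> l.
  by rewrite -gl.
move=> /nbhs_ballP[d /= d0 hd]; exists d => // r _ rd.
have [->|rt] := eqVneq r t; first by rewrite !subrr mulr0 subrr !normr0 mulr0.
have rt0 : r - t != 0 by rewrite subr_eq0.
have := hd (r - t); rewrite /ball /= sub0r normrN => /(_ rd rt0).
rewrite [_ *: 1](mulr1 (r - t)) subrK.
have -> : l - (r - t)^-1 *: (g r - g t) = - (r - t)^-1 * (g r - g t - l * (r - t)).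
  by rewrite [_ *: _]/(_ * _) quotient_error.
by rewrite normrM normrN normfV ler_pdivrMl ?normr_gt0 // (mulrC _ e).
Qed.

Lemma has_derivative_continuous J g (g' : R -> R) :
  (forall t, J t -> has_derivative J g t (g' t)) -> {within J, continuous g}.
Proof.
move=> h; apply/subspace_continuousP => t Jt; apply/cvgrPdist_le => e e0.
have [d d0 hd] := h t Jt 1 ltr01.
have c0 : 0 < 1 + `|g' t| by rewrite ltr_pwDl.
have m0 : 0 < Num.min d (e / (1 + `|g' t|)) by rewrite lt_min d0 divr_gt0.
rewrite near_withinE; apply/nbhs_ballP; exists (Num.min d (e / (1 + `|g' t|))) => //= r.
rewrite /ball /= lt_min distrC => /andP[rd re] Jr.
have {}hd := hd r Jr rd; rewrite distrC.
have -> : g r - g t = (g r - g t - g' t * (r - t)) + g' t * (r - t) by ring.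
rewrite (le_trans (ler_normD _ _)) // (le_trans (lerD hd (lexx _))) //.
by rewrite normrM -mulrDl mulrC -ler_pdivlMr // ltW.
Qed.

Lemma has_derivative_MVT a b g (g' : R -> R) : a <= b ->
  (forall t, a <= t <= b -> has_derivative `[a, b]%classic g t (g' t)) ->
  exists2 c, a <= c <= b & g b - g a = g' c * (b - a).
Proof.
move=> ab h.
have [| |c] := @MVT_segment R g g' a b ab.
- move=> t; rewrite in_itv /= => /andP[at_ tb].
  by apply: (@has_derivative_is_derive a b); [apply/andP|apply: h; rewrite !ltW].
- apply: (@has_derivative_continuous _ _ g') => t; rewrite /= in_itv /=; exact: h.
by rewrite in_itv /=; exists c.
Qed.

Lemma has_derivative_le a b g (g' : R -> R) (M : R) : a <= b ->
  (forall t, a <= t <= b -> has_derivative `[a, b]%classic g t (g' t)) ->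
  (forall t, a <= t <= b -> `|g' t| <= M) -> `|g b - g a| <= M * (b - a).
Proof.
move=> ab h hM; have [c cab ->] := has_derivative_MVT ab h.
by rewrite normrM [X in _ * X]ger0_norm ?subr_ge0 // ler_wpM2r ?subr_ge0 // hM.
Qed.

Lemma has_derivativeB J g1 g2 t l1 l2 : has_derivative J g1 t l1 ->
  has_derivative J g2 t l2 -> has_derivative J (fun r => g1 r - g2 r) t (l1 - l2).
Proof.
move=> h1 h2 e e0.
have e20 : 0 < e / 2 by rewrite divr_gt0.
have [d1 d10 hd1] := h1 (e / 2) e20.
have [d2 d20 hd2] := h2 (e / 2) e20.
exists (Num.min d1 d2) => [|r Jr]; first by rewrite lt_min d10.
rewrite lt_min => /andP[r1 r2].
have -> : g1 r - g2 r - (g1 t - g2 t) - (l1 - l2) * (r - t) =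
  (g1 r - g1 t - l1 * (r - t)) - (g2 r - g2 t - l2 * (r - t)) by ring.
rewrite (le_trans (ler_normB _ _)) // [leRHS](_ : _ = e / 2 * `|r - t| + e / 2 * `|r - t|).
  by rewrite lerD ?hd1 ?hd2.
by rewrite -mulrDl -splitr.
Qed.

Lemma has_derivative_cst J (c t : R) : has_derivative J (cst c) t 0.
Proof. by move=> e e0; exists 1 => // r _ _; rewrite subrr mul0r subrr normr0 mulr_ge0 // ltW. Qed.

Lemma primitive_exists g (a b : R) : a <= b -> continuous g ->
  exists G : R -> R, forall t, a <= t <= b -> forall J, has_derivative J G t (g t).
Proof.
move=> ab cg.
(* Integrating from a - 1 makes each t in [a,b] an interior point, so the derivative is two-sided at
   a and b as well. *)
pose F (x : R) : R := \int[lebesgue_measure]_(t in `[a - 1, x]) g t.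
exists F => t /andP[at_ tb] J.
apply: is_derive_has_derivative.
have tb1 : t < b + 1 by lra.
have a1t : a - 1 < t by lra.
have ig : lebesgue_measure.-integrable `[a - 1, b + 1] (EFin \o g).
  apply: continuous_compact_integrable; first exact: segment_compact.
  exact: continuous_subspaceT.
have [dF F'] := continuous_FTC1_closed tb1 ig a1t (cg t).
rewrite -/F derive1E in F'.
exact: (DeriveDef dF F').
Qed.

Lemma has_derivativeM J g1 g2 t l1 l2 : has_derivative J g1 t l1 ->
  has_derivative J g2 t l2 ->
  has_derivative J (fun r => g1 r * g2 r) t (l1 * g2 t + g1 t * l2).
Proof.
move=> h1 h2 e e0.
(* The remainder of the product splits into three terms whose coefficients add up to c. The third
   radius below also gives |g2 r - g2 t| <= min(1, e / c): the 1 bounds g2 near t, the e / c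
   controls the mixed term. *)
pose c := 1 + `|g2 t| + `|l1| + `|g1 t|.
have c0 : 0 < c by rewrite /c -!addrA ltr_pwDl // !addr_ge0.
have ec0 : 0 < e / c by rewrite divr_gt0.
have [d1 d10 hd1] := h1 (e / c) ec0; have [d2 d20 hd2] := h2 (e / c) ec0.
have [d3 d30 hd3] := h2 1 ltr01.
have m0 : 0 < Num.min 1 (e / c) / (1 + `|l2|).
  by rewrite divr_gt0 ?lt_min ?ltr01 // ltr_pwDl.
exists (Num.min (Num.min d1 d2) (Num.min d3 (Num.min 1 (e / c) / (1 + `|l2|)))) => [|r Jr].
  by rewrite !lt_min d10 d20 d30.
rewrite !(lt_min `|r - t|) => /andP[/andP[/(hd1 r Jr) k1 /(hd2 r Jr) k2] /andP[/(hd3 r Jr) k3 k4]].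
have k5 : `|g2 r - g2 t| <= Num.min 1 (e / c).
  have -> : g2 r - g2 t = (g2 r - g2 t - l2 * (r - t)) + l2 * (r - t) by ring.
  rewrite (le_trans (ler_normD _ _)) // (le_trans (lerD k3 (lexx _))) //.
  by rewrite normrM -mulrDl mulrC -ler_pdivlMr ?ltr_pwDl // ltW.
have -> : g1 r * g2 r - g1 t * g2 t - (l1 * g2 t + g1 t * l2) * (r - t) =
   (g1 r - g1 t - l1 * (r - t)) * g2 r + l1 * (r - t) * (g2 r - g2 t)
   + g1 t * (g2 r - g2 t - l2 * (r - t)) by ring.
have -> : e * `|r - t| = e / c * `|r - t| * (1 + `|g2 t|) + `|l1| * `|r - t| * (e / c)
  + `|g1 t| * (e / c * `|r - t|).
  have -> : e / c * `|r - t| * (1 + `|g2 t|) + `|l1| * `|r - t| * (e / c)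
    + `|g1 t| * (e / c * `|r - t|) = e / c * c * `|r - t| by rewrite /c; ring.
  by rewrite divfK ?gt_eqF.
move: k5; rewrite le_min => /andP[k5 k6].
have k7 : `|g2 r| <= 1 + `|g2 t|.
  have -> : g2 r = (g2 r - g2 t) + g2 t by ring.
  by rewrite (le_trans (ler_normD _ _)) // lerD2r.
rewrite (le_trans (ler_normD _ _)) // lerD //.
  rewrite (le_trans (ler_normD _ _)) // lerD //.
    by rewrite normrM ler_pM.
  by rewrite !normrM ler_wpM2l.
by rewrite normrM ler_wpM2l.
Qed.

Lemma has_derivative_ndecr a b g (g' : R -> R) : a <= b ->
  (forall t, a <= t <= b -> has_derivative `[a, b]%classic g t (g' t)) ->
  (forall t, a <= t <= b -> 0 <= g' t) -> g a <= g b.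
Proof.
move=> ab h pos; have [c cab gba] := has_derivative_MVT ab h.
by rewrite -subr_ge0 gba mulr_ge0 ?subr_ge0 // pos.
Qed.

Lemma has_derivative_nincr a b g (g' : R -> R) : a <= b ->
  (forall t, a <= t <= b -> has_derivative `[a, b]%classic g t (g' t)) ->
  (forall t, a <= t <= b -> g' t <= 0) -> g b <= g a.
Proof.
move=> ab h neg; have [c cab gba] := has_derivative_MVT ab h.
by rewrite -subr_le0 gba mulr_le0_ge0 ?subr_ge0 // neg.
Qed.

Lemma has_derivative_expR J (c t : R) :
  has_derivative J (fun s => expR (c * s)) t (c * expR (c * t)).
Proof.
apply: is_derive_has_derivative.
have : is_derive t 1 (expR \o (fun s => c * s)) (expR (c * t) *: (c *: 1)).
  apply: is_derive1_comp.
by rewrite [_ *: 1]mulr1 [_ *: _]mulrC.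
Qed.

Section ode_uniqueness.
Variables (L : R) (w : R -> R) (a b : R) (x y : R -> R).
Hypothesis wL : forall p q, `|w p - w q| <= L * `|p - q|.
Hypothesis xE : forall t, a <= t <= b -> has_derivative `[a, b]%classic x t (w (x t)).
Hypothesis yE : forall t, a <= t <= b -> has_derivative `[a, b]%classic y t (w (y t)).

(** Squared distance with an exponential weight; the square is differentiable where the absolute
    value is not. With c = -2 L it is nonincreasing, which gives Lipschitz dependence forwards in
    time; with c = 2 L it is nondecreasing, which gives uniqueness backwards. *)
Let E (c t : R) := expR (c * t) * ((x t - y t) * (x t - y t)).
Let E' (c t : R) := expR (c * t) * (c * ((x t - y t) * (x t - y t))
  + 2 * ((w (x t) - w (y t)) * (x t - y t))).

Let E_deriv c t : a <= t <= b -> has_derivative `[a, b]%classic (E c) t (E' c t).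
Proof.
move=> tab; have D := has_derivativeB (xE tab) (yE tab).
have := has_derivativeM (has_derivative_expR _ c t) (has_derivativeM D D).
by congr has_derivative; rewrite /E'; ring.
Qed.

Let dot_le t : `|(w (x t) - w (y t)) * (x t - y t)| <= L * ((x t - y t) * (x t - y t)).
Proof.
rewrite normrM -expr2 -[X in _ <= _ * X]real_normK ?num_real // expr2 mulrA.
by rewrite ler_wpM2r.
Qed.

Lemma ode_lipschitz : a <= b -> `|x b - y b| <= expR (L * (b - a)) * `|x a - y a|.
Proof.
move=> ab.
have : E (- (2 * L)) b <= E (- (2 * L)) a.
  apply: (@has_derivative_nincr a b _ (E' (- (2 * L)))) => // t tab; first exact: E_deriv.
  rewrite mulr_ge0_le0 ?expR_ge0 //.
  by have := dot_le t; rewrite ler_norml => /andP[]; lra.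
rewrite /E -!expr2 => h.
rewrite -ler_sqr ?nnegrE ?mulr_ge0 ?expR_ge0 // exprMn !real_normK ?num_real //.
rewrite -expRM_natl -(ler_pM2l (expR_gt0 (- (2 * L) * b))) (le_trans h) //.
rewrite [leRHS]mulrA -expRD; apply: ler_wpM2r; first exact: sqr_ge0.
by rewrite ler_expR; lra.
Qed.

Lemma ode_unique_backward : a <= b -> x b = y b -> x a = y a.
Proof.
move=> ab xyb.
have : E (2 * L) a <= E (2 * L) b.
  apply: (@has_derivative_ndecr a b _ (E' (2 * L))) => // t tab; first exact: E_deriv.
  rewrite mulr_ge0 ?expR_ge0 //.
  by have := dot_le t; rewrite ler_norml => /andP[]; lra.
rewrite /E xyb subrr mulr0 mulr0 pmulr_rle0 ?expR_gt0 // -expr2.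
move=> h; apply/eqP; rewrite -subr_eq0 -sqrf_eq0; apply/eqP/le_anti.
by rewrite h sqr_ge0.
Qed.

End ode_uniqueness.


(** The radii 2 c / 2^n dominate the tails of the increments, so the intervals of these radii around
    u n are nested; the supremum of their left endpoints lies in all of them. *)
Lemma geometric_limit (u : nat -> R) (c : R) : 0 <= c ->
  (forall n, `|u n.+1 - u n| <= c / 2 ^+ n) ->
  exists l, forall n, `|l - u n| <= 2 * c / 2 ^+ n.
Proof.
move=> c0 hu; pose r n := 2 * c / 2 ^+ n.
have r0 n : 0 <= r n by rewrite divr_ge0 ?mulr_ge0 ?exprn_ge0.
have step n : `|u n.+1 - u n| <= r n - r n.+1.
  rewrite (le_trans (hu n)) // /r exprS invfM.
  by rewrite [X in _ <= X](_ : _ = c / 2 ^+ n) //; field; rewrite expf_neq0.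
have lo m n : (m <= n)%N -> u m - r m <= u n - r n.
  elim: n => [|n IH]; first by rewrite leqn0 => /eqP ->.
  rewrite leq_eqVlt ltnS => /predU1P[->//|/IH /le_trans]; apply.
  by have := step n; rewrite ler_norml => /andP[? ?]; lra.
have hi m n : (m <= n)%N -> u n + r n <= u m + r m.
  elim: n => [|n IH]; first by rewrite leqn0 => /eqP ->.
  rewrite leq_eqVlt ltnS => /predU1P[->//|/IH]; apply: le_trans.
  by have := step n; rewrite ler_norml => /andP[? ?]; lra.
have lohi m n : u m - r m <= u n + r n.
  rewrite (le_trans (lo m (maxn m n) (leq_maxl _ _))) //.
  rewrite (le_trans _ (hi n (maxn m n) (leq_maxr _ _))) //.
  by have := r0 (maxn m n); lra.
pose S : set R := [set u n - r n | n in [set: nat]].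
have S0 : S !=set0 by exists (u 0%N - r 0%N); exists 0%N.
exists (sup S) => n; rewrite ler_distl; apply/andP; split.
  apply: ub_le_sup; last by exists n.
  by exists (u 0%N + r 0%N) => _ [m _ <-].
by apply: ge_sup => // _ [m _ <-].
Qed.

Lemma geometric_small (c e : R) : 0 < e -> exists n : nat, c / 2 ^+ n <= e.
Proof.
move=> e0; exists (Num.truncn (`|c| / e)).+1.
rewrite ler_pdivrMr ?exprn_gt0 // mulrC -ler_pdivrMr // (le_trans (y := `|c| / e)) //.
  by rewrite ler_pM2r ?invr_gt0 // ler_norm.
rewrite ltW // (lt_le_trans (truncnS_gt _)) // -natrX ler_nat ltnW // ltn_expl //.
Qed.

Lemma geometric_small_eq0 (c z : R) : 0 <= c -> (forall n : nat, z <= c / 2 ^+ n) -> z <= 0.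
Proof.
move=> c0 h; apply/ler_addgt0Pr => e e0; rewrite add0r.
by have [n hn] := geometric_small c e0; exact: le_trans (h n) hn.
Qed.

(** * Local existence by Picard iteration *)

Section picard.
Variables (L K h : R) (w : R -> R) (x0 : R).
Hypothesis h0 : 0 <= h.
Hypothesis L0 : 0 <= L.
Hypothesis wL : forall p q, `|w p - w q| <= L * `|p - q|.
Hypothesis wK : forall p, `|w p| <= K.
Hypothesis hL : h * L <= 2^-1.

(** Clamping time to [0,h] defines the iterates on all of R, so they are continuous there and the
    sup norm estimates hold for every t. *)
Let clamp (t : R) := Num.max 0 (Num.min h t).

Let clamp_itv t : 0 <= clamp t <= h.
Proof. by rewrite le_max lexx /= ge_max h0 ge_min lexx. Qed.

Let clamp_id t : 0 <= t <= h -> clamp t = t.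
Proof. by move=> /andP[t0 th]; rewrite /clamp min_r // max_r. Qed.

Let clamp_lip s t : `|clamp s - clamp t| <= `|s - t|.
Proof. exact: clamp_lipschitz. Qed.

(** A chosen primitive in place of an integral: only its value at 0 and its derivative on [0,h]
    matter, and bounds follow from the mean value theorem. By [primP] the default [cst 0] is not met
    for continuous g. *)
Let prim (g : R -> R) : R -> R := xget (cst 0) [set G | G 0 = 0 /\
  forall t, 0 <= t <= h -> forall J, has_derivative J G t (g t)].

Let primP g : continuous g -> prim g 0 = 0 /\
  forall t, 0 <= t <= h -> forall J, has_derivative J (prim g) t (g t).
Proof.
move=> cg; rewrite /prim; case: xgetP => [G _ []//|] /(_ (fun t => _)) nG.
exfalso; have [G hG] := primitive_exists h0 cg.
apply: (nG (fun t => G t - G 0)); split => [|t th J]; first by rewrite subrr.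
by have := has_derivativeB (hG t th J) (@has_derivative_cst J (G 0) t); rewrite subr0.
Qed.

(** The Picard operator. It preserves K-Lipschitz curves, and h L <= 1/2 makes it a contraction of
    factor 1/2, whence the geometric rate. *)
Let T (x : R -> R) (t : R) := x0 + prim (w \o x) (clamp t).

Let lipK (x : R -> R) := forall s t, `|x s - x t| <= K * `|s - t|.

Let lipK_cont x : lipK x -> continuous (w \o x).
Proof.
move=> xK t; apply: continuous_comp; first exact: (@lipschitz_R_continuous R K).
exact: (@lipschitz_R_continuous R L).
Qed.

Let prim_le (G g : R -> R) (M a b : R) : 0 <= a <= h -> 0 <= b <= h ->
  (forall t, 0 <= t <= h -> forall J, has_derivative J G t (g t)) ->
  (forall t, 0 <= t <= h -> `|g t| <= M) ->
  `|G a - G b| <= M * `|a - b|.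
Proof.
wlog ab : a b / a <= b => [H|] ah bh hG hM.
  have [/H|/ltW/H] := leP a b; first exact.
  by rewrite distrC (distrC a); exact.
rewrite distrC (distrC a) [X in _ * X]ger0_norm ?subr_ge0 //.
move: ah bh => /andP[a0 _] /andP[_ bh].
apply: (has_derivative_le ab (g' := g)) => t /andP[at_ tb].
  by apply: hG; rewrite (le_trans a0) // (le_trans tb).
by apply: hM; rewrite (le_trans a0) // (le_trans tb).
Qed.

Let T_lipK x : lipK x -> lipK (T x).
Proof.
move=> xK s t; have [_ hp] := primP (lipK_cont xK).
rewrite /T opprD addrACA subrr add0r.
have K0 : 0 <= K by rewrite (le_trans _ (wK 0)).
rewrite (le_trans (@prim_le _ _ K _ _ _ _ hp _)) ?clamp_itv // => [? _|]; first exact: wK.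
by rewrite ler_wpM2l // clamp_lip.
Qed.

Let T_contract x y M : lipK x -> lipK y -> (forall t, `|x t - y t| <= M) ->
  forall t, `|T x t - T y t| <= M / 2.
Proof.
move=> xK yK hM t; have [x00 hx] := primP (lipK_cont xK); have [y00 hy] := primP (lipK_cont yK).
have M0 : 0 <= M by rewrite (le_trans _ (hM 0)).
rewrite /T opprD addrACA subrr add0r.
set G := fun s => prim (w \o x) s - prim (w \o y) s.
have -> : prim (w \o x) (clamp t) - prim (w \o y) (clamp t) = G (clamp t) - G 0.
  by rewrite /G x00 y00 !subr0.
have := @prim_le G (fun s => w (x s) - w (y s)) (L * M) (clamp t) 0 (clamp_itv t).
rewrite lexx h0 => /(_ isT) h1; rewrite (le_trans (h1 _ _)) //.
- by move=> s sh J; apply: has_derivativeB; [exact: hx|exact: hy].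
- by move=> s _; rewrite (le_trans (wL _ _)) // ler_wpM2l.
- have /andP[c0 ch] := clamp_itv t.
  rewrite subr0 ger0_norm // mulrC mulrA mulrC ler_wpM2l // (le_trans _ hL) //.
  by rewrite ler_wpM2r.
Qed.

Lemma picard : exists2 X : R -> R, X 0 = x0 &
  forall t, 0 <= t <= h -> forall J, has_derivative J X t (w (X t)).
Proof.
pose xn n := iter n T (cst x0).
have K0 : 0 <= K by rewrite (le_trans _ (wK 0)).
have xnK n : lipK (xn n).
  elim: n => [|n IH]; last exact: T_lipK.
  by move=> s t; rewrite subrr normr0 mulr_ge0.
have xn1 n t : `|xn n.+1 t - xn n t| <= K * h / 2 ^+ n.
  elim: n t => [|n IH] t.
    rewrite expr0 divr1 /xn /= /T addrC addKr.
    have [p0 hp] := primP (lipK_cont (xnK 0%N)).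
    have := @prim_le _ _ K (clamp t) 0 (clamp_itv t) _ hp; rewrite lexx h0 p0 !subr0.
    have /andP[c0 ch] := clamp_itv t.
    move=> h1; rewrite (le_trans (h1 isT (fun _ _ => wK _))) // ger0_norm //.
    by rewrite ler_wpM2l.
  have -> : K * h / 2 ^+ n.+1 = K * h / 2 ^+ n / 2 by rewrite exprSr invfM mulrA.
  exact: (T_contract (xnK n.+1) (xnK n) IH t).
have /choice[X hX] : forall t, exists l, forall n, `|l - xn n t| <= 2 * (K * h) / 2 ^+ n.
  by move=> t; apply: geometric_limit => [|n]; rewrite ?mulr_ge0.
have XK : lipK X.
  move=> s t; rewrite -subr_le0.
  apply: (@geometric_small_eq0 (4 * (K * h))) => [|n]; first by rewrite !mulr_ge0.
  have -> : X s - X t = (X s - xn n s) - (X t - xn n t) + (xn n s - xn n t) by ring.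
  have := hX s n; have := hX t n; have := xnK n s t.
  set a := X s - _; set b := X t - _; set c := xn n s - _ => h1 h2 h3.
  rewrite lerBlDr (le_trans (ler_normD _ _)) // lerD //.
  rewrite (le_trans (ler_normB _ _)) // (le_trans (lerD h3 h2)) //.
  by rewrite -mulrDl -mulrDl; rewrite (_ : 2 + 2 = 4 :> R) //; ring.
have TX t : T X t = X t.
  apply/eqP; rewrite -subr_eq0 -normr_le0.
  apply: (@geometric_small_eq0 (2 * (K * h))) => [|n]; first by rewrite !mulr_ge0.
  have -> : T X t - X t = (T X t - T (xn n) t) - (X t - xn n.+1 t) by rewrite /xn /=; ring.
  have := T_contract XK (xnK n) (fun t => hX t n) t; have := hX t n.+1.
  rewrite exprSr invfM (mulrA (2 * (K * h))) => h1 h2.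
  by rewrite (le_trans (ler_normB _ _)) // (le_trans (lerD h2 h1)) // -splitr.
have [p0 hp] := primP (lipK_cont XK).
have XE t : 0 <= t <= h -> X t = x0 + prim (w \o X) t.
  by move=> th; rewrite -TX /T clamp_id.
(* The fixed point itself is constant outside [0,h] and may have kinks at 0 and h; the primitive
   without clamping agrees with it on [0,h] and has two-sided derivatives there. *)
exists (fun t => x0 + prim (w \o X) t) => [|t th J]; first by rewrite p0 addr0.
rewrite -XE //; have := has_derivativeB (hp t th J) (@has_derivative_cst J (- x0) t).
rewrite subr0; apply: has_derivative_near ltr01 _ _ => [|r Jr _]; first by rewrite opprK addrC.
by split => //; rewrite opprK addrC.
Qed.

End picard.

End derivative_within_facts.

(** * The stopped flow *)

Section exit_of_half_line.
Context {R : realType}.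

Lemma has_derivative_affine (J : set R) (a c s t : R) :
  has_derivative J (fun r => a + c * (r - s)) t c.
Proof.
move=> e e0; exists 1 => // r _ _.
have -> : a + c * (r - s) - (a + c * (t - s)) - c * (r - t) = 0 by ring.
by rewrite normr0 mulr_ge0 // ltW.
Qed.

(* Where [w] is constant on the half-line, the solution is affine: it leaves
   [0, oo) only if [w 0 < 0], and then never returns. *)
Lemma ode_exit_neg (L h : R) (w X : R -> R) :
  (forall p q, `|w p - w q| <= L * `|p - q|) ->
  (forall p, p <= 0 -> w p = w 0) ->
  (forall t, 0 <= t <= h -> forall J, has_derivative J X t (w (X t))) ->
  0 <= X 0 -> forall t, 0 <= t <= h -> X t < 0 ->
  exists s0, [/\ 0 <= s0, s0 < t, X s0 = 0 & forall s, s0 < s <= h -> X s < 0].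
Proof.
move=> wL w0 hX X0 t /andP[t0 th] Xt.
(* If w 0 >= 0, the line of slope w 0 through (t, X t) stays negative on [0,t], so it solves the
   equation there; backward uniqueness then forces X 0 < 0. *)
have w0_lt0 : w 0 < 0.
  rewrite ltNge; apply/negP => w0_ge0.
  have : X 0 = X t + w 0 * (0 - t).
    apply: (@ode_unique_backward R L w 0 t X (fun s => X t + w 0 * (s - t))) => //.
    - by move=> s /andP[s0 st]; apply: hX; rewrite s0 (le_trans st).
    - move=> s /andP[s0 st]; rewrite [w (X t + _)]w0; first exact: has_derivative_affine.
      have : w 0 * (s - t) <= 0 by rewrite mulr_ge0_le0 // subr_le0.
      lra.
    - by rewrite subrr mulr0 addr0.
  have : w 0 * (0 - t) <= 0 by rewrite sub0r mulr_ge0_le0 // oppr_le0.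
  by lra.
(* Any zero will do: from it on, the line of slope w 0 < 0 is a solution, and forward uniqueness
   identifies X with it. *)
have [s0 + Xs0] : exists2 c, c \in `[0, t]%R & X c = 0.
  apply: IVT => //.
    apply: (@has_derivative_continuous _ _ _ (fun s => w (X s))) => s.
    rewrite /= in_itv /= => /andP[s0 st]; apply: hX; rewrite s0 (le_trans st) //.
  by rewrite ge_min le_max (ltW Xt) X0 orbT.
rewrite in_itv /= => /andP[s00 s0t].
have s0_lt : s0 < t.
  by rewrite lt_neqAle s0t andbT; apply/eqP => E; move: Xt; rewrite -E Xs0 ltxx.
exists s0; split => // s /andP[s0s sh].
have : `|X s - (0 + w 0 * (s - s0))| <= expR (L * (s - s0)) * `|X s0 - (0 + w 0 * (s0 - s0))|.
  apply: (@ode_lipschitz R L w s0 s X (fun s => 0 + w 0 * (s - s0))) => // [r|r|].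
  - by move=> /andP[rs0 rs]; apply: hX; rewrite (le_trans s00) //= (le_trans rs).
  - move=> /andP[rs0 rs]; rewrite [w (0 + _)]w0; first exact: has_derivative_affine.
    by rewrite add0r mulr_le0_ge0 ?subr_ge0 // ltW.
  - exact: ltW.
rewrite Xs0 subrr mulr0 addr0 subrr normr0 mulr0 normr_le0 subr_eq0 add0r => /eqP ->.
by rewrite nmulr_rlt0 // subr_gt0.
Qed.

(** The reflection y -> 1 - y exchanges the two endpoints and changes the sign of the velocity. *)
Lemma ode_exit_gt1 (L h : R) (w X : R -> R) :
  (forall p q, `|w p - w q| <= L * `|p - q|) ->
  (forall p, 1 <= p -> w p = w 1) ->
  (forall t, 0 <= t <= h -> forall J, has_derivative J X t (w (X t))) ->
  X 0 <= 1 -> forall t, 0 <= t <= h -> 1 < X t ->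
  exists s0, [/\ 0 <= s0, s0 < t, X s0 = 1 & forall s, s0 < s <= h -> 1 < X s].
Proof.
move=> wL w1 hX X1 t th Xt.
have [|||||s0 [s00 s0t Xs0 hs]] := @ode_exit_neg L h (fun y => - w (1 - y)) (fun s => 1 - X s) _ _ _ _ t th.
- move=> p q; rewrite opprK addrC (le_trans (wL _ _)) //.
  by rewrite (_ : 1 - q - (1 - p) = p - q) //; ring.
- by move=> p p0; rewrite subr0 w1 //; lra.
- move=> s sh J; have := has_derivativeB (@has_derivative_cst R J 1 s) (hX s sh J).
  by rewrite subKr sub0r.
- by rewrite subr_ge0.
- by rewrite subr_lt0.
exists s0; split => //; first by lra.
by move=> s /hs; rewrite subr_lt0.
Qed.

End exit_of_half_line.

Section stopped_flow_facts.
Context {R : realType}.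
Variables (u : I01 R -> R) (K L : R).
Hypothesis L0 : 0 <= L.
Hypothesis uK : forall x, `|u x| <= K.
Hypothesis uL : lipschitz_I01 L u.

(** The velocity extended by its endpoint values. This keeps the constants K and L, and is constant
    on each half-line outside [0,1], as the exit lemmas require. *)
Let w : R -> R := u \o proj01.

Let wL p q : `|w p - w q| <= L * `|p - q|.
Proof. by rewrite (le_trans (uL _ _)) // ler_wpM2l // proj01_lip. Qed.

Let proj01_le0 (p : R) : p <= 0 -> proj01 p = proj01 0.
Proof.
move=> p0; apply: I01_inj; rewrite !proj01E min_r ?(le_trans p0) ?ler01 // max_l //.
by rewrite min_r ?ler01 // max_l.
Qed.

Let proj01_ge1 (p : R) : 1 <= p -> proj01 p = proj01 1.
Proof. by move=> p1; apply: I01_inj; rewrite !proj01E min_l // min_l. Qed.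

Section one_trajectory.
Variable x0 : I01 R.
Let E := existence_interval u x0.

Let solves_derivative J x t : solves u x0 J x -> J t ->
  has_derivative J (fun s => \val (x s)) t (w (\val (x t))).
Proof. by move=> [_ h] /h /derivative_withinP; rewrite /w /= proj01K. Qed.

Let derivative_solves J (z : R -> R) : z 0 = \val x0 ->
  (forall t, J t -> 0 <= z t <= 1) ->
  (forall t, J t -> has_derivative J z t (w (z t))) -> solves u x0 J (proj01 \o z).
Proof.
move=> z0 z01 hz; split; first by rewrite /= z0 proj01K.
move=> t Jt; apply/derivative_withinP.
apply: has_derivative_near ltr01 _ _ (hz t Jt).
  exact: (esym (proj01_id (z01 t Jt))).
by move=> r Jr _; split => //; exact: proj01_id (z01 r Jr).
Qed.

Let solves_sub J J' x : J' `<=` J -> solves u x0 J x -> solves u x0 J' x.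
Proof.
move=> JJ [x00 h]; split => // t /JJ Jt; apply/derivative_withinP.
by apply: has_derivative_sub JJ _; apply/derivative_withinP; exact: h.
Qed.

Let E_down s t : E t -> 0 <= s <= t -> E s.
Proof.
move=> [t0 [x hx]] /andP[s0 st]; split => //; exists x.
apply: solves_sub hx => r; rewrite /= !in_itv /= => /andP[-> rs].
exact: le_trans rs st.
Qed.

Let E0 : E 0.
Proof.
split => //; exists (cst x0); split => // t; rewrite /= in_itv /= => /le_anti <-.
apply/derivative_withinP => e e0; exists 1 => // r; rewrite /= in_itv /= => /le_anti <- _.
by rewrite !subrr mulr0 subrr normr0 mulr0.
Qed.

Let solution_unique x y (s t : R) (J J' : set R) : solves u x0 J x -> solves u x0 J' y ->
  `[0, s]%classic `<=` J -> `[0, s]%classic `<=` J' -> 0 <= s -> x s = y s.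
Proof.
move=> hx hy J1 J2 s0; apply: I01_inj; apply/eqP; rewrite -subr_eq0 -normr_le0.
rewrite (le_trans (@ode_lipschitz R L w 0 s (fun r => \val (x r)) (fun r => \val (y r)) wL _ _ s0)) //.
- by move=> r r0; apply: (solves_derivative (solves_sub J1 hx)); rewrite /= in_itv.
- by move=> r r0; apply: (solves_derivative (solves_sub J2 hy)); rewrite /= in_itv.
- by rewrite hx.1 hy.1 subrr normr0 mulr0.
Qed.

Let E_itv t : E t -> `[0, t]%classic `<=` E.
Proof. by move=> Et s; rewrite /= in_itv /=; exact: E_down. Qed.

(** Solutions on the intervals [0,t] agree on overlaps by uniqueness, so the diagonal t -> x t t
    solves the equation on all of [E]; the choice in [maximal_solution] is therefore not the
    default. *)
Lemma maximal_solution_solves : solves u x0 E (maximal_solution u x0).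
Proof.
rewrite /maximal_solution; case: xgetP => [x _ //|noX]; exfalso.
have /choice[x hx] : forall t, exists x, E t -> solves u x0 `[0, t]%classic x.
  move=> t; have [[_ [x hx]]|nE] := pselect (E t); first by exists x.
  by exists (cst x0).
have xE s t : E t -> 0 <= s <= t -> x s s = x t s.
  move=> Et st; have Es := E_down Et st; have /andP[s0 st'] := st.
  apply: (solution_unique 0 (hx s Es) (hx t Et)) => // r; rewrite /= !in_itv /= => /andP[-> rs].
  exact: le_trans rs st'.
apply: (noX (fun t => x t t)); split; first exact: (hx 0 E0).1.
move=> t Et; apply/derivative_withinP.
(* The derivative at t involves times slightly after t, so a solution reaching some t' > t is taken
   if [E] has one; if t is the last point of [E], t' = t suffices. *)
have [t' [d [Et' tt' d0 hd]]] : exists t' d, [/\ E t', t <= t', 0 < d &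
    forall r, E r -> `|r - t| < d -> r <= t'].
  have [[t' [Et' tt']]|h] := pselect (exists t', E t' /\ t < t').
    exists t', (t' - t); split => //; [exact: ltW|by rewrite subr_gt0|].
    by move=> r _; rewrite ltr_norml => /andP[_]; rewrite ltrD2r; exact: ltW.
  exists t, 1; split => // r Er _; rewrite leNgt; apply/negP => tr.
  by apply: h; exists r.
have t0 : 0 <= t by case: Et.
have := solves_derivative (hx t' Et') (t := t).
rewrite /= in_itv /= t0 => /(_ tt'); rewrite /w /= proj01K => D.
rewrite (xE t t') ?t0 //.
apply: has_derivative_near d0 _ _ D; first by rewrite (xE t t') ?t0.
move=> r Er rd; have r0 : 0 <= r by case: Er.
by have rt' := hd r Er rd; rewrite /= in_itv /= r0 rt' (xE r t') ?r0.
Qed.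

Section local_solution.
Variables (h : R) (X : R -> R).
Hypothesis X0 : X 0 = \val x0.
Hypothesis hX : forall t, 0 <= t <= h -> forall J, has_derivative J X t (w (X t)).

Let X0_itv : 0 <= X 0 <= 1. Proof. by rewrite X0 I01_itv. Qed.

Let exit_neg t : 0 <= t <= h -> X t < 0 ->
  exists s0, [/\ 0 <= s0, s0 < t, X s0 = 0 & forall s, s0 < s <= h -> X s < 0].
Proof.
apply: (ode_exit_neg wL _ hX); last by have /andP[] := X0_itv.
by move=> p p0; rewrite /w /= (proj01_le0 p0).
Qed.

Let exit_gt1 t : 0 <= t <= h -> 1 < X t ->
  exists s0, [/\ 0 <= s0, s0 < t, X s0 = 1 & forall s, s0 < s <= h -> 1 < X s].
Proof.
apply: (ode_exit_gt1 wL _ hX); last by have /andP[] := X0_itv.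
by move=> p p0; rewrite /w /= (proj01_ge1 p0).
Qed.

(** An exit is final, so a trajectory that is inside at time t has been inside throughout [0,t] and
    is a genuine solution there. *)
Let inside_E t : 0 <= t <= h -> 0 <= X t <= 1 -> E t.
Proof.
move=> /andP[t0 th] /andP[Xt0 Xt1].
have Xs s : 0 <= s <= t -> 0 <= X s <= 1.
  move=> /andP[s0 st]; have sh : 0 <= s <= h by rewrite s0 (le_trans st).
  apply/andP; split; rewrite leNgt; apply/negP => Xs.
    have [r [r0 rs _ hr]] := exit_neg sh Xs.
    by move: Xt0; rewrite leNgt hr // th (lt_le_trans rs).
  have [r [r0 rs _ hr]] := exit_gt1 sh Xs.
  by move: Xt1; rewrite leNgt hr // th (lt_le_trans rs).
split => //; exists (proj01 \o X); apply: derivative_solves => // s.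
by rewrite /= in_itv /= => /andP[s0 st]; apply: hX; rewrite s0 (le_trans st).
Qed.

Let maximal_solutionE t : E t -> t <= h -> \val (maximal_solution u x0 t) = X t.
Proof.
move=> Et th; have t0 : 0 <= t by case: Et.
apply/eqP; rewrite -subr_eq0 -normr_le0.
rewrite (le_trans (@ode_lipschitz R L w 0 t (fun r => \val (maximal_solution u x0 r)) X wL _ _ t0)) //.
- move=> r r0; apply: (solves_derivative (solves_sub (E_itv Et) maximal_solution_solves)).
  by rewrite /= in_itv.
- by move=> r /andP[r0 rt]; apply: hX; rewrite r0 (le_trans rt).
- by rewrite maximal_solution_solves.1 X0 subrr normr0 mulr0.
Qed.

(** The existence interval is exactly [0,s0]: a later time in it, cut down to h, would place X
    inside [0,1] after s0. The exit time is thus finite and attained at s0. *)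
Let flow_exited t s0 : 0 <= s0 -> s0 < t -> t <= h -> 0 <= X s0 <= 1 ->
  (forall s, s0 < s <= h -> ~ (0 <= X s <= 1)) -> \val (flow u t x0) = X s0.
Proof.
move=> s00 s0t th Xs0 hs.
have s0h : s0 <= h by rewrite (le_trans _ th) // ltW.
have Es0 : E s0 by apply: inside_E => //; rewrite s00.
have ltE s : s0 < s -> ~ E s.
  move=> s0s Es; have s0m : s0 < Num.min s h by rewrite lt_min s0s (lt_le_trans s0t).
  have mh : Num.min s h <= h by rewrite ge_min lexx orbT.
  have Em : E (Num.min s h).
    by apply: E_down Es _; rewrite ge_min lexx andbT (le_trans s00) // ltW.
  by apply: (hs (Num.min s h)); rewrite ?s0m // -(maximal_solutionE Em mh) I01_itv.
have exitE : exit_time u x0 = s0%:E.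
  apply/le_anti/andP; split.
    apply: ge_ereal_sup => _ [s Es <-]; rewrite lee_fin leNgt; apply/negP.
    by move=> /ltE.
  by apply: ereal_sup_ubound; exists s0.
rewrite /flow; case: ifPn => [/asboolP /(ltE _ s0t) //|_].
by rewrite exitE /= maximal_solutionE.
Qed.

(** After leaving through an endpoint, X stays beyond it, so its projection is that endpoint, which
    is where the flow was stopped. *)
Lemma flow_local t : 0 <= t <= h -> flow u t x0 = proj01 (X t).
Proof.
move=> th; have /andP[t0 t_h] := th; apply: I01_inj.
have [X_lt0|X_ge0] := ltP (X t) 0.
  have [s0 [s00 s0t Xs0 hs]] := exit_neg th X_lt0.
  rewrite (proj01_le0 (ltW X_lt0)) proj01_id ?lexx ?ler01 // (@flow_exited _ s0) //.
    by rewrite Xs0 lexx ler01.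
  by move=> s /hs Xs /andP[]; rewrite leNgt Xs.
have [X_gt1|X_le1] := ltP 1 (X t).
  have [s0 [s00 s0t Xs0 hs]] := exit_gt1 th X_gt1.
  rewrite (proj01_ge1 (ltW X_gt1)) proj01_id ?lexx ?ler01 // (@flow_exited _ s0) //.
    by rewrite Xs0 lexx ler01.
  by move=> s /hs Xs /andP[_]; rewrite leNgt Xs.
have Xt : 0 <= X t <= 1 by rewrite X_ge0.
rewrite proj01_id // /flow ifT; last by apply/asboolP; exact: inside_E.
by apply: maximal_solutionE => //; exact: inside_E.
Qed.

End local_solution.
End one_trajectory.

Variable h : R.
Hypothesis h0 : 0 <= h.
Hypothesis hL : h * L <= 2^-1.

Let local_solution x0 : exists X : R -> R, [/\ X 0 = \val x0,
  (forall t, 0 <= t <= h -> forall J, has_derivative J X t (w (X t))) &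
  forall t, 0 <= t <= h -> flow u t x0 = proj01 (X t)].
Proof.
have [X X0 hX] := @picard R L K h w (\val x0) h0 L0 wL (fun p => uK _) hL.
by exists X; split => // t; exact: flow_local.
Qed.

Let displacement (X : R -> R) t : 0 <= t <= h ->
  (forall t, 0 <= t <= h -> forall J, has_derivative J X t (w (X t))) ->
  `|X t - X 0| <= K * t.
Proof.
move=> /andP[t0 th] hX; rewrite -[t in _ * t]subr0.
apply: (has_derivative_le t0 (g' := fun s => w (X s))) => [s /andP[s0 st]|s _].
  by apply: hX; rewrite s0 (le_trans st).
exact: uK.
Qed.

Lemma flow_displacement t x : 0 <= t <= h -> `|\val (flow u t x) - \val x| <= K * t.
Proof.
move=> th; have [X [X0 hX ->]] := local_solution x => //.
have -> : \val x = \val (proj01 (X 0)) by rewrite X0 proj01K.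
by rewrite (le_trans (proj01_lip _ _)) // displacement.
Qed.

(** While X is inside, its velocity differs from u x by at most L times the displacement K t, which
    integrates to the quadratic remainder. If X is outside, the projection sits at an endpoint. *)
Lemma flow_first_order t x : 0 <= t <= h ->
  [\/ `|\val (flow u t x) - \val x - t * u x| <= L * K * t * t,
      \val (flow u t x) = 0 | \val (flow u t x) = 1].
Proof.
move=> th; have [X [X0 hX ->]] := local_solution x => //.
have [X_lt0|X_ge0] := ltP (X t) 0.
  by constructor 2; rewrite (proj01_le0 (ltW X_lt0)) proj01_id // lexx ler01.
have [X_gt1|X_le1] := ltP 1 (X t).
  by constructor 3; rewrite (proj01_ge1 (ltW X_gt1)) proj01_id // lexx ler01.
constructor 1; rewrite proj01_id ?X_ge0 //.
have K0 : 0 <= K by rewrite (le_trans _ (uK x)).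
have /andP[t0 t_h] := th.
pose g s := X s - (\val x + u x * (s - 0)).
have -> : X t - \val x - t * u x = g t - g 0 by rewrite /g X0; ring.
rewrite -[X in _ * _ * _ * X]subr0.
apply: (has_derivative_le t0 (g' := fun s => w (X s) - u x)) => s /andP[s0 st].
  by apply: has_derivativeB; [apply: hX; rewrite s0 (le_trans st)|exact: has_derivative_affine].
have sh : 0 <= s <= h by rewrite s0 (le_trans st).
have -> : u x = w (X 0) by rewrite /w /= X0 proj01K.
rewrite (le_trans (wL _ _)) // -mulrA ler_wpM2l //.
by rewrite (le_trans (displacement sh hX)) // ler_wpM2l.
Qed.

Lemma flow_lipschitz t x y : 0 <= t <= h ->
  `|\val (flow u t x) - \val (flow u t y)| <= expR (L * t) * `|\val x - \val y|.
Proof.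
move=> th; have [X [X0 hX ->]] := local_solution x => //.
have [Y [Y0 hY ->]] := local_solution y => //.
have /andP[t0 t_h] := th.
rewrite (le_trans (proj01_lip _ _)) // -X0 -Y0.
have := @ode_lipschitz R L w 0 t X Y wL _ _ t0; rewrite subr0; apply => s /andP[s0 st].
  by apply: hX; rewrite s0 (le_trans st).
by apply: hY; rewrite s0 (le_trans st).
Qed.

Lemma flow_continuous_comp t (phi : I01 R -> R) : 0 <= t <= h -> continuous phi ->
  continuous (phi \o flow u t).
Proof.
move=> th cphi.
have -> : phi \o flow u t = (phi \o proj01) \o (fun x => \val (flow u t x)).
  by apply/funext => x /=; rewrite proj01K.
move=> x; apply: continuous_comp.
  by apply: (@lipschitz_I01_continuous R (expR (L * t))) => p q; exact: flow_lipschitz.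
apply: continuous_comp; [exact: continuous_proj01|exact: cphi].
Qed.

Lemma flow_measurable t : 0 <= t <= h -> measurable_fun setT (flow u t).
Proof.
move=> th; apply: measurable_into_I01; apply: continuous_measurable_I01.
by apply: (@lipschitz_I01_continuous R (expR (L * t))) => p q; exact: flow_lipschitz.
Qed.

End stopped_flow_facts.

(** * Mild solutions with frozen velocity *)

Section bochner_estimate.
Context {R : realType}.

Lemma ereal_cvg0_lt (I : Type) (F : set_system I) {FF : Filter F}
    (u : I -> \bar R) (e : R) :
  u x @[x --> F] --> 0%E -> 0 < e -> \forall x \near F, (u x < e%:E)%E.
Proof.
move=> /fine_cvgP[fin /cvgrPdist_lt /(_ e) h] e0.
near=> x.
have fx : u x \is a fin_num by near: x.
have : `|0 - (fine \o u) x| < e by near: x; exact: h.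
rewrite sub0r normrN /= => /(le_lt_trans (ler_norm _)).
by rewrite -lte_fin fineK.
Unshelve. all: by end_near.
Qed.

(* No measurability: the integral of a nonnegative function is defined as the
   supremum of the integrals of the simple functions below it. *)
Lemma ge0_le_integral_nonmeasurable d (T : measurableType d)
    (mu : {measure set T -> \bar R}) (D : set T) (g1 g2 : T -> \bar R) :
  (forall x, D x -> (0 <= g1 x)%E) -> (forall x, D x -> (g1 x <= g2 x)%E) ->
  (\int[mu]_(x in D) g1 x <= \int[mu]_(x in D) g2 x)%E.
Proof.
move=> g10 g12; rewrite !ge0_integralE //; last first.
  by move=> x Dx; rewrite (le_trans (g10 x Dx)) // g12.
apply: ge_ereal_sup => _ [h hg1 <-]; apply: ereal_sup_ubound; exists h => // x.
apply: le_trans (hg1 x) _; rewrite !patchE; case: ifPn => // /[!inE]; exact: g12.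
Qed.

Let lambda := @lebesgue_measure R.

Lemma Rintegral_step (D : set R) (n : nat) (A : 'I_n -> set R) (v : 'I_n -> R) :
  measurable D -> (forall i, [/\ measurable (A i), A i `<=` D & (lambda (A i) < +oo)%E]) ->
  lambda.-integrable D (EFin \o (fun x => \sum_(i < n) \1_(A i) x * v i)) /\
  \int[lambda]_(x in D) (\sum_(i < n) \1_(A i) x * v i) =
    \sum_(i < n) fine (lambda (A i)) * v i.
Proof.
move=> mD hA; elim: (index_enum _) => [|i r [IH1 IH2]].
  rewrite big_nil; split; last first.
    by under eq_Rintegral do rewrite big_nil; rewrite Rintegral_cst // mul0r.
  have -> : EFin \o (fun x : R => \sum_(j <- [::]) \1_(A j) x * v j) = cst 0%E.
    by apply/funext => x /=; rewrite big_nil.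
  exact: integrable0.
have [mA AD Aoo] := hA i.
have i1 : lambda.-integrable D (EFin \o (fun x => \1_(A i) x * v i)).
  have -> : EFin \o (fun x => \1_(A i) x * v i) = (fun x => (\1_(A i) x)%:E * (v i)%:E)%E.
    by apply/funext => x /=; rewrite EFinM.
  apply: integrableZr => //.
  apply/integrableP; split; first exact/measurable_EFinP/measurable_indic.
  under eq_integral do rewrite gee0_abs ?lee_fin ?indicE ?ler0n //.
  by rewrite integral_indic //= (setIidl AD).
have E : (fun x => \sum_(j <- i :: r) \1_(A j) x * v j) =
    (fun x => \1_(A i) x * v i + \sum_(j <- r) \1_(A j) x * v j).
  by apply/funext => x; rewrite big_cons.
rewrite E big_cons; split.
  have -> : EFin \o (fun x => \1_(A i) x * v i + \sum_(j <- r) \1_(A j) x * v j) =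
     (EFin \o (fun x => \1_(A i) x * v i)) \+ (EFin \o (fun x => \sum_(j <- r) \1_(A j) x * v j)).
    by apply/funext => x /=; rewrite EFinD.
  exact: integrableD.
rewrite RintegralD // IH2; congr (_ + _).
rewrite RintegralZr //; last first.
  apply/integrableP; split; first exact/measurable_EFinP/measurable_indic.
  under eq_integral do rewrite gee0_abs ?lee_fin ?indicE ?ler0n //.
  by rewrite integral_indic //= (setIidl AD).
by rewrite /Rintegral integral_indic // (setIidl AD).
Qed.

(** Evaluation at phi is dominated by the dual norm. An approximating simple map evaluated at phi is
    a scalar step function within d + N of c, where N is its dual norm distance to F; the integral
    of N tends to 0. *)
Lemma bochner_estimate (t c d : R) (F : R -> (I01 R -> R) -> R)
    (B : (I01 R -> R) -> R) (phi : I01 R -> R) :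
  0 <= t -> (BL_norm phi <= 1)%E ->
  bochner_integral BL_dual_norm BL_completion `[0, t]%classic F B ->
  (forall s, 0 <= s <= t -> `|F s phi - c| <= d) ->
  `|B phi - c * t| <= d * t.
Proof.
move=> t0 phi1 [_ [s [son _ cvgint cvgI]]] hF.
set D : set R := `[0, t]%classic.
have mD : measurable (D : set (measurableTypeR R)) by exact: measurable_itv.
have lD : lambda D = t%:E.
  by rewrite /lambda /D lebesgue_measure_itv /= lte_fin sube0; case: ltgtP t0 => // <-.
have hN l : (`|l phi|%:E <= BL_dual_norm l)%E by apply: ereal_sup_ubound; exists phi.
have d0 : 0 <= d by apply: le_trans (hF 0 _); rewrite ?lexx.
have sumE n (a : 'I_n -> R) (v : 'I_n -> (I01 R -> R) -> R) :
    (\sum_(i < n) a i *: v i) phi = \sum_(i < n) a i * v i phi by rewrite fct_sumE.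
have subE (l1 l2 : (I01 R -> R) -> R) : (l1 - l2) phi = l1 phi - l2 phi by [].
have cstI (r : R) : lambda.-integrable D (EFin \o cst r).
  apply: continuous_compact_integrable; first exact: segment_compact.
  by apply: continuous_subspaceT; exact: cst_continuous.
have key n : (`|simple_integral (s n) phi - c * t|%:E <=
    (d * t)%:E + \int[lambda]_(x in D) BL_dual_norm (F x - simple_eval (s n) x)%R)%E.
  pose g (x : R) : R := simple_eval (s n) x phi.
  have gE : g = fun x => \sum_(i < sm_size (s n)) \1_(@sm_set _ _ (s n) i) x * @sm_val _ _ (s n) i phi.
    by apply/funext => x; rewrite /g /simple_eval sumE.
  have [|ig Ig] := @Rintegral_step D _ (@sm_set _ _ (s n)) (fun i => @sm_val _ _ (s n) i phi) mD.
    by move=> i; have [? ? ? _] := son n i.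
  rewrite -gE in ig Ig.
  have igc : lambda.-integrable D (EFin \o (fun x => g x - c)).
    have -> : EFin \o (fun x => g x - c) = ((EFin \o g) \- (EFin \o cst c))%E.
      by apply/funext => x /=; rewrite EFinB.
    exact: integrableB.
  have -> : simple_integral (s n) phi - c * t = \int[lambda]_(x in D) (g x - c).
    rewrite (RintegralB mD ig (cstI c)) (Rintegral_cst lambda mD c) Ig /simple_integral sumE.
    by rewrite [fine (lambda D)](congr1 fine lD).
  (* The dual norm of the error is not known to be measurable in x, so its integral cannot be added
     to another one. The function k is measurable, lies below that norm, and still satisfies |g - c|
     <= d + k. *)
  pose k x := Num.max 0 (`|g x - c| - d).
  have k0 x : 0 <= k x by rewrite le_max lexx.
  have mk : measurable_fun D k.
    apply: measurable_maxr => //; apply: measurable_funB => //.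
    apply: measurableT_comp => //.
    by have /integrableP[/measurable_EFinP] := igc.
  have kN : (\int[lambda]_(x in D) (k x)%:E <=
      \int[lambda]_(x in D) BL_dual_norm (F x - simple_eval (s n) x)%R)%E.
    apply: ge0_le_integral_nonmeasurable => [x _|x]; first by rewrite lee_fin.
    rewrite /D /= in_itv /= => xt.
    rewrite (le_trans _ (hN _)) // lee_fin ge_max normr_ge0 /= lerBlDr.
    have -> : g x - c = - ((F x - simple_eval (s n) x) phi) + (F x phi - c).
      by rewrite subE /g; ring.
    by rewrite (le_trans (ler_normD _ _)) // normrN lerD // hF.
  rewrite (le_trans _ (leeD (lexx _) kN)) //.
  have -> : (d * t)%:E = (\int[lambda]_(x in D) (cst d x)%:E)%E.
    by have := integral_cst lambda mD d%:E; rewrite [X in (_ * X)%E](lD : _ = _) => ->.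
  rewrite -ge0_integralD //; last 3 first.
  - exact/measurable_EFinP/measurable_cst.
  - by move=> x _; rewrite lee_fin.
  - exact/measurable_EFinP.
  rewrite (@le_trans _ _ (`|\int[lambda]_(x in D) (g x - c)%:E|)%E) //.
    rewrite /Rintegral EFin_normr_Rintegral //.
  rewrite (le_trans (le_abse_integral _ _ _)) //.
    by have /integrableP[] := igc.
  apply: ge0_le_integral_nonmeasurable => //.
  move=> x _ /=; rewrite lee_fin -lerBlDl le_max lexx orbT //.
apply/ler_addgt0Pr => e e0.
have e20 : 0 < e / 2 by rewrite divr_gt0.
near \oo => n.
have h1 : (\int[lambda]_(x in D) BL_dual_norm (F x - simple_eval (s n) x)%R < (e / 2)%:E)%E.
  by near: n; exact: ereal_cvg0_lt cvgint e20.
have h2 : (BL_dual_norm (B - simple_integral (s n))%R < (e / 2)%:E)%E.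
  by near: n; exact: ereal_cvg0_lt cvgI e20.
have h3 : `|(B - simple_integral (s n)) phi| <= e / 2.
  by rewrite -lee_fin (le_trans (hN _)) // ltW.
have h4 : `|simple_integral (s n) phi - c * t| <= d * t + e / 2.
  by rewrite -lee_fin (le_trans (key n)) // EFinD leeD2l // ltW.
have -> : B phi - c * t = (simple_integral (s n) phi - c * t) + (B - simple_integral (s n)) phi.
  by rewrite subE; ring.
rewrite (le_trans (ler_normD _ _)) // (le_trans (lerD h4 h3)) //.
by rewrite -addrA -splitr.
Unshelve. all: by end_near.
Qed.

End bochner_estimate.

Section mild_estimates.
Context {R : realType}.
Implicit Types (phi : I01 R -> R) (nu : M01 R).

(** The only form in which Duhamel's formula is used: c = 0 gives bounds on size and displacement,
    while c = <nu, f phi> gives the first-order expansion of a step. *)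
Lemma mild_estimate (f u : I01 R -> R) (S t c d : R) nu (m : R -> M01 R) phi :
  mild_fixed f u S nu m -> 0 <= t <= S -> BL phi ->
  (forall s, 0 <= s <= t -> `|pairing (P u (t - s) (density f (m s))) phi - c| <= d) ->
  `|pairing (m t) phi - pairing (P u t nu) phi - c * t| <= d * t.
Proof.
move=> [_ _ hB] /andP[t0 tS] blphi hd.
have [|B [bochner BE]] := hB t; first by rewrite /= in_itv /= t0.
have [C [L [C0 L0 phiC phiL]]] := (BLP phi).1 blphi.
(* Scaling into the unit ball of BL; the 1 keeps the factor defined for phi = 0. *)
pose a := (C + L + 1)^-1.
have a0 : 0 < a by rewrite invr_gt0 ltr_wpDl // addr_ge0.
have aC x : `|a * phi x| <= a * C by rewrite normrM gtr0_norm // ler_pM2l.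
have aL : lipschitz_I01 (a * L) (fun x => a * phi x).
  by move=> x y; rewrite -mulrBr normrM gtr0_norm // -mulrA ler_pM2l.
have aphi1 : (BL_norm (fun x => a * phi x)%R <= 1)%E.
  apply: BL_norm_le1 aC _ aL _; first by rewrite mulr_ge0 // ltW.
  by rewrite -mulrDr ler_pdivrMl ?ltr_wpDl ?addr_ge0 // mulr1 lerDl.
have blaphi : BL (fun x => a * phi x).
  by apply/BLP; exists (a * C), (a * L); split => //; rewrite mulr_ge0 // ltW.
have bphi := BL_bounded_measurable blphi.
have := bochner_estimate (c := a * c) (d := a * d) t0 aphi1 bochner.
have -> : B (fun x => a * phi x) = a * (pairing (m t) phi - pairing (P u t nu) phi).
  by have := BE _ blaphi; rewrite !pairingZ //; lra.
rewrite -mulrA -mulrBr normrM gtr0_norm // -mulrA ler_pM2l //; apply => s st.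
by rewrite pairingZ // -mulrBr normrM gtr0_norm // ler_pM2l //; exact: hd.
Qed.

Variables (f u : I01 R -> R) (F K L h A S : R) (nu : M01 R) (m : R -> M01 R).
Hypothesis fF : forall x, `|f x| <= F.
Hypothesis cf : continuous f.
Hypothesis L0 : 0 <= L.
Hypothesis uK : forall x, `|u x| <= K.
Hypothesis uL : lipschitz_I01 L u.
Hypothesis h0 : 0 <= h.
Hypothesis hL : h * L <= 2^-1.
Hypothesis hF : h * F <= 2^-1.
Hypothesis hS : h <= S.
Hypothesis nuA : (TV_norm nu <= A%:E)%E.
Hypothesis mild : mild_fixed f u S nu m.

Let F0 : 0 <= F. Proof. exact: le_trans (fF (proj01 0)). Qed.
Let K0 : 0 <= K. Proof. exact: le_trans (uK (proj01 0)). Qed.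
Let A0 : 0 <= A. Proof. by rewrite -lee_fin (le_trans (TV_norm_ge0 nu)). Qed.

Let bf : bounded_measurable f. Proof. exact: continuous_bounded_measurable fF. Qed.

Let pairing_P r rho phi C : 0 <= r <= h -> continuous phi -> (forall x, `|phi x| <= C) ->
  pairing (P u r rho) phi = pairing rho (phi \o flow u r).
Proof.
move=> rh cphi phiC; rewrite /P pairing_image //.
  exact: (flow_measurable L0 uK uL h0 hL).
exact: continuous_bounded_measurable phiC.
Qed.

Let flow_comp r phi : 0 <= r <= h -> continuous phi -> continuous (phi \o flow u r).
Proof. exact: (flow_continuous_comp L0 uK uL h0 hL). Qed.

Let pairing_P_density r rho phi C : 0 <= r <= h -> continuous phi ->
  (forall x, `|phi x| <= C) ->
  pairing (P u r (density f rho)) phi = pairing rho (fun x => f x * phi (flow u r x)).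
Proof.
move=> rh cphi phiC; rewrite (pairing_P _ rh cphi phiC) pairing_density //.
by apply: (@continuous_bounded_measurable _ _ C) => [|x]; [exact: flow_comp|exact: phiC].
Qed.

Let source_le r rho c phi C : (TV_norm rho <= c%:E)%E -> 0 <= r <= h -> continuous phi ->
  (forall x, `|phi x| <= C) -> `|pairing (P u r (density f rho)) phi| <= c * (F * C).
Proof.
move=> rhoc rh cphi phiC; rewrite (pairing_P_density _ rh cphi phiC).
apply: TV_norm_pairing => //; first exact: I01_continuousM (flow_comp rh cphi).
by move=> x; rewrite normrM ler_pM.
Qed.

(** One round of a bootstrap: transport does not increase total variation, and a source of strength
    at most F c acts for a time s. *)
Let TV_le_aux c : (forall s, 0 <= s <= h -> (TV_norm (m s) <= c%:E)%E) ->
  forall s, 0 <= s <= h -> (TV_norm (m s) <= (A + s * F * c)%:E)%E.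
Proof.
move=> mc s /andP[s0 sh]; apply: TV_norm_BL => phi blphi phi1.
have cphi := BL_continuous_fun blphi.
have sS : 0 <= s <= S by rewrite s0 (le_trans sh).
have := @mild_estimate f u S s 0 (c * (F * 1)) nu m phi mild sS blphi.
rewrite mul0r subr0 => est.
have : `|pairing (m s) phi - pairing (P u s nu) phi| <= c * (F * 1) * s.
  apply: est => r /andP[r0 rs]; rewrite subr0; apply: source_le => //.
    by apply: mc; rewrite r0 (le_trans rs).
  by rewrite subr_ge0 rs (le_trans _ sh) // gerBl.
have : `|pairing (P u s nu) phi| <= A * 1.
  rewrite (pairing_P _ _ cphi phi1) ?s0 //; apply: TV_norm_pairing => //.
    by apply: flow_comp => //; rewrite s0.
  by move=> x; exact: phi1.
rewrite !ler_norml => /andP[_ ?] /andP[_ ?].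
have -> : s * F * c = c * (F * 1) * s by ring.
lra.
Qed.

(** Since h F <= 1/2, a round of the bootstrap maps a bound c to at most A + c/2, whose fixed point
    is 2 A. Starting from the bound C contained in [mild_fixed], the excess over 2 A is halved each
    time. *)
Lemma mild_TV_le2 s : 0 <= s <= h -> (TV_norm (m s) <= (2 * A)%:E)%E.
Proof.
move=> sh; have [_ [C hC] _] := mild.
have C0 : 0 <= C.
  by rewrite -lee_fin (le_trans (TV_norm_ge0 (m 0))) // hC //= in_itv /= lexx (le_trans h0).
have step n : forall s, 0 <= s <= h -> (TV_norm (m s) <= (2 * A + C / 2 ^+ n)%:E)%E.
  elim: n => [r /andP[r0 rh]|n IH r rh].
    rewrite (le_trans (hC r _)) ?lee_fin ?expr0 ?divr1 ?lerDr ?mulr_ge0 //.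
    by rewrite /= in_itv /= r0 (le_trans rh).
  rewrite (le_trans (TV_le_aux IH rh)) // lee_fin.
  have /andP[r0 rh'] := rh.
  have : r * F <= 2^-1 by rewrite (le_trans _ hF) // ler_wpM2r.
  have q0 : 0 <= 2 * A + C / 2 ^+ n by rewrite addr_ge0 ?mulr_ge0 // divr_ge0 // exprn_ge0.
  move=> /(ler_wpM2r q0); rewrite exprS invfM mulrCA.
  by move: (C / 2 ^+ n) => z; lra.
have [t t0 ht] := TV_norm_fin (m s); rewrite ht lee_fin -subr_le0.
apply: (geometric_small_eq0 C0) => n; rewrite lerBlDl.
by have := step n s sh; rewrite ht lee_fin.
Qed.

(** One more round, started from 2 A, yields a factor 1 + O(h); unlike 2, it can be multiplied over
    all steps of a partition. *)
Lemma mild_TV_le : (TV_norm (m h) <= ((1 + 2 * F * h) * A)%:E)%E.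
Proof.
rewrite (le_trans (TV_le_aux mild_TV_le2 _)) ?h0 ?lexx // lee_fin.
by rewrite le_eqVlt; apply/orP; left; apply/eqP; ring.
Qed.

Lemma mild_displacement s phi C L' : 0 <= s <= h -> (forall x, `|phi x| <= C) ->
  0 <= L' -> lipschitz_I01 L' phi ->
  `|pairing (m s) phi - pairing nu phi| <= A * (L' * (K * h)) + 2 * A * (F * C) * h.
Proof.
move=> sh phiC L'0 phiL; have /andP[s0 sh'] := sh.
have C0 : 0 <= C by exact: le_trans (phiC (proj01 0)).
have blphi : BL phi by apply/BLP; exists C, L'.
have cphi := BL_continuous_fun blphi.
have sS : 0 <= s <= S by rewrite s0 (le_trans sh').
have := @mild_estimate f u S s 0 (2 * A * (F * C)) nu m phi mild sS blphi.
rewrite mul0r subr0 => est.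
have h1 : `|pairing (m s) phi - pairing (P u s nu) phi| <= 2 * A * (F * C) * h.
  rewrite (le_trans (est _)) // => [r /andP[r0 rs]|]; last first.
    by rewrite ler_wpM2l // !mulr_ge0.
  rewrite subr0; apply: source_le => //.
    by apply: mild_TV_le2; rewrite r0 (le_trans rs).
  by rewrite subr_ge0 rs (le_trans _ sh') // gerBl.
have h2 : `|pairing (P u s nu) phi - pairing nu phi| <= A * (L' * (K * h)).
  rewrite (pairing_P _ sh cphi phiC) -pairingB.
  - apply: TV_norm_pairing => //.
      by apply: I01_continuousB => //; exact: flow_comp.
    move=> x; rewrite (le_trans (phiL _ _)) // ler_wpM2l //.
    rewrite (le_trans (flow_displacement L0 uK uL h0 hL x sh)) //.
    by rewrite ler_wpM2l.
  - by apply: (@continuous_bounded_measurable _ _ C) => [|x]; [exact: flow_comp|exact: phiC].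
  - exact: continuous_bounded_measurable phiC.
have -> : pairing (m s) phi - pairing nu phi =
  (pairing (P u s nu) phi - pairing nu phi) + (pairing (m s) phi - pairing (P u s nu) phi).
  by ring.
by rewrite (le_trans (ler_normD _ _)) // lerD.
Qed.

(** In use, phi0 and phi1 are the test function at the two ends of the step and g is its derivative
    along the flow. The error has three sources: e2 from the transport of nu, F e1 from replacing
    the transported phi1 by phi0 in the source, and the displacement of m s from nu tested against f
    phi0. *)
Lemma mild_step (phi0 phi1 g : I01 R -> R) (C0 C1 Cg Lf e1 e2 : R) :
  BL phi1 -> continuous phi0 -> continuous g ->
  (forall x, `|phi1 x| <= C1) -> (forall x, `|phi0 x| <= C0) ->
  (forall x, `|g x| <= Cg) ->
  0 <= Lf -> lipschitz_I01 Lf (fun x => f x * phi0 x) ->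
  (forall r x, 0 <= r <= h -> `|phi1 (flow u r x) - phi0 x| <= e1) ->
  (forall x, `|phi1 (flow u h x) - phi0 x - h * g x| <= h * e2) ->
  `|pairing (m h) phi1 - pairing nu phi0
    - h * (pairing nu g + pairing nu (fun x => f x * phi0 x))|
  <= h * (A * e2 + (2 * A * (F * e1) + (A * (Lf * (K * h)) + 2 * A * (F * (F * C0)) * h))).
Proof.
move=> bl1 cphi0 cg phi1C phi0C gC Lf0 fphiL he1 he2.
have cphi1 := BL_continuous_fun bl1.
have hh : 0 <= h <= h by rewrite h0 lexx.
have hS' : 0 <= h <= S by rewrite h0.
have fphiC x : `|f x * phi0 x| <= F * C0 by rewrite normrM ler_pM.
set c := pairing nu (fun x => f x * phi0 x).
set d := 2 * A * (F * e1) + _.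
have b0 := continuous_bounded_measurable cphi0 phi0C.
have b1 : bounded_measurable (phi1 \o flow u h).
  by apply: (@continuous_bounded_measurable _ _ C1) => [|x]; [exact: flow_comp|exact: phi1C].
have bg := continuous_bounded_measurable cg gC.
have h1 : `|pairing (m h) phi1 - pairing (P u h nu) phi1 - c * h| <= d * h.
  apply: mild_estimate mild hS' bl1 _ => s /andP[s0 sh].
  have rh : 0 <= h - s <= h by rewrite subr_ge0 sh gerBl.
  have sh' : 0 <= s <= h by rewrite s0.
  rewrite (pairing_P_density _ rh cphi1 phi1C).
  have cfphi0 := I01_continuousM cf cphi0.
  have cfphi1 := I01_continuousM cf (flow_comp rh cphi1).
  have k1 : `|pairing (m s) (fun x => f x * phi1 (flow u (h - s) x))
      - pairing (m s) (fun x => f x * phi0 x)| <= 2 * A * (F * e1).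
    rewrite -pairingB.
    - apply: TV_norm_pairing; [exact: mild_TV_le2|exact: I01_continuousB|].
      by move=> x; rewrite -mulrBr normrM ler_pM // he1.
    - apply: (@continuous_bounded_measurable _ _ (F * C1)) => // x.
      by rewrite normrM ler_pM.
    - exact: continuous_bounded_measurable fphiC.
  have k2 := mild_displacement sh' fphiC Lf0 fphiL.
  set q := pairing (m s) (fun x => f x * phi0 x) in k1 k2.
  rewrite -(subrKA q) (le_trans (ler_normD _ _)) // lerD //.
have h2 : `|pairing (P u h nu) phi1 - pairing nu phi0 - h * pairing nu g| <= A * (h * e2).
  rewrite (pairing_P _ hh cphi1 phi1C) -pairingZ // -!pairingB //; last 2 first.
  - by under eq_fun do rewrite addrC -mulN1r; exact: bounded_measurable_lin.
  - have := bounded_measurable_lin h bg (@bounded_measurable_cst R 0).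
    by under eq_fun do rewrite addr0.
  apply: TV_norm_pairing => //.
  apply: I01_continuousB; first by apply: I01_continuousB => //; exact: flow_comp.
  by apply: I01_continuousM => //; exact: I01_continuous_cst.
have -> : pairing (m h) phi1 - pairing nu phi0 - h * (pairing nu g + c) =
  (pairing (P u h nu) phi1 - pairing nu phi0 - h * pairing nu g) +
  (pairing (m h) phi1 - pairing (P u h nu) phi1 - c * h) by ring.
rewrite (le_trans (ler_normD _ _)) //.
have -> : h * (A * e2 + d) = A * (h * e2) + d * h by ring.
exact: lerD.
Qed.

End mild_estimates.

(** * Test functions *)

Section rectangle_functions.
Context {R : realType}.
Variable T : R.
Let K : set (R * R) := `[0, 1]%classic `*` `[0, T]%classic.

Lemma rectangleP (x t : R) : K (x, t) <-> (0 <= x <= 1 /\ 0 <= t <= T).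
Proof. by rewrite /K /= !in_itv. Qed.

Let compact_K : compact K.
Proof. by apply: compact_setX; exact: segment_compact. Qed.

Lemma small_multiple (c e : R) : 0 <= c -> 0 < e ->
  0 < e / (c + 1) /\ c * (e / (c + 1)) <= e.
Proof.
move=> c0 e0; have c1 : 0 < c + 1 by rewrite ltr_wpDl.
split; first by rewrite divr_gt0.
by rewrite mulrA ler_pdivrMr // mulrC ler_pM2l // lerDl.
Qed.

Lemma rectangle_bounded (a : R -> R -> R) :
  {within K, continuous (fun p => a p.1 p.2)} ->
  exists2 C : R, 0 <= C & forall x t, 0 <= x <= 1 -> 0 <= t <= T -> `|a x t| <= C.
Proof.
move=> ca; have /compact_bounded[M [_ hM]] := continuous_compact ca compact_K.
exists (`|M| + 1) => [|x t x01 tT]; first by rewrite addr_ge0.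
apply: (hM (`|M| + 1)); first by rewrite (le_lt_trans (ler_norm M)) // ltrDl.
by exists (x, t) => //; exact/rectangleP.
Qed.

Lemma rectangle_modulus (a : R -> R -> R) (e : R) :
  {within K, continuous (fun p => a p.1 p.2)} -> 0 < e ->
  exists2 d : R, 0 < d & forall x t y s, 0 <= x <= 1 -> 0 <= t <= T ->
    0 <= y <= 1 -> 0 <= s <= T -> `|x - y| < d -> `|t - s| < d ->
    `|a x t - a y s| <= e.
Proof.
move=> ca e0; have [d d0 hd] := compact_uniform_continuous compact_K ca e0.
exists d => // x t y s x01 tT y01 sT xy ts.
by rewrite ltW // (hd (x, t) (y, s)) //; exact/rectangleP.
Qed.

(** The intermediate point is located by its distances to both ends, which leaves the order of p and
    q free. Near the boundary it is the distance to the end q, the stopped point, that matters. *)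
Lemma has_derivative_MVT_itv (a b : R) (g g' : R -> R) (p q : R) :
  (forall t, a <= t <= b -> has_derivative `[a, b]%classic g t (g' t)) ->
  a <= p <= b -> a <= q <= b ->
  exists c, [/\ a <= c <= b, `|c - p| <= `|q - p|, `|c - q| <= `|q - p| &
    g q - g p = g' c * (q - p)].
Proof.
move=> hg; wlog pq : p q / p <= q => [H pab qab|].
  have [pq|qp] := leP p q; first exact: H.
  have [c [cab cq cp E]] := H q p (ltW qp) qab pab.
  by exists c; split; rewrite // 1?(distrC q p) //; lra.
move=> /andP[ap pb] /andP[aq qb].
have [|c /andP[pc cq] E] := @has_derivative_MVT R p q g g' pq.
  move=> t /andP[pt tq]; apply: has_derivative_sub (hg t _).
    move=> r; rewrite /= !in_itv /= => /andP[pr rq].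
    by rewrite (le_trans ap) //= (le_trans rq).
  by rewrite (le_trans ap) //= (le_trans tq).
exists c; split => //.
- by rewrite (le_trans ap) //= (le_trans cq).
- by rewrite !ger0_norm ?subr_ge0 // lerD2r.
- by rewrite distrC !ger0_norm ?subr_ge0 // lerD2l lerN2.
Qed.

Variables psi dx dt : R -> R -> R.
Hypothesis psi_test : test_function T psi dx dt.

Let cdx : {within K, continuous (fun p => dx p.1 p.2)}.
Proof. by case: psi_test => -[]. Qed.

Let cdt : {within K, continuous (fun p => dt p.1 p.2)}.
Proof. by case: psi_test => -[]. Qed.

Lemma test_MVT_x x y t : 0 <= x <= 1 -> 0 <= y <= 1 -> 0 <= t <= T ->
  exists c, [/\ 0 <= c <= 1, `|c - x| <= `|y - x|, `|c - y| <= `|y - x| &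
    psi y t - psi x t = dx c t * (y - x)].
Proof.
move=> x01 y01 tT.
apply: (@has_derivative_MVT_itv 0 1 (psi ^~ t) (dx ^~ t)) => // z z01.
apply/derivative_withinP; have [[_ _ _ D] _] := psi_test.
by have [] := D z t ((rectangleP z t).2 (conj z01 tT)).
Qed.

Lemma test_MVT_t x s t : 0 <= x <= 1 -> 0 <= s <= T -> 0 <= t <= T ->
  exists c, [/\ 0 <= c <= T, `|c - s| <= `|t - s|, `|c - t| <= `|t - s| &
    psi x t - psi x s = dt x c * (t - s)].
Proof.
move=> x01 sT tT.
apply: (@has_derivative_MVT_itv 0 T (psi x) (dt x)) => // r rT.
apply/derivative_withinP; have [[_ _ _ D] _] := psi_test.
by have [] := D x r ((rectangleP x r).2 (conj x01 rT)).
Qed.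

Lemma test_lipschitz : exists2 C : R, 0 <= C &
  forall x y s t, 0 <= x <= 1 -> 0 <= y <= 1 -> 0 <= s <= T -> 0 <= t <= T ->
  `|psi y t - psi x s| <= C * (`|y - x| + `|t - s|).
Proof.
have [C C0 hC] := rectangle_bounded cdx; have [D D0 hD] := rectangle_bounded cdt.
exists (C + D) => [|x y s t x01 y01 sT tT]; first by rewrite addr_ge0.
have [c [c01 _ _ E1]] := test_MVT_x x01 y01 tT.
have [r [rT _ _ E2]] := test_MVT_t x01 sT tT.
have -> : psi y t - psi x s = (psi y t - psi x t) + (psi x t - psi x s) by ring.
rewrite (le_trans (ler_normD _ _)) // E1 E2 !normrM mulrDr lerD //.
  by rewrite ler_wpM2r // (le_trans (hC _ _ c01 tT)) // lerDl.
by rewrite ler_wpM2r // (le_trans (hD _ _ x01 rT)) // lerDr.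
Qed.

(* A trajectory stopped before time [h] starts within [k h] of an endpoint, where
   [dx] vanishes, so stopping costs only [o(h)]. *)
Lemma test_flow_expansion (k l e : R) : 0 <= k -> 0 <= l -> 0 < e ->
  exists2 d : R, 0 < d & forall (u : I01 R -> R) (h t : R) (x : I01 R),
    (forall z, `|u z| <= k) -> lipschitz_I01 l u -> 0 <= h -> h < d ->
    h * l <= 2^-1 -> 0 <= t -> t + h <= T ->
    `|psi (\val (flow u h x)) (t + h) - psi (\val x) t
      - h * (dt (\val x) t + dx (\val x) t * u x)| <= h * e.
Proof.
move=> k0 l0 e0.
have [C C0 hC] := rectangle_bounded cdx.
(* The budget e is split as (2 k + 1) n <= e/2 for the oscillation of [dx] and [dt], and C l k m <=
   e/2 for the quadratic remainder of the flow. The radius d1 / (k + 1) below keeps the displacement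
   k h under d1. *)
have q0 : 0 < e / 2 by rewrite divr_gt0.
have c0 : 0 <= 2 * k + 1 by rewrite addr_ge0 // mulr_ge0.
have [n0 hn] := small_multiple c0 q0; set n := e / 2 / _ in n0 hn.
have [m0 hm] := small_multiple (mulr_ge0 C0 (mulr_ge0 l0 k0)) q0.
set m := e / 2 / _ in m0 hm.
have [d1 d10 hd1] := rectangle_modulus cdx n0.
have [d2 d20 hd2] := rectangle_modulus cdt n0.
have k1 : 0 < k + 1 by rewrite ltr_wpDl.
have d3 : 0 < d1 / (k + 1) by rewrite divr_gt0.
exists (Num.min (Num.min d1 d2) (Num.min (d1 / (k + 1)) m)).
  by rewrite !lt_min d10 d20 d3.
move=> u h t x uk ul h0; rewrite !lt_min => /andP[/andP[hd1' hd2'] /andP[hk hm']] hl t0 thT.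
set y := flow u h x.
have x01 := I01_itv x; have y01 := I01_itv y.
have hh : 0 <= h <= h by rewrite h0 lexx.
have tT : 0 <= t <= T by rewrite t0 (le_trans _ thT) // lerDl.
have thT' : 0 <= t + h <= T by rewrite thT addr_ge0.
have hkd : k * h < d1.
  move: hk; rewrite ltr_pdivlMr // mulrC => hk.
  by rewrite (le_lt_trans _ hk) // ler_wpM2r // lerDl.
have yx : `|\val y - \val x| <= k * h := flow_displacement l0 uk ul h0 hl x hh.
have tht : `|t + h - t| = h by rewrite addrAC subrr add0r ger0_norm.
have [c [c01 cx cy E1]] := test_MVT_x x01 y01 thT'.
have [r [rT rt _ E2]] := test_MVT_t x01 tT thT'.
rewrite tht in rt; rewrite addrAC subrr add0r in E2.
have T1 : `|psi (\val x) (t + h) - psi (\val x) t - h * dt (\val x) t| <= h * n.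
  rewrite E2 mulrC -mulrBr normrM ger0_norm // ler_wpM2l // hd2 //.
    by rewrite subrr normr0.
  exact: le_lt_trans rt hd2'.
have T2 : `|dx c (t + h) - dx (\val x) t| <= n.
  by rewrite hd1 //; [exact: le_lt_trans (le_trans cx yx) hkd|rewrite tht].
have T3 : `|psi (\val y) (t + h) - psi (\val x) (t + h) - h * (dx (\val x) t * u x)|
    <= h * (2 * k * n + C * (l * k * h)).
  rewrite E1.
  have := flow_first_order l0 uk ul h0 hl x hh; rewrite -/y => first_order.
  (* At a stopped point [dx] vanishes at both times: time t + h controls the mean value factor
     [dx c (t + h)], and time t controls the drift term [dx x t]. *)
  have [near_y|bdy] : `|\val y - \val x - h * u x| <= l * k * h * h \/
      (dx (\val y) t = 0 /\ dx (\val y) (t + h) = 0).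
    have [_ dx0] := psi_test.
    case: first_order => [?|y0|y1]; [by left| |].
    - by right; rewrite y0; have [-> _] := dx0 _ tT; have [-> _] := dx0 _ thT'.
    - by right; rewrite y1; have [_ ->] := dx0 _ tT; have [_ ->] := dx0 _ thT'.
  - have -> : dx c (t + h) * (\val y - \val x) - h * (dx (\val x) t * u x) =
      (dx c (t + h) - dx (\val x) t) * (\val y - \val x) +
      dx (\val x) t * (\val y - \val x - h * u x) by ring.
    rewrite (le_trans (ler_normD _ _)) // !normrM.
    have -> : h * (2 * k * n + C * (l * k * h)) =
      n * (k * h) + C * (l * k * h * h) + n * (k * h) by ring.
    have pos : 0 <= n * (k * h) by apply: mulr_ge0; [exact: ltW|exact: mulr_ge0].
    by rewrite -[leLHS]addr0 lerD // lerD // ler_pM // hC.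
  - have [b1 b2] := bdy.
    have B1 : `|dx c (t + h)| <= n.
      have -> : dx c (t + h) = dx c (t + h) - dx (\val y) (t + h) by rewrite b2 subr0.
      rewrite hd1 // ?subrr ?normr0 //.
      exact: le_lt_trans (le_trans cy yx) hkd.
    have B2 : `|dx (\val x) t| <= n.
      have -> : dx (\val x) t = dx (\val x) t - dx (\val y) t by rewrite b1 subr0.
      rewrite hd1 // ?subrr ?normr0 //.
      by rewrite distrC (le_lt_trans yx).
    rewrite (le_trans (ler_normB _ _)) // !normrM (ger0_norm h0).
    have -> : h * (2 * k * n + C * (l * k * h)) =
      n * (k * h) + h * (n * k) + C * (l * k * h * h) by ring.
    have pos : 0 <= C * (l * k * h * h) by rewrite !mulr_ge0.
    rewrite -[leLHS]addr0 lerD // lerD //; first by rewrite ler_pM.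
    by rewrite ler_wpM2l // ler_pM.
have -> : psi (\val y) (t + h) - psi (\val x) t - h * (dt (\val x) t + dx (\val x) t * u x) =
  (psi (\val y) (t + h) - psi (\val x) (t + h) - h * (dx (\val x) t * u x)) +
  (psi (\val x) (t + h) - psi (\val x) t - h * dt (\val x) t) by ring.
rewrite (le_trans (ler_normD _ _)) // (le_trans (lerD T3 T1)) // -mulrDr ler_wpM2l //.
have : C * (l * k * h) <= e / 2.
  rewrite (le_trans _ hm) // [leLHS]mulrA; apply: ler_wpM2l; last exact: ltW.
  by rewrite !mulr_ge0.
have -> : 2 * k * n + C * (l * k * h) + n = (2 * k + 1) * n + C * (l * k * h) by ring.
by move=> h2; rewrite [leRHS]splitr lerD.
Qed.

End rectangle_functions.

Lemma I01_continuous_modulus (R : realType) (phi : I01 R -> R) :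
  (forall e : R, 0 < e -> exists2 d : R, 0 < d &
     forall x y : I01 R, `|\val x - \val y| < d -> `|phi x - phi y| <= e) ->
  continuous phi.
Proof.
move=> h.
have -> : phi = (phi \o proj01) \o (fun x : I01 R => \val x : R).
  by apply/funext => x /=; rewrite proj01K.
move=> x; apply: continuous_comp; first exact: continuous_val_I01.
apply/cvgrPdist_le => e e0; have [d d0 hd] := h e e0.
apply/nbhs_ballP; exists d => //= y xy; apply: hd.
exact: le_lt_trans (proj01_lip _ _) xy.
Qed.

Lemma rectangle_slice_continuous (R : realType) (T : R) (a : R -> R -> R) (t : R) :
  {within `[0, 1]%classic `*` `[0, T]%classic, continuous (fun p : R * R => a p.1 p.2)} ->
  0 <= t <= T -> continuous (fun x : I01 R => a (\val x) t).
Proof.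
move=> ca tT; apply: I01_continuous_modulus => e e0.
have [d d0 hd] := rectangle_modulus ca e0.
by exists d => // x y xy; apply: hd; rewrite ?I01_itv // subrr normr0.
Qed.

(** * Uniform continuity of the drift functional *)

Section drift_functional.
Context {R : realType}.
Variables (T r kr lr mr : R) (v : M01 R -> I01 R -> R).
Hypothesis r0 : 0 <= r.
Hypothesis kr0 : 0 <= kr.
Hypothesis lr0 : 0 <= lr.
Hypothesis v_sup : forall mu, (TV_norm mu <= r%:E)%E -> forall x, `|v mu x| <= kr.
Hypothesis v_lip : forall mu, (TV_norm mu <= r%:E)%E -> lipschitz_I01 lr (v mu).
Hypothesis v_dist : forall mu nu (d : R), (TV_norm mu <= r%:E)%E ->
  (TV_norm nu <= r%:E)%E -> (BL_dist mu nu <= d%:E)%E ->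
  forall x, `|v mu x - v nu x| <= mr * d.
Hypothesis mr0 : 0 <= mr.

(** General coefficients cover both integrands of the weak equation: [dt] and [dx] for transport, f
    psi and 0 for the source. *)
Definition drift (a b : R -> R -> R) (mu : M01 R) (t : R) : R :=
  pairing mu (fun x => a (\val x) t + b (\val x) t * v mu x).

Variables a b : R -> R -> R.
Let K : set (R * R) := `[0, 1]%classic `*` `[0, T]%classic.
Hypothesis ca : {within K, continuous (fun p => a p.1 p.2)}.
Hypothesis cb : {within K, continuous (fun p => b p.1 p.2)}.

Lemma drift_integrand_continuous mu t : (TV_norm mu <= r%:E)%E -> 0 <= t <= T ->
  continuous (fun x : I01 R => a (\val x) t + b (\val x) t * v mu x).
Proof.
move=> mur tT.
apply: I01_continuousD; first exact: rectangle_slice_continuous tT.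
apply: I01_continuousM; first exact: rectangle_slice_continuous tT.
exact: lipschitz_I01_continuous (v_lip mur).
Qed.

(** The charge is changed under a fixed integrand by [equicontinuous_pairing]; the integrand is
    changed under a fixed charge by its sup norm, where the dependence of v on the charge enters. *)
Lemma drift_continuous (e : R) : 0 < e -> exists2 d : R, 0 < d &
  forall mu nu t s, (TV_norm mu <= r%:E)%E -> (TV_norm nu <= r%:E)%E ->
    0 <= t <= T -> 0 <= s <= T -> `|t - s| < d -> (BL_dist mu nu <= d%:E)%E ->
    `|drift a b mu t - drift a b nu s| <= e.
Proof.
move=> e0.
have [Ca Ca0 hCa] := rectangle_bounded ca; have [Cb Cb0 hCb] := rectangle_bounded cb.
pose C := Ca + Cb * kr.
have C0 : 0 <= C by rewrite addr_ge0 // mulr_ge0.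
have e4 : 0 < e / 4 by rewrite divr_gt0.
(* The tolerance z, with 2 r z <= e/4, bounds both the oscillation of the integrand over a distance
   d1 and its change from (mu, t) to (nu, s). Each is made of a part n (1 + kr) <= z/2 from a and b,
   and a part at most z/2 from v, controlled by p or q. As 1/d1 multiplies the BL distance, w is
   chosen after d1. *)
have [z0 hz] := small_multiple (mulr_ge0 (ler0n R 2) r0) e4; set z := e / 4 / _ in z0 hz.
have z20 : 0 < z / 2 by rewrite divr_gt0.
have [n0 hn] := small_multiple (addr_ge0 ler01 kr0) z20; set n := z / 2 / _ in n0 hn.
have [da da0 hda] := rectangle_modulus ca n0.
have [db db0 hdb] := rectangle_modulus cb n0.
have [p0 hp] := small_multiple (mulr_ge0 Cb0 lr0) z20; set p := z / 2 / _ in p0 hp.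
pose d1 := Num.min (Num.min da db) p.
have d10 : 0 < d1 by rewrite !lt_min da0 db0.
have [q0 hq] := small_multiple (mulr_ge0 Cb0 mr0) z20; set q := z / 2 / _ in q0 hq.
have N0 : 0 <= C + 2 * C / d1 by rewrite addr_ge0 // divr_ge0 ?mulr_ge0 // ltW.
have [w0 hw] := small_multiple N0 e4; set w := e / 4 / _ in w0 hw.
exists (Num.min (Num.min da db) (Num.min q w)).
  by rewrite !lt_min da0 db0 q0.
set d := Num.min _ _ => mu nu t s mur nur tT sT ts hd.
have d0 : 0 <= d by rewrite -lee_fin (le_trans _ hd) // BL_dist_ge0.
have dq : d <= q by rewrite !ge_min lexx orbT.
have dw : d <= w by rewrite !ge_min lexx !orbT.
have tsa : `|t - s| < da by move: ts; rewrite !lt_min => /andP[/andP[]].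
have tsb : `|t - s| < db by move: ts; rewrite !lt_min => /andP[/andP[]].
pose phi (x : I01 R) := a (\val x) t + b (\val x) t * v mu x.
pose chi (x : I01 R) := a (\val x) s + b (\val x) s * v nu x.
have cphi : continuous phi by exact: drift_integrand_continuous.
have cchi : continuous chi by exact: drift_integrand_continuous.
have phiC x : `|phi x| <= C.
  rewrite (le_trans (ler_normD _ _)) // lerD ?hCa ?I01_itv // normrM ler_pM //.
    by rewrite hCb // I01_itv.
  exact: v_sup.
have chiC x : `|chi x| <= C.
  rewrite (le_trans (ler_normD _ _)) // lerD ?hCa ?I01_itv // normrM ler_pM //.
    by rewrite hCb // I01_itv.
  exact: v_sup.
have phi_mod (x y : I01 R) : `|\val x - \val y| < d1 -> `|phi x - phi y| <= z.
  rewrite !lt_min => /andP[/andP[xya xyb] xyp].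
  have -> : phi x - phi y = (a (\val x) t - a (\val y) t) +
    (b (\val x) t - b (\val y) t) * v mu x + b (\val y) t * (v mu x - v mu y).
    by rewrite /phi; ring.
  have h1 : `|a (\val x) t - a (\val y) t| <= n.
    by apply: hda; rewrite ?I01_itv // subrr normr0.
  have h2 : `|(b (\val x) t - b (\val y) t) * v mu x| <= n * kr.
    rewrite normrM ler_pM // ?v_sup //.
    by apply: hdb; rewrite ?I01_itv // subrr normr0.
  have h3 : `|b (\val y) t * (v mu x - v mu y)| <= Cb * lr * p.
    rewrite normrM -mulrA ler_pM ?hCb ?I01_itv //.
    by rewrite (le_trans (v_lip mur _ _)) // ler_wpM2l // ltW.
  rewrite (le_trans (ler_normD _ _)) // (le_trans (lerD (ler_normD _ _) (lexx _))) //.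
  rewrite (le_trans (lerD (lerD h1 h2) h3)) // [leRHS]splitr lerD //.
  by rewrite (mulrC n) -[X in X + _]mul1r -mulrDl.
have diff x : `|phi x - chi x| <= z.
  have -> : phi x - chi x = (a (\val x) t - a (\val x) s) +
    (b (\val x) t - b (\val x) s) * v mu x + b (\val x) s * (v mu x - v nu x).
    by rewrite /phi /chi; ring.
  have h1 : `|a (\val x) t - a (\val x) s| <= n.
    by apply: hda; rewrite ?I01_itv // subrr normr0.
  have h2 : `|(b (\val x) t - b (\val x) s) * v mu x| <= n * kr.
    rewrite normrM ler_pM // ?v_sup //.
    by apply: hdb; rewrite ?I01_itv // subrr normr0.
  have h3 : `|b (\val x) s * (v mu x - v nu x)| <= Cb * mr * q.
    rewrite normrM -mulrA ler_pM ?hCb ?I01_itv //.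
    by rewrite (le_trans (v_dist mur nur hd _)) // ler_wpM2l.
  rewrite (le_trans (ler_normD _ _)) // (le_trans (lerD (ler_normD _ _) (lexx _))) //.
  rewrite (le_trans (lerD (lerD h1 h2) h3)) // [leRHS]splitr lerD //.
  by rewrite (mulrC n) -[X in X + _]mul1r -mulrDl.
have s1 := equicontinuous_pairing mur nur d10 phiC phi_mod cphi hd.
have s2 := TV_norm_pairing nur (I01_continuousB cphi cchi) diff.
rewrite pairingB in s2; [|exact: continuous_bounded_measurable phiC|exact: continuous_bounded_measurable chiC].
have -> : drift a b mu t - drift a b nu s = (pairing mu phi - pairing nu phi)
  + (pairing nu phi - pairing nu chi) by rewrite /drift -/phi -/chi; ring.
rewrite (le_trans (ler_normD _ _)) // (le_trans (lerD s1 s2)) //.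
have h1 : (C + 2 * C / d1) * d <= e / 4 by rewrite (le_trans _ hw) // ler_wpM2l.
have rz : 0 <= r * z by rewrite mulr_ge0 // ltW.
have -> : e = e / 4 + e / 4 + (e / 4 + e / 4) by field.
rewrite -addrA lerD //; first by rewrite (le_trans hz) // lerDl ltW.
by rewrite lerD // (le_trans _ hz) // -mulrA ler_peMl // ler1n.
Qed.

End drift_functional.

(** * One Euler step *)

Section fundamental_theorem.
Context {R : realType}.

Lemma has_derivative_FTC2 (a b : R) (g G : R -> R) : a < b ->
  {within `[a, b]%classic, continuous g} ->
  (forall t, a <= t <= b -> forall J, has_derivative J G t (g t)) ->
  \int[lebesgue_measure]_(t in `[a, b]%classic) g t = G b - G a.
Proof.
move=> ab cg hG.
have dG t : a <= t <= b -> is_derive (t : R) 1 G (g t).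
  move=> tab; apply: (@has_derivative_is_derive R (t - 1) (t + 1)); last exact: hG.
  by rewrite ltrBlDr ltrDl ltr01.
have cG t : a <= t <= b -> {for t, continuous G}.
  move=> /dG[dGt _]; apply: differentiable_continuous; exact/derivable1_diffP.
rewrite /Rintegral (continuous_FTC2 ab cg (F := G)).
- by rewrite -EFinB.
- split.
  + move=> t; rewrite in_itv /= => /andP[at_ tb].
    by have [] := dG t _ => //; rewrite !ltW.
  + by apply: cvg_at_right_filter; apply: cG; rewrite lexx ltW.
  + by apply: cvg_at_left_filter; apply: cG; rewrite lexx ltW.
- move=> t; rewrite in_itv /= => /andP[at_ tb]; rewrite derive1E.
  have tab : a <= t <= b by rewrite !ltW.
  by have [_ ->] := dG t tab.
Qed.

Lemma within_primitive_exists (T : R) (g : R -> R) : 0 <= T ->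
  {within `[0, T]%classic, continuous g} ->
  exists G : R -> R, forall t, 0 <= t <= T -> forall J, has_derivative J G t (g t).
Proof.
move=> T0 cg.
(* Composition with the clamp extends g continuously to R, which makes its primitive differentiable
   from both sides at 0 and T. *)
pose clamp (t : R) := Num.max 0 (Num.min T t).
have clampT t : 0 <= clamp t <= T by rewrite le_max lexx /= ge_max T0 ge_min lexx.
have clamp_id t : 0 <= t <= T -> clamp t = t.
  by move=> /andP[t0 tT]; rewrite /clamp min_r // max_r.
have [|G hG] := @primitive_exists R (g \o clamp) 0 T T0.
  move=> t; apply/cvgrPdist_le => e e0.
  have [d d0 hd] := compact_uniform_continuous (segment_compact (a := 0) (b := T)) cg e0.
  apply/nbhs_ballP; exists d => //= s ts; rewrite ltW //.
  by apply: hd; rewrite /= ?in_itv /= ?clampT //; exact: le_lt_trans (clamp_lipschitz _ _ _ _) ts.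
by exists G => t tT J; have := hG t tT J; rewrite /= clamp_id.
Qed.

End fundamental_theorem.

Section euler_step.
Context {R : realType}.
Implicit Types (nu rho : M01 R) (u : I01 R -> R).

Lemma TV_norm_charge_eq (mu nu : M01 R) (r : R) : charge_eq mu nu ->
  (TV_norm mu <= r%:E)%E -> (TV_norm nu <= r%:E)%E.
Proof.
move=> munu mur; apply: TV_norm_BL => phi blphi phi1.
rewrite -(pairing_charge_eq munu (BL_bounded_measurable blphi)) -[r]mulr1.
rewrite (le_trans (ler_norm _)) //; apply: TV_norm_pairing => //.
exact: BL_continuous_fun.
Qed.

Lemma lipschitz_I01M (phi chi : I01 R -> R) (C D L M : R) :
  (forall x, `|phi x| <= C) -> (forall x, `|chi x| <= D) ->
  lipschitz_I01 L phi -> lipschitz_I01 M chi ->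
  lipschitz_I01 (L * D + C * M) (fun x => phi x * chi x).
Proof.
move=> hC hD hL hM x y.
have -> : phi x * chi x - phi y * chi y =
  (phi x - phi y) * chi x + phi y * (chi x - chi y) by ring.
rewrite (le_trans (ler_normD _ _)) // !normrM mulrDl lerD //.
  by rewrite mulrAC ler_pM.
by rewrite -mulrA ler_pM.
Qed.

Variables (T F Lf k l r : R) (f : I01 R -> R).
Hypothesis F0 : 0 <= F.
Hypothesis Lf0 : 0 <= Lf.
Hypothesis fF : forall x, `|f x| <= F.
Hypothesis fL : lipschitz_I01 Lf f.
Hypothesis k0 : 0 <= k.
Hypothesis l0 : 0 <= l.
Hypothesis r0 : 0 <= r.

Let cf : continuous f. Proof. exact: lipschitz_I01_continuous fL. Qed.

(** The two conditions are those of the Picard contraction and of the total variation bootstrap. *)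
Let small_step : exists2 d : R, 0 < d & forall h, 0 <= h -> h < d ->
  h * l <= 2^-1 /\ h * F <= 2^-1.
Proof.
have half : 0 < 2^-1 :> R by rewrite invr_gt0.
have [d1 hd1] := small_multiple l0 half; have [d2 hd2] := small_multiple F0 half.
exists (Num.min (2^-1 / (l + 1)) (2^-1 / (F + 1))) => [|h h0]; first by rewrite lt_min d1.
rewrite lt_min => /andP[h1 h2]; split.
  by rewrite (le_trans _ hd1) // mulrC ler_wpM2l // ltW.
by rewrite (le_trans _ hd2) // mulrC ler_wpM2l // ltW.
Qed.

(** The threshold d is fixed before A, so one d serves every step of a partition although the bound
    on the total variation grows along it. *)
Lemma Q_TV : exists2 d : R, 0 < d & forall u nu rho h A, (forall x, `|u x| <= k) ->
  lipschitz_I01 l u -> (TV_norm nu <= A%:E)%E -> 0 <= h -> h < d ->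
  Q f u h nu rho -> (TV_norm rho <= ((1 + 2 * F * h) * A)%:E)%E.
Proof.
have [d d0 hd] := small_step; exists d => // u nu rho h A uk ul nuA h0 h_d.
move=> [S [m [/andP[_ hS] mild mrho]]]; have [hl hF] := hd h h0 h_d.
apply: (TV_norm_charge_eq mrho).
exact: (mild_TV_le fF cf l0 uk ul h0 hl hF hS nuA mild).
Qed.

Variables psi dx dt : R -> R -> R.
Hypothesis psi_test : test_function T psi dx dt.

Lemma Q_weak (e : R) : 0 < e -> exists2 d : R, 0 < d & forall u nu rho t h,
  (forall x, `|u x| <= k) -> lipschitz_I01 l u -> (TV_norm nu <= r%:E)%E ->
  0 <= h -> h < d -> 0 <= t -> t + h <= T -> Q f u h nu rho ->
  `|pairing rho (fun x => psi (\val x) (t + h)) - pairing nu (fun x => psi (\val x) t)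
    - h * (pairing nu (fun x => dt (\val x) t + dx (\val x) t * u x)
           + pairing nu (fun x => f x * psi (\val x) t))| <= h * e.
Proof.
move=> e0; have [[cpsi cdx cdt _] _] := psi_test.
have e20 : 0 < e / 2 by rewrite divr_gt0.
have [C C0 hC] := rectangle_bounded cpsi.
have [Cx Cx0 hCx] := rectangle_bounded cdx.
have [Ct Ct0 hCt] := rectangle_bounded cdt.
have [D D0 hD] := test_lipschitz psi_test.
have [n0 hn] := small_multiple r0 e20; set n := e / 2 / _ in n0 hn.
have [d1 d10 expansion] := test_flow_expansion psi_test k0 l0 n0.
have [d2 d20 hd2] := small_step.
(* L is a Lipschitz constant of f psi(., t). With e1 = D (k h + h), the error of [mild_step] becomes
   r n + Z h per unit of time, each term at most e/2. *)
pose L := Lf * C + F * D.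
pose Z := 2 * r * (F * (D * (k + 1))) + r * (L * k) + 2 * r * (F * (F * C)).
have L0 : 0 <= L by rewrite addr_ge0 // mulr_ge0.
have Z0 : 0 <= Z by rewrite !addr_ge0 // !mulr_ge0 // addr_ge0.
have [z0 hz] := small_multiple Z0 e20; set z := e / 2 / _ in z0 hz.
exists (Num.min (Num.min d1 d2) z) => [|u nu rho t h uk ul nur h0].
  by rewrite !lt_min d10 d20.
rewrite !lt_min => /andP[/andP[h1 h2] h3] t0 thT [S [m [/andP[_ hS] mild mrho]]].
have [hl hF] := hd2 h h0 h2.
have tT : 0 <= t <= T by rewrite t0 (le_trans _ thT) // lerDl.
have thT' : 0 <= t + h <= T by rewrite thT addr_ge0.
have bl s : 0 <= s <= T -> BL (fun x : I01 R => psi (\val x) s).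
  move=> sT; apply/BLP; exists C, D; split => // x; first by rewrite hC ?I01_itv.
  move=> y; rewrite (le_trans (hD (\val y) (\val x) s s _ _ _ _)) ?I01_itv //.
  by rewrite subrr normr0 addr0.
rewrite -(pairing_charge_eq mrho (BL_bounded_measurable (bl _ thT'))).
pose g (x : I01 R) := dt (\val x) t + dx (\val x) t * u x.
have cg : continuous g.
  apply: I01_continuousD; first exact: rectangle_slice_continuous tT.
  apply: I01_continuousM; first exact: rectangle_slice_continuous tT.
  exact: lipschitz_I01_continuous ul.
have gC x : `|g x| <= Ct + Cx * k.
  by rewrite (le_trans (ler_normD _ _)) // lerD ?hCt ?I01_itv // normrM ler_pM // hCx ?I01_itv.
have psi_lip : lipschitz_I01 D (fun x : I01 R => psi (\val x) t).
  move=> x y; rewrite (le_trans (hD (\val y) (\val x) t t _ _ _ _)) ?I01_itv //.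
  by rewrite subrr normr0 addr0.
have psiC s (x : I01 R) : 0 <= s <= T -> `|psi (\val x) s| <= C.
  by move=> sT; rewrite hC ?I01_itv.
have disp s x : 0 <= s <= h ->
    `|psi (\val (flow u s x)) (t + h) - psi (\val x) t| <= D * (k * h + h).
  move=> sh; rewrite (le_trans (hD _ _ _ _ _ _ tT thT')) ?I01_itv // ler_wpM2l //.
  rewrite lerD //; last by rewrite addrAC subrr add0r ger0_norm.
  rewrite (le_trans (flow_displacement l0 uk ul h0 hl x sh)) // ler_wpM2l //.
  by case/andP: sh.
have := mild_step fF cf l0 uk ul h0 hl hF hS nur mild (bl _ thT') 
  (BL_continuous_fun (bl _ tT)) cg (fun x => psiC _ x thT') (fun x => psiC _ x tT) gC
  L0 (lipschitz_I01M fF (fun x => psiC t x tT) fL psi_lip) disp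
  (fun x => expansion u h t x uk ul h0 h1 hl t0 thT).
move=> /le_trans; apply; rewrite ler_wpM2l //.
have -> : r * n + (2 * r * (F * (D * (k * h + h))) + (r * (L * (k * h)) + 2 * r * (F * (F * C)) * h))
  = r * n + Z * h by rewrite /Z; ring.
rewrite [leRHS]splitr lerD // (le_trans _ hz) // ler_wpM2l // ltW //.
Qed.

End euler_step.

(** * Limit of the Euler approximations *)

Lemma has_derivative_FTC2_add (R : realType) (T : R) (g1 g2 G : R -> R) : 0 < T ->
  {within `[0, T]%classic, continuous g1} -> {within `[0, T]%classic, continuous g2} ->
  (forall t, 0 <= t <= T -> forall J, has_derivative J G t (g1 t + g2 t)) ->
  \int[lebesgue_measure]_(t in `[0, T]%classic) g1 t
  + \int[lebesgue_measure]_(t in `[0, T]%classic) g2 t = G T - G 0.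
Proof.
move=> T0 cg1 cg2 hG.
have cg : {within `[0, T]%classic, continuous (fun t => g1 t + g2 t)}.
  by move=> t; apply: cvgD; [exact: cg1|exact: cg2].
rewrite -(has_derivative_FTC2 T0 cg hG) RintegralD //.
- by apply: continuous_compact_integrable => //; exact: segment_compact.
- by apply: continuous_compact_integrable => //; exact: segment_compact.
Qed.

Lemma primitive_increment (R : realType) (T : R) (g G : R -> R) (e : R) :
  {within `[0, T]%classic, continuous g} ->
  (forall t, 0 <= t <= T -> forall J, has_derivative J G t (g t)) -> 0 < e ->
  exists2 d : R, 0 < d & forall p q, 0 <= p -> p <= q -> q <= T -> q - p < d ->
    `|G q - G p - (q - p) * g p| <= (q - p) * e.
Proof.
move=> cg hG e0.
have [d d0 unif] := compact_uniform_continuous (segment_compact (a := 0) (b := T)) cg e0.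
exists d => // p q p0 pq qT qpd.
have [|c /andP[pc cq] ->] := @has_derivative_MVT R p q G g pq.
  by move=> t /andP[t1 t2]; apply: hG; rewrite (le_trans p0) // (le_trans t2).
rewrite mulrC -mulrBr normrM ger0_norm ?subr_ge0 // ler_wpM2l ?subr_ge0 // ltW //.
apply: unif.
- by rewrite /= in_itv /= (le_trans p0 pc) (le_trans cq qT).
- by rewrite /= in_itv /= p0 (le_trans pq qT).
- by rewrite /ball /= ger0_norm ?subr_ge0 // (le_lt_trans _ qpd) // lerD2r.
Qed.

(** The four errors are one from the weak equation on the step, two from moving the drift and the
    source to the limit, and one from the primitive. *)
Lemma abs_increment_le (R : realType) (P1 P0 G1 G0 h S1 S2 x1 x2 e : R) : 0 <= h ->
  `|P1 - P0 - h * (S1 + S2)| <= h * e -> `|S1 - x1| <= e -> `|S2 - x2| <= e ->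
  `|G1 - G0 - h * (x1 + x2)| <= h * e ->
  `|(P1 - G1) - (P0 - G0)| <= h * (4 * e).
Proof.
move=> h0 hP h1 h2 hG.
have -> : (P1 - G1) - (P0 - G0) = (P1 - P0 - h * (S1 + S2)) +
  h * ((S1 - x1) + (S2 - x2)) - (G1 - G0 - h * (x1 + x2)) by ring.
have -> : h * (4 * e) = h * e + h * (e + e) + h * e by ring.
rewrite (le_trans (ler_normB _ _)) // lerD // (le_trans (ler_normD _ _)) // lerD //.
rewrite normrM ger0_norm // ler_wpM2l // (le_trans (ler_normD _ _)) //.
exact: lerD.
Qed.

Lemma telescope_le (R : realType) (E p : nat -> R) (c : R) (N : nat) :
  (forall j, (j < N)%N -> `|E j.+1 - E j| <= (p j.+1 - p j) * c) ->
  `|E N - E 0%N| <= (p N - p 0%N) * c.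
Proof.
elim: N => [_|N IH h]; first by rewrite !subrr normr0 mul0r.
have -> : E N.+1 - E 0%N = (E N.+1 - E N) + (E N - E 0%N) by ring.
have -> : (p N.+1 - p 0%N) * c = (p N.+1 - p N) * c + (p N - p 0%N) * c by ring.
rewrite (le_trans (ler_normD _ _)) // lerD ?h // IH // => j jN.
by apply: h; exact: ltnW.
Qed.

Lemma abs_endpoints_le (R : realType) (X Y Z G1 G0 t e e' : R) :
  `|(Z - G1) - (Y - G0)| <= t * (4 * e) -> `|Z - X| <= e -> (4 * t + 1) * e <= e' ->
  `|X - Y - (G1 - G0)| <= e'.
Proof.
move=> h1 h2; apply: le_trans.
have -> : X - Y - (G1 - G0) = (Z - G1 - (Y - G0)) - (Z - X) by ring.
have -> : (4 * t + 1) * e = t * (4 * e) + e by ring.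
by rewrite (le_trans (ler_normB _ _)) // lerD.
Qed.

Lemma common_positive_bound (R : realType) (d1 d2 d3 d4 d5 : R) :
  0 < d1 -> 0 < d2 -> 0 < d3 -> 0 < d4 -> 0 < d5 -> exists d,
    [/\ 0 < d, d <= d1 /\ d <= d2 & [/\ d <= d3, d <= d4 & d <= d5]].
Proof.
move=> d10 d20 d30 d40 d50.
exists (Num.min (Num.min d1 d2) (Num.min d3 (Num.min d4 d5))).
by rewrite !lt_min d10 d20 d30 d40 d50 !ge_min !lexx !orbT.
Qed.

Section limit_of_euler_approximations.
Context {R : realType}.
Variables (T F Lf A r k l mr : R) (f : I01 R -> R) (v : M01 R -> I01 R -> R).
Hypothesis T0 : 0 < T.
Hypothesis F0 : 0 <= F.
Hypothesis Lf0 : 0 <= Lf.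
Hypothesis fF : forall x, `|f x| <= F.
Hypothesis fL : lipschitz_I01 Lf f.
Hypothesis k0 : 0 <= k.
Hypothesis l0 : 0 <= l.
Hypothesis mr0 : 0 <= mr.
Hypothesis A0 : 0 <= A.
Hypothesis rE : r = A * expR (2 * F * T).
Hypothesis v_sup : forall mu, (TV_norm mu <= r%:E)%E -> forall x, `|v mu x| <= k.
Hypothesis v_lip : forall mu, (TV_norm mu <= r%:E)%E -> lipschitz_I01 l (v mu).
Hypothesis v_dist : forall mu nu (d : R), (TV_norm mu <= r%:E)%E ->
  (TV_norm nu <= r%:E)%E -> (BL_dist mu nu <= d%:E)%E ->
  forall x, `|v mu x - v nu x| <= mr * d.

Let r0 : 0 <= r. Proof. by rewrite rE mulr_ge0 // expR_ge0. Qed.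

Let TV_r t : t <= T -> A * expR (2 * F * t) <= r.
Proof. by move=> tT; rewrite rE ler_wpM2l // ler_expR ler_wpM2l // mulr_ge0. Qed.

Section partition.
Variables (s : seq R) (nu0 : M01 R) (m : R -> M01 R).
Hypothesis ptn : itv_partition 0 T s.
Let p j := part_pt T s j.

Lemma part_pt_itv j : (j <= size s)%N -> 0 <= p j <= T.
Proof.
move=> js; rewrite /p /part_pt.
by rewrite (itv_partition_nth_ge _ ptn) ?ltnS // (itv_partition_nth_le _ ptn).
Qed.

Lemma part_pt_lt j : (j < size s)%N -> p j < p j.+1.
Proof. by move=> js; have [/(pathP T) + _] := ptn; apply. Qed.

Lemma part_pt_mesh j : (j < size s)%N -> p j.+1 - p j <= mesh T s.
Proof.
by move=> js; have := le_bigmax 0 (fun i : 'I_(size s) => p i.+1 - p i) (Ordinal js).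
Qed.

Lemma part_pt_last : p (size s) = T.
Proof. exact: itv_partition_nth_size. Qed.

Lemma euler_TV (d : R) : mesh T s < d ->
  (forall u nu rho h B, (forall x, `|u x| <= k) -> lipschitz_I01 l u ->
     (TV_norm nu <= B%:E)%E -> 0 <= h -> h < d -> Q f u h nu rho ->
     (TV_norm rho <= ((1 + 2 * F * h) * B)%:E)%E) ->
  (TV_norm nu0 <= A%:E)%E -> euler f v T s nu0 m ->
  forall t, 0 <= t <= T -> (TV_norm (m t) <= r%:E)%E.
Proof.
move=> meshd step nu0A [_ _ m0 mQ].
suff H j : (j <= size s)%N -> forall t, 0 <= t <= p j ->
    (TV_norm (m t) <= (A * expR (2 * F * t))%:E)%E.
  move=> t /andP[t0 tT]; rewrite (le_trans (H (size s) _ t _)) //.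
    by rewrite part_pt_last t0.
  by rewrite lee_fin TV_r.
elim: j => [_ t|j IH js t /andP[t0 tp]].
  rewrite /p /part_pt /= => /le_anti <-; rewrite mulr0 expR0 mulr1.
  by apply: TV_norm_charge_eq nu0A => B mB; rewrite m0.
have [tpj|pjt] := leP t (p j); first by apply: IH; [exact: ltnW|rewrite t0].
have /andP[pj0 pjT] := part_pt_itv (ltnW js).
have pjA : (TV_norm (m (p j)) <= (A * expR (2 * F * p j))%:E)%E.
  by apply: IH; [exact: ltnW|rewrite pj0 lexx].
have pjr : (TV_norm (m (p j)) <= r%:E)%E.
  by rewrite (le_trans pjA) // lee_fin TV_r.
have hd : t - p j < d.
  rewrite (le_lt_trans _ meshd) // (le_trans _ (part_pt_mesh js)) // lerD2r //.
have := mQ j js t; rewrite -/(p j) -/(p j.+1) pjt tp => /(_ isT) q.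
have := step _ _ _ _ _ (v_sup pjr) (v_lip pjr) pjA _ hd q.
rewrite subr_ge0 => /(_ (ltW pjt)) /le_trans; apply; rewrite lee_fin.
rewrite mulrCA ler_wpM2l //.
have -> : 2 * F * t = 2 * F * (t - p j) + 2 * F * p j by ring.
by rewrite expRD ler_wpM2r ?expR_ge0 // expR_ge1Dx.
Qed.

End partition.

Variables (nu0 : M01 R) (mu : R -> M01 R).
Variables (alpha : nat -> seq R) (muk : nat -> R -> M01 R).
Hypothesis nu0A : (TV_norm nu0 <= A%:E)%E.
Hypothesis mu_cont : BL_continuous T mu.
Hypothesis muk_euler : forall n, euler f v T (alpha n) nu0 (muk n).
Hypothesis muk_close : forall d : R, 0 < d -> exists n, mesh T (alpha n) < d /\
  forall t, 0 <= t <= T -> (BL_dist (muk n t) (mu t) <= d%:E)%E.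

Let muk_good (d : R) : 0 < d -> exists n, [/\ mesh T (alpha n) < d,
  forall t, 0 <= t <= T -> (BL_dist (muk n t) (mu t) <= d%:E)%E &
  forall t, 0 <= t <= T -> (TV_norm (muk n t) <= r%:E)%E].
Proof.
move=> d0; have [d1 d10 step] := Q_TV k F0 fF fL l0.
have [n [h1 h2]] := muk_close (d := Num.min d d1) (ltac:(by rewrite lt_min d0)).
move: h1; rewrite lt_min => /andP[nd nd1].
exists n; split => // [t tT|].
  by rewrite (le_trans (h2 t tT)) // lee_fin ge_min lexx.
have [ptn _ _ _] := muk_euler n.
exact: (euler_TV ptn nd1 step nu0A (muk_euler n)).
Qed.

(** Lower semicontinuity: against a fixed BL function the approximations converge, and BL functions
    suffice to test total variation. *)
Lemma limit_TV t : 0 <= t <= T -> (TV_norm (mu t) <= r%:E)%E.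
Proof.
move=> tT; apply: TV_norm_BL => phi blphi phi1.
have [C [L [C0 L0 phiC phiL]]] := (BLP phi).1 blphi.
apply/ler_addgt0Pr => e e0.
have [z0 hz] := small_multiple (addr_ge0 C0 L0) e0; set z := e / _ in z0 hz.
have [n [_ h1 h2]] := muk_good z0.
have := TV_norm_pairing (h2 t tT) (BL_continuous_fun blphi) phi1.
have := BL_distP (h1 t tT) phiC L0 phiL.
rewrite mulr1 !ler_norml => /andP[? ?] /andP[? ?]; lra.
Qed.

Lemma drift_within_continuous (a b : R -> R -> R) :
  {within `[0, 1]%classic `*` `[0, T]%classic, continuous (fun p : R * R => a p.1 p.2)} ->
  {within `[0, 1]%classic `*` `[0, T]%classic, continuous (fun p : R * R => b p.1 p.2)} ->
  {within `[0, T]%classic, continuous (fun t => drift v a b (mu t) t)}.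
Proof.
move=> ca cb; apply/subspace_continuousP => t tT; apply/cvgrPdist_le => e e0.
have tT' : 0 <= t <= T by move: tT; rewrite /= in_itv.
have [d d0 hd] := drift_continuous r0 k0 l0 v_sup v_lip v_dist mr0 ca cb e0.
have FW : Filter (within `[0, T]%classic (nbhs t)) by exact: within_filter.
have near_dist := ereal_cvg0_lt (FF := FW) (mu_cont tT) d0.
have near_t : \forall x \near within `[0, T]%classic (nbhs t), `|x - t| < d.
  rewrite near_withinE; apply/nbhs_ballP; exists d => //= y ty _.
  by rewrite distrC.
have near_T : \forall x \near within `[0, T]%classic (nbhs t), 0 <= x <= T.
  by rewrite near_withinE; apply: filterE => y; rewrite /= in_itv.
near=> x; rewrite distrC; apply: hd => //.
- by apply: limit_TV; near: x.
- exact: limit_TV.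
- by near: x.
- by near: x.
- by apply: ltW; near: x.
Unshelve. all: by end_near.
Qed.

Variables psi dx dt : R -> R -> R.
Hypothesis psi_test : test_function T psi dx dt.

(** The retraction extends f to the line, since the coefficients of [drift] are functions on the
    plane. *)
Let a (x t : R) := f (proj01 x) * psi x t.

Let ca : {within `[0, 1]%classic `*` `[0, T]%classic, continuous (fun p : R * R => a p.1 p.2)}.
Proof.
have [[cpsi _ _ _] _] := psi_test.
have cf : continuous (f \o proj01).
  apply: (@lipschitz_R_continuous R Lf) => y z /=.
  by rewrite (le_trans (fL _ _)) // ler_wpM2l // proj01_lip.
apply/subspace_continuousP => p Kp.
have /subspace_continuousP /(_ p Kp) c1 := cpsi.
apply: cvgM c1.
have c2 : (f \o proj01) q.1 @[q --> nbhs p] --> (f \o proj01) p.1.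
  apply: (@continuous_comp _ _ _ fst (f \o proj01) p); first exact: cvg_fst.
  exact: cf.
by apply: cvg_trans c2; apply: cvg_app; exact: cvg_within.
Qed.

Let c0 : {within `[0, 1]%classic `*` `[0, T]%classic, continuous (fun p : R * R => (0 : R))}.
Proof. by apply: continuous_subspaceT; exact: cst_continuous. Qed.

Let source rho t : drift v a (fun _ _ => 0) rho t = pairing rho (fun x => f x * psi (\val x) t).
Proof.
by congr pairing; apply/funext => x; rewrite mul0r addr0 /a proj01K.
Qed.

(** With G a primitive of the limiting integrand, the difference E j between the tested
    approximation and G at the j-th partition point changes by at most 4 e times the step length,
    hence by at most 4 e T in total. *)
Lemma limit_weak :
  pairing (mu T) (fun x => psi (\val x) T) - pairing nu0 (fun x => psi (\val x) 0)
  = \int[lebesgue_measure]_(t in `[0, T]%classic)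
      pairing (mu t) (fun x => dt (\val x) t + dx (\val x) t * v (mu t) x)
    + \int[lebesgue_measure]_(t in `[0, T]%classic)
        pairing (density f (mu t)) (fun x => psi (\val x) t).
Proof.
have [[cpsi cdx cdt _] _] := psi_test.
have T0' : 0 <= T by exact: ltW.
have T4 : 0 <= 4 * T + 1 by apply: addr_ge0; [exact: mulr_ge0 (ler0n _ _) T0'|exact: ler01].
have [C C0 hC] := rectangle_bounded cpsi.
have [D D0 hD] := test_lipschitz psi_test.
have psi_bl t : 0 <= t <= T -> [/\ forall x : I01 R, `|psi (\val x) t| <= C,
    lipschitz_I01 D (fun x : I01 R => psi (\val x) t) & BL (fun x : I01 R => psi (\val x) t)].
  move=> tT.
  have h1 (x : I01 R) : `|psi (\val x) t| <= C by rewrite hC ?I01_itv.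
  have h2 : lipschitz_I01 D (fun x : I01 R => psi (\val x) t).
    move=> x y; rewrite (le_trans (hD (\val y) (\val x) t t _ _ _ _)) ?I01_itv //.
    by rewrite subrr normr0 addr0.
  by split => //; apply/BLP; exists C, D.
pose g1 t := drift v dt dx (mu t) t.
pose g2 t := drift v a (fun _ _ => 0) (mu t) t.
have cg1 : {within `[0, T]%classic, continuous g1} by exact: drift_within_continuous.
have cg2 : {within `[0, T]%classic, continuous g2} by exact: (drift_within_continuous ca c0).
have cg : {within `[0, T]%classic, continuous (fun t => g1 t + g2 t)}.
  by move=> t; apply: cvgD; [exact: cg1|exact: cg2].
have [G hG] := within_primitive_exists T0' cg.
have source_int : \int[lebesgue_measure]_(t in `[0, T]%classic)
    pairing (density f (mu t)) (fun x => psi (\val x) t)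
    = \int[lebesgue_measure]_(t in `[0, T]%classic) g2 t.
  apply: eq_Rintegral => t; rewrite inE /= in_itv /= => tT.
  have [h1 h2 h3] := psi_bl t tT.
  rewrite /g2 source pairing_density //; last exact: BL_bounded_measurable.
  by apply: BL_bounded_measurable; apply/BLP; exists F, Lf.
rewrite source_int (has_derivative_FTC2_add T0 cg1 cg2 hG : _ + _ = _).
apply/eqP; rewrite -subr_eq0 -normr_le0; apply/ler_addgt0Pr => e' e'0; rewrite add0r.
(* 4 T e comes from telescoping; the last e pays for replacing the approximation by mu at time T. At
   time 0 the approximation equals nu0 on measurable sets, so nothing is lost. *)
have [e [e0 he]] : exists e, 0 < e /\ (4 * T + 1) * e <= e'.
  by eexists; exact: small_multiple T4 e'0.
have [d1 d10 weak] := Q_weak F0 Lf0 fF fL k0 l0 r0 psi_test e0.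
have [d2 d20 drift1] := drift_continuous r0 k0 l0 v_sup v_lip v_dist mr0 cdt cdx e0.
have [d3 d30 drift2] := drift_continuous (b := fun _ _ => 0) r0 k0 l0 v_sup v_lip v_dist mr0 ca c0 e0.
have [d4 d40 increment] := primitive_increment cg hG e0.
have [d6 [d60 hd6]] : exists d, 0 < d /\ (C + D) * d <= e.
  by eexists; exact: small_multiple (addr_ge0 C0 D0) e0.
have [d [d0 [dd1 dd2] [dd3 dd4 dd6]]] := common_positive_bound d10 d20 d30 d40 d60.
have [n [mesh_d close TVn]] := muk_good d0.
set m := muk n in close TVn; set s := alpha n in mesh_d.
have [ptn _ m0 mQ] := muk_euler n; rewrite -/s -/m in ptn m0 mQ.
pose p j := part_pt T s j.
pose E j := pairing (m (p j)) (fun x => psi (\val x) (p j)) - G (p j).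
have step j : (j < size s)%N -> `|E j.+1 - E j| <= (p j.+1 - p j) * (4 * e).
  move=> js; have pjT := part_pt_itv ptn (ltnW js); have pjT' := part_pt_itv ptn js.
  have pj_lt := part_pt_lt ptn js; have pj_mesh := part_pt_mesh js.
  rewrite -/(p j) -/(p j.+1) in pjT pjT' pj_lt pj_mesh.
  set h := p j.+1 - p j in pj_mesh *.
  have h0 : 0 < h by rewrite subr_gt0.
  have hd : h < d by exact: le_lt_trans mesh_d.
  have hh : p j + h = p j.+1 by rewrite addrC subrK.
  have hd1 := lt_le_trans hd dd1; have hd4 := lt_le_trans hd dd4.
  have pjj (z : R) : 0 < z -> `|p j - p j| < z by rewrite subrr normr0.
  have dist_le (z : R) : d <= z -> (BL_dist (m (p j)) (mu (p j)) <= z%:E)%E.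
    by move=> dz; rewrite (le_trans (close _ pjT)) // lee_fin.
  have TVj := TVn _ pjT.
  have q : Q f (v (m (p j))) h (m (p j)) (m (p j.+1)).
    by apply: mQ; rewrite -/(p j) -/(p j.+1) ?pj_lt ?lexx.
  have [pj0 pjle] := andP pjT; have [pj0' pjle'] := andP pjT'.
  have := weak _ _ _ (p j) h (v_sup TVj) (v_lip TVj) TVj (ltW h0) hd1 pj0.
  rewrite hh => /(_ _ pjle' q) W.
  have D1 : `|drift v dt dx (m (p j)) (p j) - g1 (p j)| <= e.
    exact: (drift1 _ _ _ _ TVj (limit_TV pjT) pjT pjT (pjj _ d20) (dist_le _ dd2)).
  have D2 : `|drift v a (fun _ _ => 0) (m (p j)) (p j) - g2 (p j)| <= e.
    exact: (drift2 _ _ _ _ TVj (limit_TV pjT) pjT pjT (pjj _ d30) (dist_le _ dd3)).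
  have U := increment _ _ pj0 (ltW pj_lt) pjle' hd4.
  rewrite source in D2.
  exact: (abs_increment_le (ltW h0) W D1 D2 U).
have TT : 0 <= T <= T by rewrite T0' lexx.
have OT : 0 <= (0 : R) <= T by rewrite lexx.
have [hT1 hT2 hT3] := psi_bl T TT; have [_ _ h03] := psi_bl 0 OT.
have last : `|pairing (m T) (fun x => psi (\val x) T) - pairing (mu T) (fun x => psi (\val x) T)| <= e.
  apply: (le_trans (BL_distP (close T TT) hT1 D0 hT2)).
  exact: (le_trans (ler_wpM2l (addr_ge0 C0 D0) dd6) hd6).
have := telescope_le step.
have pN : p (size s) = T := part_pt_last ptn; have p00 : p 0%N = 0 by [].
rewrite /E !pN !p00 subr0.
rewrite (pairing_charge_eq m0 (BL_bounded_measurable h03)) => main.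
exact: (abs_endpoints_le main last he).
Qed.

End limit_of_euler_approximations.

Theorem theorem4p8 (R : realType) (T : R) (T_gt0 : 0 < T)
  (f : I01 R -> R) (f_BL : BL f)
  (v : M01 R -> I01 R -> R)
  (v_BL : forall mu : M01 R, BL (v mu))
  (v_bounds : forall r : R, 0 < r -> exists K L M : R,
    forall mu nu : M01 R, (TV_norm mu <= r%:E)%E -> (TV_norm nu <= r%:E)%E ->
      [/\ (sup_norm (v mu) <= K%:E)%E,
          (lip_const (v mu) <= L%:E)%E &
          (sup_norm (fun x => (v mu x - v nu x)%R)
             <= M%:E * BL_dist mu nu)%E])
  (nu0 : M01 R) (nu0_pos : positive_charge nu0)
  (mu : R -> M01 R)
  (mu_pos : forall t, 0 <= t <= T -> positive_charge (mu t))
  (mu_mild : mild_solution f v T nu0 mu) :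
  weak_solution f v T nu0 mu.
Proof.
move=> psi dx dt psi_test.
have [F [Lf [F0 Lf0 fF fL]]] := (BLP f).1 f_BL.
have [A A0 nu0A] := TV_norm_fin nu0.
set r := A * expR (2 * F * T).
have r0 : 0 <= r by rewrite mulr_ge0 // expR_ge0.
(* The bounds on v are available for positive radii, whereas r = 0 when nu0 has total variation
   0. *)
have r1 : 0 < r + 1 by rewrite ltr_wpDl.
have [K [L [M hv]]] := v_bounds _ r1.
have TV1 rho : (TV_norm rho <= r%:E)%E -> (TV_norm rho <= (r + 1)%:E)%E.
  by move=> /le_trans; apply; rewrite lee_fin lerDl.
have v_sup rho : (TV_norm rho <= r%:E)%E -> forall x, `|v rho x| <= `|K|.
  move=> /TV1 h x; have [/sup_normP h1 _ _] := hv _ _ h h.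
  exact: le_trans (h1 x) (ler_norm _).
have v_lip rho : (TV_norm rho <= r%:E)%E -> lipschitz_I01 `|L| (v rho).
  move=> /TV1 h x y; have [_ /lip_const_le h1 _] := hv _ _ h h.
  by rewrite (le_trans (h1 x y)) // ler_wpM2r // ler_norm.
have v_dist rho nu (d : R) : (TV_norm rho <= r%:E)%E -> (TV_norm nu <= r%:E)%E ->
    (BL_dist rho nu <= d%:E)%E -> forall x, `|v rho x - v nu x| <= `|M| * d.
  move=> /TV1 h /TV1 h' hd; have [_ _ h1] := hv _ _ h h'.
  apply/(sup_normP (fun x => v rho x - v nu x)); rewrite (le_trans h1) // EFinM.
  rewrite (@le_trans _ _ (`|M|%:E * BL_dist rho nu)%E) //.
    by rewrite lee_wpmul2r ?BL_dist_ge0 // lee_fin ler_norm.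
  by rewrite lee_wpmul2l // lee_fin.
have [mu_cont [alpha [muk [sub [_ mesh0 muk_euler sub_incr muk_cvg]]]]] := mu_mild.
(* A strictly increasing index map dominates the identity, so the meshes along the subsequence tend
   to 0 too. *)
have sub_ge n : (n <= sub n)%N.
  by elim: n => // n IH; rewrite (leq_ltn_trans IH) // sub_incr.
have close (d : R) : 0 < d -> exists n, mesh T (alpha (sub n)) < d /\
    forall t, 0 <= t <= T -> (BL_dist (muk (sub n) t) (mu t) <= d%:E)%E.
  move=> d0.
  have /cvgrPdist_lt /(_ d d0) [N _ hN] := mesh0.
  have [N' _ hN'] := ereal_cvg0_lt muk_cvg d0.
  exists (maxn N N'); split.
    have := hN (sub (maxn N N')) (leq_trans (leq_maxl _ _) (sub_ge _)).
    by rewrite /= sub0r normrN => /(le_lt_trans (ler_norm _)).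
  move=> t tT; have := hN' (maxn N N') (leq_maxr _ _) => /ltW; apply: le_trans.
  by apply: ereal_sup_ubound; exists t => //; rewrite /= in_itv.
apply: (limit_weak T_gt0 F0 Lf0 fF fL (normr_ge0 K) (normr_ge0 L) (normr_ge0 M) A0 erefl
  v_sup v_lip v_dist _ mu_cont (fun n => muk_euler (sub n)) close psi_test).
by rewrite nu0A.
Qed.
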